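(* Let $\beta>0$ and let $V\in L^1_{\mathrm{loc}}(\mathbb{R}^2)$ be a radially symmetric function satisfying $V\ge C$ a.e. in $D(0,R_2)\setminus D(0,R_1)$ for some constants $C>0$, $R_2>R_1>0$. Assume that $$V^-(r)\le C_0r^{l_0}\ \text{ for a.e. } r\ge1,\qquad V^+(r)\le C_1r^{l_1}\ \text{ for a.e. } r\le1,\qquad V^+(r)\le C_2r^{l_2}\ \text{ for a.e. } r\ge1,$$ where $C_0,C_1,C_2$ are positive and $l_0,l_1,l_2\in\mathbb{R}$. If $l_0<2\beta-2$, $l_1>\beta-2$ and $l_2<\beta-2$, then there exists a radially symmetric function $\psi\in H^1_{\mathrm{loc}}(\mathbb{R}^2)\cap C^1(\mathbb{R}^2\setminus\{0\})$ with $Ve^{\psi}\in L^1(\mathbb{R}^2)$ such that $$-\Delta\psi=4\pi\beta Ve^{\psi}\quad\text{weakly in }\mathbb{R}^2,\qquad\int_{\mathbb{R}^2}Ve^{\psi}=1.$$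
   Context: $D(x,r)\subset\mathbb{R}^2$ is the disk of radius $r$ centered at $x$. $V^+:=\max(V,0)$, $V^-:=V^+-V$. For a radially symmetric function, $V(r)$ denotes its value at points with $|x|=r$. ''Weakly'' means in the sense of distributions. *)

(* Defs.v *)
From HB Require Import structures.
From mathcomp Require Import all_boot all_order all_algebra.
From mathcomp Require Import all_classical all_reals all_analysis.

Set Implicit Arguments.
Unset Strict Implicit.
Unset Printing Implicit Defensive.

Import Order.TTheory GRing.Theory Num.Theory numFieldNormedType.Exports.

Local Open Scope classical_set_scope.
Local Open Scope ring_scope.

(* [plane R] is convertible to [R * R]; the alias [measurableTypeR] selects the
   Borel sigma-algebra on which [lebesgue_measure] is defined.  Topology and
   derivatives are inferred on [R * R]. *)
Notation plane R := (measurableTypeR R * measurableTypeR R)%type.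

Notation leb1 R := (@lebesgue_measure R).

Notation leb2 R := (@lebesgue_measure R \x @lebesgue_measure R)%E.

Section Plane.
Context {R : realType}.

(* Needed because the library norm on [R * R] is the sup norm. *)
Definition eucl (x : R * R) : R := Num.sqrt (x.1 ^+ 2 + x.2 ^+ 2).

Definition disk (x : R * R) (r : R) : set (R * R) := [set y | eucl (y - x) < r].

Definition radially_symmetric (f : R * R -> R) :=
  forall x y, eucl x = eucl y -> f x = f y.

(* Meaningful for radially symmetric [f] and [0 <= r]: the value of [f] on the
   circle of radius [r]. *)
Definition radial_value (f : R * R -> R) (r : R) : R := f (r, 0).

Definition pd1 (f : R * R -> R) : R * R -> R := fun x => 'D_(1, 0) f x.

Definition pd2 (f : R * R -> R) : R * R -> R := fun x => 'D_(0, 1) f x.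

Definition laplacian (f : R * R -> R) : R * R -> R :=
  fun x => pd1 (pd1 f) x + pd2 (pd2 f) x.

(* [U] is meant to be open. *)
Fixpoint Ck_on (U : set (R * R)) (k : nat) (f : R * R -> R) : Prop :=
  (forall x, U x -> {for x, continuous f}) /\
  if k is k'.+1 then
    [/\ forall x, U x -> derivable f x (1, 0) /\ derivable f x (0, 1),
        Ck_on U k' (pd1 f) & Ck_on U k' (pd2 f)]
  else True.

Definition test_function (phi : R * R -> R) :=
  (forall k, Ck_on setT k phi) /\ compact (closure [set x | phi x != 0]).

Definition Lp_loc (p : nat) (f : plane R -> R) :=
  measurable_fun setT f /\
  forall K : set (R * R), compact K ->
    (\int[leb2 R]_(x in K) (`|f x| ^+ p)%:E < +oo)%E.

Definition weak_gradient (f g1 g2 : plane R -> R) :=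
  forall phi, test_function phi ->
  \int[leb2 R]_x (f x * pd1 phi x) = - (\int[leb2 R]_x (g1 x * phi x)) /\
  \int[leb2 R]_x (f x * pd2 phi x) = - (\int[leb2 R]_x (g2 x * phi x)).

Definition H1_loc (f : plane R -> R) := Lp_loc 2 f /\
  exists g1 g2, [/\ Lp_loc 2 g1, Lp_loc 2 g2 & weak_gradient f g1 g2].

(* - Laplacian f = g in the sense of distributions, for [f] and [g] locally
   integrable. *)
Definition weak_poisson (f g : plane R -> R) :=
  forall phi, test_function phi ->
  \int[leb2 R]_x (f x * - laplacian phi x) = \int[leb2 R]_x (g x * phi x).

End Plane.

(* Main.v *)
Require Import Defs.
From HB Require Import structures.
From mathcomp Require Import all_boot all_order all_algebra.
From mathcomp Require Import all_classical all_reals all_analysis.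
From mathcomp Require Import measurable_realfun ring lra.

(* Write [psi r = v (ln r) - 2 beta (ln r)^+ - s].  The equation is the Euler-Lagrange
   equation of [F v * exp (- e v / (4 beta))] over [v 0 = 0], where
   [F v = \int 2 pi r V(r) max(r, 1)^(- 2 beta) e^(v (ln r)) dr] and [e v = \int v'^2].
   The growth conditions on [V^+] bound the weight in [F] by [w(r) e^(- b' |ln r|)] with
   [w] integrable and [b' > beta]; as [v t <= b' |t| + e v / (4 b')], a maximising sequence
   has bounded energy and subconverges to a maximiser by Ascoli and Fatou.  Perturbing it by
   piecewise linear ramps gives [r psi'(r) = - 2 beta \int_(|x| < r) V e^psi], which becomes
   the weak equation after an integration by parts along rays in polar coordinates. *)

Set Implicit Arguments.
Unset Strict Implicit.
Unset Printing Implicit Defensive.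

Import Order.TTheory GRing.Theory Num.Theory numFieldNormedType.Exports.

Local Open Scope classical_set_scope.
Local Open Scope ring_scope.

(** In [t = ln r] the Dirichlet energy of a radial function is [2 pi \int psi'(t)^2 dt]. A solution
    of total mass one has slope [0] at [t = - oo] and [- 2 beta] at [t = + oo], hence infinite
    energy; removing [2 beta t^+] leaves a [v] whose slope vanishes at both ends. The corner at
    [t = 0] matches the normalisation [v 0 = 0]: for unnormalised competitors this is a factor
    [e^(- u 0)], whose logarithm varies by a Dirac mass at [0]. Stationarity of
    [ln F - e / (4 beta)] then says that [psi''] is [- 2 beta] times a density of mass one, with
    [s = ln F]. Measured in [dt], the bounds on [V^+] behave like [e^((l1 + 2) t)] at [- oo] and
    [e^((l2 + 2 - 2 beta) t)] at [+ oo]; the conditions on [l1] and [l2] say exactly that both decay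
    faster than [e^(- beta |t|)]. For the negative part, [l0] leaves a margin at infinity, but near
    the origin [V^-] is merely integrable, so [V^- e^v] need not be integrable for a [v] of finite
    energy. The passage to the limit must use upper bounds alone, and [F] may be negative, so the
    annulus where [V >= C] has to supply one [v] with [F v > 0]. *)

(** * Pointwise cluster points of sequences of functions *)

(** Tychonoff yields one limit [p] for all indices at once. As [I] may be uncountable, no single
    subsequence need converge everywhere; one is extracted for each countable list [c], and all of
    them share the limit [p]. *)
Lemma cluster_subseq (R : realType) (I : eqType) (f : nat -> I -> R) (B : I -> R) :
  (forall n i, `|f n i| <= B i) ->
  exists p : I -> R, forall c : nat -> I, exists2 nk : nat -> nat,
    (forall k, k <= nk k)%N &
    forall j, (fun k => f (nk k) (c j)) @ \oo --> p (c j).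
Proof.
move=> fB; pose T := prod_topology (fun _ : I => R).
pose g : nat -> T := f.
have : compact [set h : T | forall i, `[- B i, B i]%classic (h i)].
  by apply: (@tychonoff I (fun _ => R) (fun i => `[- B i, B i]%classic)) => i;
    exact: segment_compact.
move=> /(_ (g @ \oo) _) [|p [_ clp]].
  by exists 0%N => // n _ i; rewrite /= in_itv /= -ler_norml.
exists p => c.
(* A neighbourhood in the product topology constrains finitely many coordinates, here the first [k]
   entries of [c]. The induction varies their number [m] while the tolerance stays fixed. *)
have near_p k : nbhs p [set h : T | forall j, (j < k)%N -> `|p (c j) - h (c j)| < k.+1%:R^-1].
  suff H m : nbhs p [set h : T | forall j, (j < m)%N -> `|p (c j) - h (c j)| < k.+1%:R^-1].
    exact: H.
  elim: m => [|m IH]; first by apply: filterE.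
  have Hm : \forall h \near p, `|p (c m) - h (c m)| < k.+1%:R^-1.
    have pc : (fun h : T => h (c m)) @ p --> p (c m).
      exact: (@proj_continuous I (fun _ => R) (c m) p).
    by move/cvgrPdist_lt : pc => /(_ k.+1%:R^-1); apply; rewrite invr_gt0.
  near=> h => j; rewrite ltnS leq_eqVlt => /orP[/eqP ->|jm].
    by near: h.
  by move: j jm; near: h.
have ex k : exists n, (k <= n)%N /\ forall j, (j < k)%N -> `|p (c j) - f n (c j)| < k.+1%:R^-1.
  have [|_ [[n kn <-] pn]] := clp [set g n | n in [set n | (k <= n)%N]] _ _ (near_p k).
    by exists k => // n kn; exists n.
  by exists n.
exists (fun k => projT1 (cid (ex k))) => [k|j].
  by case: cid => n [].
apply/cvgrPdist_lt => e e0; near=> k; case: cid => n /= [_ nP].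
apply: lt_trans (nP _ _) _; first by near: k; exact: nbhs_infty_gt.
near: k; exact: near_infty_natSinv_lt (PosNum e0).
Unshelve. all: by end_near. Qed.

(** * Functions of finite Dirichlet energy *)

(* [e] bounds the Dirichlet energy of [u]; [rho] plays the role of a primitive
   of the square of the derivative of [u].  This form is stable under pointwise
   limits. *)
Definition energy_le (R : realType) (u rho : R -> R) (e : R) :=
  (forall s t, s <= t -> (u t - u s) ^+ 2 <= (t - s) * (rho t - rho s)) /\
  (forall s t, s <= t -> 0 <= rho t - rho s <= e).

Definition clamp (R : realType) (a b t : R) := Num.max a (Num.min t b).

(** Decreasing from [1] to [0]: for [r > 0], [ramp a b (ln r)] is a continuous version of the
    indicator of a disk with radius between [expR a] and [expR b]. Such ramps are the directions of
    the first variation. *)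
Definition ramp (R : realType) (a b t : R) := (b - clamp a b t) / (b - a).

Section energy.
Context {R : realType}.
Implicit Types (u rho : R -> R) (e a b s t : R).

Lemma energy_le_ge0 u rho e : energy_le u rho e -> 0 <= e.
Proof.
by move=> [_ /(_ 0 0 (lexx _))]; rewrite subrr => /andP[].
Qed.

Lemma energy_le_holder u rho e s t : energy_le u rho e ->
  (u t - u s) ^+ 2 <= e * `|t - s|.
Proof.
move=> [E1 E2]; wlog st : s t / s <= t => [H|].
  have [/H//|/ltW/H] := leP s t.
  by rewrite -(opprB (u t)) sqrrN distrC.
rewrite ger0_norm ?subr_ge0// mulrC (le_trans (E1 _ _ st))//.
by apply: ler_wpM2l; rewrite ?subr_ge0//; have /andP[] := E2 _ _ st.
Qed.

(* AM-GM: [e |t| <= (b |t| + e / (4 b))^2] *)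
Lemma energy_le_upper u rho e b t : energy_le u rho e -> u 0 = 0 -> 0 < b ->
  u t <= b * `|t| + e / (4 * b).
Proof.
move=> E u0 b0; have := energy_le_holder 0 t E; rewrite u0 !subr0 => H.
have e0 := energy_le_ge0 E.
set y := _ + _; have y0 : 0 <= y by rewrite addr_ge0 ?divr_ge0// mulr_ge0//; lra.
have ey : e * `|t| <= y ^+ 2.
  rewrite -subr_ge0 (_ : _ - _ = (b * `|t| - e / (4 * b)) ^+ 2) ?sqr_ge0//.
  by rewrite /y; field; rewrite gt_eqF.
rewrite leNgt; apply/negP => yu.
have : y ^+ 2 < u t ^+ 2 by rewrite ltr_pXn2r// nnegrE; lra.
lra.
Qed.

Lemma energy_le_continuous u rho e : energy_le u rho e -> continuous u.
Proof.
move=> E t; apply/cvgrPdist_lt => d d0; have e0 := energy_le_ge0 E.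
have q0 : 0 < d ^+ 2 / (e + 1) by rewrite divr_gt0 ?exprn_gt0//; lra.
near=> s; have H := energy_le_holder s t E.
rewrite -(@ltr_pXn2r _ 2)// ?nnegrE// ?(ltW d0)// real_normK ?num_real//.
apply: le_lt_trans H _; rewrite (@le_lt_trans _ _ ((e + 1) * `|t - s|))//.
  by rewrite ler_wpM2r//; lra.
rewrite mulrC -ltr_pdivlMr; last lra.
near: s; exact: (nbhsx_ballx t _ q0).
Unshelve. all: by end_near. Qed.

Lemma energy_le_scale u rho e c : energy_le u rho e ->
  energy_le (fun t => c * u t) (fun t => c ^+ 2 * rho t) (c ^+ 2 * e).
Proof.
move=> [E1 E2]; split=> s t st; rewrite -!mulrBr.
  rewrite exprMn [leRHS]mulrCA; apply: ler_wpM2l; [exact: sqr_ge0|exact: E1].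
have /andP[? ?] := E2 _ _ st; apply/andP; split.
  by rewrite mulr_ge0 ?sqr_ge0.
by rewrite ler_wpM2l ?sqr_ge0.
Qed.

Lemma energy_le_shift u rho e c : energy_le u rho e ->
  energy_le (fun t => u t + c) rho e.
Proof. by move=> [E1 E2]; split=> // s t st; rewrite opprD addrACA subrr addr0; exact: E1. Qed.

Lemma clamp_le a b t : a <= b -> t <= a -> clamp a b t = a.
Proof. by move=> ab ta; rewrite /clamp min_l ?max_l// (le_trans ta). Qed.

Lemma clamp_id a b t : a <= t -> t <= b -> clamp a b t = t.
Proof. by move=> ta tb; rewrite /clamp min_l ?max_r. Qed.

Lemma clamp_ge a b t : a <= b -> b <= t -> clamp a b t = b.
Proof. by move=> ab bt; rewrite /clamp min_r ?max_r. Qed.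

Lemma clamp_itv a b t : a <= b -> a <= clamp a b t <= b.
Proof. by move=> ab; rewrite /clamp le_max lexx/= ge_max ab ge_min lexx orbT. Qed.

Lemma ramp_itv a b t : a < b -> 0 <= ramp a b t <= 1.
Proof.
move=> ab; have /andP[ac cb] := clamp_itv t (ltW ab).
rewrite /ramp divr_ge0 ?subr_ge0// ?(ltW ab)//=.
by rewrite ler_pdivrMr ?subr_gt0// mul1r lerB.
Qed.

Lemma ramp_le a b t : a < b -> t <= a -> ramp a b t = 1.
Proof. by move=> ab ta; rewrite /ramp (clamp_le (ltW ab) ta) divff// subr_eq0 gt_eqF. Qed.

Lemma ramp_ge a b t : a < b -> b <= t -> ramp a b t = 0.
Proof. by move=> ab bt; rewrite /ramp (clamp_ge (ltW ab) bt) subrr mul0r. Qed.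

Lemma continuous_clamp a b : continuous (clamp a b).
Proof.
move=> t; rewrite /clamp; apply: (@continuous_max _ _ (cst a) (fun t => Num.min t b)).
  exact: cvg_cst.
by apply: (@continuous_min _ _ id (cst b)); [exact: cvg_id|exact: cvg_cst].
Qed.

Lemma continuous_ramp a b : continuous (ramp a b).
Proof.
move=> t; apply: cvgM; last exact: cvg_cst.
by apply: cvgB; [exact: cvg_cst|exact: continuous_clamp].
Qed.

(** Cauchy-Schwarz for two terms: the double product is at most [2 sqrt (p B q A) <= p B + q A]. It
    concatenates the inequality of [energy_le] over adjacent intervals. *)
Lemma sqr_glue (x y p q A B : R) : 0 <= p -> 0 <= q -> 0 <= A -> 0 <= B ->
  x ^+ 2 <= p * A -> y ^+ 2 <= q * B -> (x + y) ^+ 2 <= (p + q) * (A + B).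
Proof.
move=> p0 q0 A0 B0 xA yB.
have H : x * y *+ 2 <= p * B + q * A.
  have pqAB : (x * y) ^+ 2 <= (p * B) * (q * A).
    rewrite exprMn (_ : p * B * _ = (p * A) * (q * B)); last by ring.
    exact: ler_pM (sqr_ge0 _) (sqr_ge0 _) xA yB.
  have pB0 : 0 <= p * B by exact: mulr_ge0.
  have qA0 : 0 <= q * A by exact: mulr_ge0.
  move: pqAB pB0 qA0; move: (p * B) (q * A) (x * y) => al ga z zz al0 ga0.
  rewrite leNgt; apply/negP => lt.
  have z0 : 0 <= z by lra.
  have : (al + ga) ^+ 2 < (z *+ 2) ^+ 2 by rewrite ltr_pXn2r// nnegrE; lra.
  by have := sqr_ge0 (al - ga); lra.
lra.
Qed.

(** Formally [rho] is a primitive of [u'^2], and [(u' + c)^2 = u'^2 + 2 c u' + c^2] on [[a, b]]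
    accounts for the added terms. Without derivatives, the inequality is checked where the clamp is
    constant and where it is the identity, then glued at [a] and [b]. *)
Lemma energy_le_clamp u rho e a b c : a < b -> energy_le u rho e ->
  energy_le (fun t => u t + c * clamp a b t)
    (fun t => rho t + 2 * c * u (clamp a b t) + c ^+ 2 * clamp a b t)
    (e + 2 * c * (u b - u a) + c ^+ 2 * (b - a)).
Proof.
move=> ab [E1 E2]; set u' := fun t => _; set rho' := fun t => _.
(* The monotonicity of [rho'] is carried along because [sqr_glue] needs nonnegative increments. *)
pose P s t := (u' t - u' s) ^+ 2 <= (t - s) * (rho' t - rho' s) /\ 0 <= rho' t - rho' s.
have Pglue s m t : s <= m -> m <= t -> P s m -> P m t -> P s t.
  move=> sm mt [P1 P2] [P3 P4]; split.
    have -> : u' t - u' s = (u' m - u' s) + (u' t - u' m) by ring.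
    have -> : rho' t - rho' s = (rho' m - rho' s) + (rho' t - rho' m) by ring.
    have -> : t - s = (m - s) + (t - m) by ring.
    by apply: sqr_glue => //; rewrite subr_ge0.
  by rewrite (_ : _ - _ = (rho' m - rho' s) + (rho' t - rho' m)); [exact: addr_ge0|ring].
have Peq s t : s <= t -> clamp a b s = clamp a b t -> P s t.
  move=> st cst; rewrite /P /u' /rho' cst; split.
    set k := c * _; set l := 2 * c * _; set m := c ^+ 2 * _.
    rewrite (_ : _ - _ = u t - u s); last by ring.
    by rewrite (_ : rho t + _ + _ - _ = rho t - rho s); [exact: E1|ring].
  by have /andP[+ _] := E2 _ _ st; lra.
have Pab s t : a <= s -> s <= t -> t <= b -> P s t.
  move=> as_ st tb.
  rewrite /P /u' /rho' (clamp_id as_ (le_trans st tb)) (clamp_id (le_trans as_ st) tb).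
  have H := E1 _ _ st; have /andP[H0 _] := E2 _ _ st.
  split; first by move: H; lra.
  move: st; rewrite le_eqVlt => /orP[/eqP ->|st]; first by rewrite subrr.
  have ts : 0 < t - s by rewrite subr_gt0.
  (* Here monotonicity follows from the first inequality: [t - s] times the increment of [rho']
     dominates a square. *)
  have := sqr_ge0 ((u t - u s) + c * (t - s)).
  have : 0 <= (t - s) * (rho t + 2 * c * u t + c ^+ 2 * t - (rho s + 2 * c * u s + c ^+ 2 * s)).
    apply: le_trans (sqr_ge0 ((u t - u s) + c * (t - s))) _.
    by move: H; lra.
  by rewrite pmulr_rge0.
have ab' := ltW ab.
have Pb s t : s <= t -> t <= b -> P s t.
  move=> st tb; have [ta|/ltW at_] := leP t a.
    by apply: Peq => //; rewrite (clamp_le ab' ta) (clamp_le ab' (le_trans st ta)).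
  have [as_|/ltW sa] := leP a s; first exact: Pab.
  apply: (Pglue _ a) => //; last exact: Pab.
  by apply: Peq => //; rewrite (clamp_le ab' sa) (clamp_le ab' (lexx a)).
have PP s t : s <= t -> P s t.
  move=> st; have [tb|/ltW bt] := leP t b; first exact: Pb.
  have [bs|/ltW sb] := leP b s.
    by apply: Peq => //; rewrite (clamp_ge ab' bs) (clamp_ge ab' bt).
  apply: (Pglue _ b) => //; first exact: Pb.
  by apply: Peq => //; rewrite (clamp_ge ab' (lexx b)) (clamp_ge ab' bt).
split=> s t st; have [H1 H2] := PP _ _ st; first exact: H1.
rewrite H2/=.
(* By monotonicity [[s, t]] may be enlarged until it contains [[a, b]]; there the terms added to
   [rho] take exactly the values added to [e]. *)
have sa : Num.min s a <= s by rewrite ge_min lexx.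
have tb : t <= Num.max t b by rewrite le_max lexx.
have [_ H3] := PP _ _ sa; have [_ H4] := PP _ _ tb.
apply: (@le_trans _ _ (rho' (Num.max t b) - rho' (Num.min s a))); first lra.
have /andP[_ H5] := E2 _ _ (le_trans sa (le_trans st tb)).
rewrite /rho' (@clamp_le a b (Num.min s a)) ?ge_min ?lexx ?orbT//.
rewrite (@clamp_ge a b (Num.max t b)) ?le_max ?lexx ?orbT//.
lra.
Qed.

Lemma energy_le_ramp u rho e a b c : a < b -> energy_le u rho e ->
  exists rho', energy_le (fun t => u t + c * ramp a b t) rho'
    (e - 2 * c * ((u b - u a) / (b - a)) + c ^+ 2 / (b - a)).
Proof.
move=> ab E; have ba : b - a != 0 by rewrite subr_eq0 gt_eqF.
pose c' := - c / (b - a).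
have := energy_le_shift (c * b / (b - a)) (energy_le_clamp c' ab E).
set rho' := (X in energy_le _ X); set e' := (X in energy_le _ _ X).
set u' := (X in energy_le X); move=> E'; exists rho'.
rewrite (_ : (fun t => _) = u'); last first.
  by apply/funext => t; rewrite /u' /ramp /c'; field.
rewrite (_ : _ + _ = e')//; rewrite /e' /c'; field.
exact: ba.
Qed.

End energy.

(** * Integrals of real functions and Fatou's lemma *)

Lemma cvg_EFin_comp (R : realType) (I : Type) (F : set_system I) {FF : Filter F}
  (f : I -> R) a : f @ F --> a -> EFin \o f @ F --> a%:E.
Proof. by move=> fa; apply: cvg_EFin => //; exact: nearW. Qed.

Section integral_lemmas.
Context d (X : measurableType d) (R : realType) (mu : {measure set X -> \bar R}).
Implicit Types f g : X -> R.

Lemma integrable_le_norm (D : set X) f g : measurable D -> measurable_fun D f ->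
  mu.-integrable D (EFin \o g) -> (forall x, D x -> `|f x| <= g x) ->
  mu.-integrable D (EFin \o f).
Proof.
move=> mD mf ig fg; apply: le_integrable ig => //; first exact/measurable_EFinP.
by move=> x Dx /=; rewrite lee_fin (le_trans (fg _ Dx))// ler_norm.
Qed.

Lemma measurable_integrable (D : set X) f :
  mu.-integrable D (EFin \o f) -> measurable_fun D f.
Proof. by move=> /measurable_int/measurable_EFinP. Qed.

Lemma EFin_Rintegral (D : set X) f : measurable D -> mu.-integrable D (EFin \o f) ->
  (\int[mu]_(x in D) f x)%:E = (\int[mu]_(x in D) (f x)%:E)%E.
Proof. by move=> mD fi; rewrite fineK// integrable_fin_num. Qed.

Lemma fatou_le (f_ : nat -> X -> R) f (b_ : nat -> R) b :
  (forall n, measurable_fun setT (f_ n)) -> (forall n x, 0 <= f_ n x) ->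
  (forall x, f_ ^~ x @ \oo --> f x) ->
  (forall n, (\int[mu]_x (f_ n x)%:E <= (b_ n)%:E)%E) -> b_ @ \oo --> b ->
  (\int[mu]_x (f x)%:E <= b%:E)%E.
Proof.
move=> mf f0 ff fb bb.
have mE n : measurable_fun setT (EFin \o f_ n) by exact/measurable_EFinP.
have f0' n x : setT x -> (0 <= (EFin \o f_ n) x)%E by rewrite /= lee_fin.
have := fatou mu measurableT mE f0'.
rewrite (_ : (\int[mu]_x limn_einf _ = \int[mu]_x (f x)%:E)%E); last first.
  apply: eq_integral => x _.
  by have [-> _] := cvg_limn_einf_sup (cvg_EFin_comp (ff x)).
move=> /le_trans; apply.
have cb : (fun n => (b_ n)%:E) @ \oo --> b%:E by exact: cvg_EFin_comp.
rewrite limn_einf_lim -(cvg_lim _ cb)//; apply: lee_lim.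
- exact: is_cvg_einfs.
- by apply/cvg_ex; exists b%:E.
- near=> n; apply: le_trans (fb n).
  by apply: ereal_inf_lbound; exists n => /=.
Unshelve. all: by end_near. Qed.

(** Fatou's lemma for [g - f_ n]. Nothing dominates [f_ n] from below; the lower bounds [c_ n] on
    the integrals take over that role and give the integrability of the limit. *)
Lemma reverse_fatou (f_ : nat -> X -> R) f g (c_ : nat -> R) c :
  (forall n, mu.-integrable setT (EFin \o f_ n)) ->
  measurable_fun setT f -> mu.-integrable setT (EFin \o g) ->
  (forall n x, f_ n x <= g x) -> (forall x, f_ ^~ x @ \oo --> f x) ->
  (forall n, c_ n <= \int[mu]_x f_ n x) -> c_ @ \oo --> c ->
  mu.-integrable setT (EFin \o f) /\ c <= \int[mu]_x f x.
Proof.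
move=> fi mf gi fg ff cf cc.
have mg := measurable_integrable gi.
have gf0 x : 0 <= g x - f x.
  by rewrite subr_ge0; apply: (ler_cvg_to (ff x) (cvg_cst _)); exact: nearW.
have H : (\int[mu]_x (g x - f x)%:E <= (\int[mu]_x g x - c)%:E)%E.
  apply: (@fatou_le (fun n x => g x - f_ n x) _ (fun n => \int[mu]_x g x - c_ n)).
  - by move=> n; apply: measurable_funB => //; exact: measurable_integrable (fi n).
  - by move=> n x; rewrite subr_ge0.
  - by move=> x; apply: cvgB; [exact: cvg_cst|exact: ff].
  - move=> n; rewrite -EFin_Rintegral//.
      by rewrite lee_fin RintegralB// lerB.
    exact: (integrableB _ gi (fi n)).
  - by apply: cvgB => //; exact: cvg_cst.
have gfi : mu.-integrable setT (EFin \o (fun x => g x - f x)).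
  apply/integrableP; split; first exact/measurable_EFinP/measurable_funB.
  apply: le_lt_trans (ltry (\int[mu]_x g x - c)).
  apply: le_trans H; rewrite le_eqVlt; apply/orP; left; apply/eqP.
  by apply: eq_integral => x _ /=; rewrite ger0_norm.
have fi' : mu.-integrable setT (EFin \o f).
  rewrite (_ : EFin \o f = (fun x => (g x)%:E - (g x - f x)%R%:E)%E).
    exact: (integrableB _ gi gfi).
  by apply/funext => x /=; rewrite -EFinB; congr EFin; lra.
split=> //; move: H; rewrite -EFin_Rintegral// lee_fin RintegralB//; lra.
Qed.

End integral_lemmas.

(** * Compactness of families of bounded energy *)

Section subsequence.
Context {R : realType}.

(** The energy inequalities involve finitely many coordinates at a time, so they pass to any
    pointwise cluster point. The common Hoelder bound then upgrades convergence at rational times to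
    convergence at all times along one subsequence. *)
Lemma energy_le_compact (u_ rho_ : nat -> R -> R) (e_ : nat -> R) (E : R) :
  (forall n, energy_le (u_ n) (rho_ n) (e_ n)) -> (forall n, u_ n 0 = 0) ->
  (forall n, e_ n <= E) ->
  exists u rho e, exists nk : nat -> nat, [/\ energy_le u rho e, u 0 = 0,
    (forall k, k <= nk k)%N, e_ \o nk @ \oo --> e &
    forall t, (fun k => u_ (nk k) t) @ \oo --> u t].
Proof.
move=> En u0 eE.
(* The coordinates are the energy ([inl None]), the values of [u_ n] and the increments of [rho_ n]
   from [0]; [rho_ n] itself is only determined up to a constant and need not be bounded. *)
pose f n (i : option R + R) : R := match i with
  | inl (Some t) => u_ n t | inl None => e_ n | inr t => rho_ n t - rho_ n 0 end.
pose B (i : option R + R) : R := match i with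
  | inl (Some t) => E * `|t| + 1 | inl None => E | inr t => E end.
have e0 n : 0 <= e_ n by exact: energy_le_ge0 (En n).
have E0 : 0 <= E by exact: le_trans (e0 0%N) (eE 0%N).
have fB n i : `|f n i| <= B i.
  case: i => [[t|]|t] /=.
  - have := energy_le_holder 0 t (En n); rewrite u0 !subr0 => H.
    have H1 : `|u_ n t| ^+ 2 <= E * `|t|.
      by rewrite real_normK ?num_real// (le_trans H)// ler_wpM2r.
    have H2 := normr_ge0 (u_ n t).
    have H3 : 0 <= E * `|t| by rewrite mulr_ge0.
    rewrite leNgt; apply/negP => lt.
    have : (E * `|t| + 1) ^+ 2 < `|u_ n t| ^+ 2 by rewrite ltr_pXn2r// nnegrE; lra.
    move: (E * `|t|) H1 H3 => z; nra.
  - by rewrite ger0_norm.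
  - have [_ E2] := En n; apply: le_trans (eE n).
    have [/E2/andP[? ?]|/ltW/E2/andP[? ?]] := leP 0 t; first by rewrite ger0_norm.
    by rewrite distrC ger0_norm.
have [p pP] := cluster_subseq fB.
exists (fun t => p (inl (Some t))), (fun t => p (inr t)), (p (inl None)).
have pL (l : seq (option R + R)) : exists2 nk : nat -> nat, (forall k, k <= nk k)%N &
    forall i, i \in l -> (fun k => f (nk k) i) @ \oo --> p i.
  have [nk nkk H] := pP (nth (inr 0) l); exists nk => // i il.
  by have := H (index i l); rewrite nth_index.
have [nk nkk H] := pP (fun j => if j is j'.+1 then
  inl (Some (if unpickle j' is Some q then ratr q else 0)) else inl None).
have He : e_ \o nk @ \oo --> p (inl None) by exact: (H 0%N).
have Hp : energy_le (fun t => p (inl (Some t))) (fun t => p (inr t)) (p (inl None)).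
  split=> s t st.
    have [mk _ Hm] := pL [:: inl (Some s); inl (Some t); inr s; inr t].
    have c1 := Hm (inl (Some s)); have c2 := Hm (inl (Some t)).
    have c3 := Hm (inr s); have c4 := Hm (inr t).
    rewrite !inE !eqxx ?orbT /= in c1 c2 c3 c4.
    have {}c1 := c1 isT; have {}c2 := c2 isT; have {}c3 := c3 isT; have {}c4 := c4 isT.
    have L : (fun k => (f (mk k) (inl (Some t)) - f (mk k) (inl (Some s))) *
        (f (mk k) (inl (Some t)) - f (mk k) (inl (Some s)))) @ \oo -->
        (p (inl (Some t)) - p (inl (Some s))) * (p (inl (Some t)) - p (inl (Some s))).
      by apply: cvgM; apply: cvgB.
    have L' : (fun k => (t - s) * (f (mk k) (inr t) - f (mk k) (inr s))) @ \oo -->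
        (t - s) * (p (inr t) - p (inr s)).
      by apply: cvgM; [exact: cvg_cst|exact: cvgB].
    rewrite expr2; apply: (ler_cvg_to L L'); apply: nearW => k /=.
    have [E1 _] := En (mk k); have := E1 _ _ st; rewrite -expr2.
    by rewrite (_ : _ - _ - _ = rho_ (mk k) t - rho_ (mk k) s); [|ring].
  have [mk _ Hm] := pL [:: inl None; inr s; inr t].
  have c1 := Hm (inl None); have c3 := Hm (inr s); have c4 := Hm (inr t).
  rewrite !inE !eqxx ?orbT /= in c1 c3 c4.
  have {}c1 := c1 isT; have {}c3 := c3 isT; have {}c4 := c4 isT.
  have L : (fun k => f (mk k) (inr t) - f (mk k) (inr s)) @ \oo -->
      p (inr t) - p (inr s) by exact: cvgB.
  have B2 k : 0 <= f (mk k) (inr t) - f (mk k) (inr s) <= e_ (mk k).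
    have [_ E2] := En (mk k); have := E2 _ _ st => /=.
    by rewrite (_ : _ - _ - _ = rho_ (mk k) t - rho_ (mk k) s); [|ring].
  apply/andP; split => /=.
    apply: (cvgr_to_ge L); apply: nearW => k.
    by have /andP[] := B2 k.
  by apply: (ler_cvg_to L c1); apply: nearW => k; have /andP[] := B2 k.
exists nk; split => //.
  have [mk _ Hm] := pL [:: inl (Some 0)].
  have {}Hm := Hm (inl (Some 0)); rewrite inE eqxx in Hm; have {}Hm := Hm isT.
  have c0 : (fun k => f (mk k) (inl (Some 0))) @ \oo --> (0 : R).
    by rewrite (_ : (fun k => _) = cst 0); [exact: cvg_cst|apply/funext => k /=; rewrite u0].
  exact: (cvg_unique _ Hm c0).
move=> t; apply/cvgrPdist_lt => d d0.
(* Within this distance of [t] every function of energy at most [E] varies by less than [d / 3]; the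
   [1] guards against [E = 0]. *)
have q0 : 0 < (d / 3) ^+ 2 / (E + 1) by rewrite divr_gt0 ?exprn_gt0//; lra.
have [q] : exists q, ratr q \in `]t, t + (d / 3) ^+ 2 / (E + 1)[.
  by apply: rat_in_itvoo; rewrite ltrDl.
rewrite in_itv /= => /andP[tq qt].
have close u rho e : energy_le u rho e -> e <= E -> `|u t - u (ratr q)| < d / 3.
  move=> Eu ee; have := energy_le_holder (ratr q) t Eu => {}Eu.
  have d30 : 0 <= d / 3 by lra.
  rewrite -(@ltr_pXn2r _ 2)// ?nnegrE//.
  rewrite real_normK ?num_real// (le_lt_trans Eu)//.
  apply: (@le_lt_trans _ _ ((E + 1) * `|t - ratr q|)).
    by rewrite ler_wpM2r//; lra.
  rewrite mulrC -ltr_pdivlMr; last lra.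
  by rewrite ltr0_norm; lra.
have Hq : (fun k => u_ (nk k) (ratr q)) @ \oo --> p (inl (Some (ratr q))).
  by have := H (pickle q).+1; rewrite pickleK.
near=> k.
have -> : p (inl (Some t)) - u_ (nk k) t = (p (inl (Some t)) - p (inl (Some (ratr q)))) +
  (p (inl (Some (ratr q))) - u_ (nk k) (ratr q)) + (u_ (nk k) (ratr q) - u_ (nk k) t) by ring.
have pE : p (inl None) <= E by apply: (cvgr_to_le He); apply: nearW => k0; exact: eE.
have h1 := close _ _ _ Hp pE.
have h2 := close _ _ _ (En (nk k)) (eE (nk k)); rewrite distrC in h2.
have h3 : `|p (inl (Some (ratr q))) - u_ (nk k) (ratr q)| < d / 3.
  by near: k; move/cvgrPdist_lt : Hq; apply; lra.
apply: le_lt_trans (ler_normD _ _) _.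
have := ler_normD (p (inl (Some t)) - p (inl (Some (ratr q))))
  (p (inl (Some (ratr q))) - u_ (nk k) (ratr q)).
move: h1 h2 h3; lra.
Unshelve. all: by end_near. Qed.

End subsequence.

(** * The variational problem *)

Lemma expR_taylor1 (R : realType) (x : R) : `|x| <= 2^-1 ->
  `|expR x - 1 - x| <= 2 * x ^+ 2.
Proof.
rewrite ler_norml => /andP[x1 x2].
have h1 := expR_ge1Dx x; have h2 := expR_ge1Dx (- x).
rewrite expRN in h2.
have e0 := expR_gt0 x.
have h3 : (1 - x) * expR x <= 1.
  by rewrite -ler_pdivlMr// div1r.
have h4 : expR x <= 1 + x + 2 * x ^+ 2.
  have x10 : 0 < 1 - x by lra.
  rewrite -(ler_pM2l x10) (le_trans h3)//.
  have : 0 <= x ^+ 2 * (1 - 2 * x) by rewrite mulr_ge0 ?sqr_ge0//; lra.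
  lra.
by have := sqr_ge0 x; rewrite ler_norml; lra.
Qed.

(** For [y] of the sign of [x] and [|y| <= |x| / (2 (|C| + 1))], the linear term would exceed the
    quadratic one. *)
Lemma eq0_of_le_sqr (R : realType) (x C d : R) : 0 < d ->
  (forall y, `|y| <= d -> y * x <= C * y ^+ 2) -> x = 0.
Proof.
move=> d0 H; apply/eqP; apply/negPn/negP => x0.
have xp : 0 < `|x| by rewrite normr_gt0.
have Cp : 0 < `|C| + 1 by have := normr_ge0 C; lra.
pose z := Num.min d (`|x| / (2 * (`|C| + 1))).
have z0 : 0 < z by rewrite /z lt_min d0 divr_gt0// mulr_gt0.
have zx : z * (2 * (`|C| + 1)) <= `|x|.
  by rewrite -ler_pdivlMr ?mulr_gt0// /z ge_min lexx orbT.
have sx : Num.sg x ^+ 2 = 1 by rewrite sqr_sg x0.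
have := H (Num.sg x * z).
rewrite normrM normr_sg x0 mul1r gtr0_norm// /z ge_min lexx => /(_ isT).
rewrite -/z exprMn sx mul1r mulrAC -normrEsg.
have := ler_norm C; nra.
Qed.

Section variational.
Context d (X : measurableType d) (R : realType) (mu : {measure set X -> \bar R}).
Variables (k w T : X -> R) (beta b' : R).
Hypotheses (mk : measurable_fun setT k) (mT : measurable_fun setT T).
Hypotheses (beta0 : 0 < beta) (bb' : beta < b').
Hypotheses (iw : mu.-integrable setT (EFin \o w)) (w0 : forall x, 0 <= w x).
Hypothesis kw : forall x, k x <= w x * expR (- (b' * `|T x|)).

(** [adm] is a genuine restriction: [kw] bounds [k] from above only, so the negative part of [G u]
    may have infinite integral, and [F u] would then carry no information. *)
Let G u x := k x * expR (u (T x)).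
Let F u := \int[mu]_x G u x.
Let adm u := mu.-integrable setT (EFin \o G u).

Let measurable_G u : continuous u -> measurable_fun setT (G u).
Proof.
move=> cu; apply: measurable_funM => //; apply: measurableT_comp => //.
apply: measurableT_comp => //; exact: continuous_measurable_fun.
Qed.

Let G_le u rho e x : energy_le u rho e -> u 0 = 0 ->
  G u x <= w x * expR (e / (4 * b')).
Proof.
move=> E u0; rewrite /G.
apply: (@le_trans _ _ (w x * expR (- (b' * `|T x|)) * expR (u (T x)))).
  by rewrite ler_wpM2r ?expR_ge0.
rewrite -mulrA -expRD; apply: ler_wpM2l => //.
rewrite ler_expR.
by have := @energy_le_upper _ u rho e b' (T x) E u0 (lt_trans beta0 bb'); lra.
Qed.

Let iwZ c : mu.-integrable setT (EFin \o (fun x => w x * c)).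
Proof. exact: (integrableZr measurableT c iw). Qed.

Let F_le u rho e : energy_le u rho e -> u 0 = 0 -> adm u ->
  F u <= (\int[mu]_x w x) * expR (e / (4 * b')).
Proof.
move=> E u0 au; rewrite -RintegralZr//.
apply: le_Rintegral => // x _; exact: G_le E u0.
Qed.

Let F_shift u c : adm u -> adm (fun t => u t + c) /\ F (fun t => u t + c) = F u * expR c.
Proof.
move=> au.
have GE : G (fun t => u t + c) = fun x => G u x * expR c.
  by apply/funext => x; rewrite /G expRD mulrA.
split; first by rewrite /adm GE; exact: (integrableZr measurableT (expR c) au).
by rewrite /F GE RintegralZr.
Qed.

(* Since [beta < b'], [energy_le_upper] makes [F u * expR (- e / (4 * beta))] decay in [e]:
   a maximising sequence has bounded energy. *)
Lemma maximizer_exists :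
  (exists u rho e, [/\ energy_le u rho e, u 0 = 0, adm u & 0 < F u]) ->
  exists v rho e, [/\ energy_le v rho e, v 0 = 0, adm v, 0 < F v &
    forall u rho' e', energy_le u rho' e' -> adm u ->
      F u * expR (- u 0) * expR (- e' / (4 * beta)) <= F v * expR (- e / (4 * beta))].
Proof.
have := beta0; have := bb'.
move=> bb'' beta0' [u1 [rho1 [e1 [E1 u10 a1 F1]]]].
have b'0 : 0 < b' by exact: lt_trans bb'.
pose W := \int[mu]_x w x.
have W0 : 0 <= W by exact: Rintegral_ge0.
pose th := (4 * beta)^-1 - (4 * b')^-1.
have b4 : 0 < 4 * beta by lra.
have b'4 : 0 < 4 * b' by lra.
have th0 : 0 < th by rewrite subr_gt0 ltf_pV2 ?posrE//; lra.
pose S := [set y | exists u rho e, [/\ energy_le u rho e, u 0 = 0, adm u &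
  y = F u * expR (- e / (4 * beta))]].
have Sub u rho e : energy_le u rho e -> u 0 = 0 -> adm u ->
    F u * expR (- e / (4 * beta)) <= W * expR (- (th * e)).
  move=> E u0 au; have := F_le E u0 au => H.
  apply: le_trans (ler_wpM2r (expR_ge0 _) H) _.
  rewrite -mulrA -expRD (_ : _ + _ = - (th * e))//.
  by rewrite /th; field; rewrite !gt_eqF.
have supS : has_sup S.
  split; first by exists (F u1 * expR (- e1 / (4 * beta))), u1, rho1, e1.
  exists W => y [u [rho [e [E u0 au ->]]]].
  apply: le_trans (Sub _ _ _ E u0 au) _.
  rewrite -[leRHS]mulr1 ler_wpM2l// expR_le1 oppr_le0 mulr_ge0 ?(ltW th0)//.
  exact: energy_le_ge0 E.
pose M := sup S.
have M0 : 0 < M.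
  apply: lt_le_trans (ub_le_sup supS.2 _); last first.
    by exists u1, rho1, e1; split.
  by rewrite mulr_gt0 ?expR_gt0.
(* Levels that increase to [M] and stay above [M / 2], a positive bound that limits the energies
   below. *)
pose c_ (n : nat) := M - M / 2 * n.+1%:R^-1.
have cM n : M / 2 <= c_ n < M.
  rewrite /c_; have : 0 < n.+1%:R^-1 :> R by rewrite invr_gt0.
  have : n.+1%:R^-1 <= 1 :> R by rewrite invf_le1// ler1n.
  move: (n.+1%:R^-1) => z z1 z0; apply/andP; split; nra.
have /choice [z zP] n : exists z : (R -> R) * (R -> R) * R,
    [/\ energy_le z.1.1 z.1.2 z.2, z.1.1 0 = 0, adm z.1.1 &
      c_ n <= F z.1.1 * expR (- z.2 / (4 * beta))].
  have eps0 : 0 < M - c_ n by have := cM n; lra.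
  have [y [u [rho [e [E u0 au ->]]]] /ltW H] := sup_adherent eps0 supS.
  by exists (u, rho, e); split => //=; move: H; rewrite -/M; lra.
(* From [M / 2 <= W * expR (- (th * e))] and [th * e <= expR (th * e)]. *)
have eE n : (z n).2 <= W / (M / 2) / th.
  have [E u0 au cz] := zP n; have := Sub _ _ _ E u0 au.
  have /andP[c1 _] := cM n.
  have := expR_ge1Dx (th * (z n).2); rewrite expRN => h1 h2.
  have ex0 := expR_gt0 (th * (z n).2).
  rewrite !ler_pdivlMr; [|lra|lra].
  have : M / 2 * expR (th * (z n).2) <= W.
    by rewrite -ler_pdivlMr//; lra.
  nra.
have [v [rho [e [nk [Ev v0 nkk ek vk]]]]] :=
  @energy_le_compact R (fun n => (z n).1.1) (fun n => (z n).1.2) (fun n => (z n).2) _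
  (fun n => let: And4 a _ _ _ := zP n in a) (fun n => let: And4 _ a _ _ := zP n in a) eE.
have cvgE : (fun j => expR ((z (nk j)).2 / (4 * beta))) @ \oo --> expR (e / (4 * beta)).
  apply: (@cvg_comp _ _ _ (fun j => (z (nk j)).2 / (4 * beta)) expR); last exact: continuous_expR.
  by apply: cvgM; [exact: ek|exact: cvg_cst].
have cvgc : (fun j => c_ (nk j)) @ \oo --> M.
  apply/cvgrPdist_le => eps eps0; near=> j.
  rewrite /c_ opprB addrC subrK ger0_norm; last by rewrite mulr_ge0 ?invr_ge0//; lra.
  apply: (@le_trans _ _ (M / 2 * j.+1%:R^-1)).
    rewrite ler_wpM2l//; first lra.
    by rewrite lef_pV2 ?posrE// ler_nat ltnS.
  rewrite mulrC -ler_pdivlMr; last lra.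
  apply/ltW; near: j; apply: near_infty_natSinv_lt (PosNum _).
  by rewrite divr_gt0//; lra.
(* Fatou is run on [G] alone: the energies converge along the subsequence, so their factor is moved
   to the lower bounds. The uniform energy bound provides a single integrable majorant. *)
have [] := @reverse_fatou _ _ _ mu (fun j => G (z (nk j)).1.1) (G v)
  (fun x => w x * expR (W / (M / 2) / th / (4 * b')))
  (fun j => c_ (nk j) * expR ((z (nk j)).2 / (4 * beta))) (M * expR (e / (4 * beta))).
- by move=> n; have [] := zP (nk n).
- exact/measurable_G/(energy_le_continuous Ev).
- exact: iwZ.
- move=> n x; have [En un _ _] := zP (nk n); apply: le_trans (G_le _ En un) _.
  by rewrite ler_wpM2l// ler_expR ler_wpM2r ?invr_ge0//; lra.
- move=> x; apply: cvgM; first exact: cvg_cst.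
  by apply: (@cvg_comp _ _ _ (fun j => (z (nk j)).1.1 (T x)) expR);
    [exact: vk|exact: continuous_expR].
- move=> n; have [_ _ _ H] := zP (nk n).
  rewrite -ler_pdivlMr ?expR_gt0//; move: H; rewrite -expRN mulNr; apply.
- exact: cvgM.
move=> av; rewrite -/(F v) => MF.
have Fv0 : 0 < F v by apply: lt_le_trans MF; rewrite mulr_gt0 ?expR_gt0.
exists v, rho, e; split => // u rho' e' Eu au.
apply: (@le_trans _ _ M); last first.
  by rewrite mulNr expRN ler_pdivlMr ?expR_gt0.
(* A competitor with arbitrary value at [0] enters after subtracting [u 0], which multiplies [F] by
   [expR (- u 0)]; this is the origin of that factor in the statement. *)
apply: (ub_le_sup supS.2); exists (fun t => u t - u 0), rho', e'; split.
- exact: energy_le_shift.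
- by rewrite subrr.
- by have [] := F_shift (- u 0) au.
- by have [_ ->] := F_shift (- u 0) au.
Unshelve. all: by end_near. Qed.

(* Adding [x * ramp a b] to [v] changes the energy by
   [- 2 x (v b - v a) / (b - a) + x^2 / (b - a)], and the terms of first order in [x]
   must cancel. *)
Lemma euler_lagrange v rho e : energy_le v rho e -> v 0 = 0 -> adm v -> 0 < F v ->
  (forall u rho' e', energy_le u rho' e' -> adm u ->
      F u * expR (- u 0) * expR (- e' / (4 * beta)) <= F v * expR (- e / (4 * beta))) ->
  forall a b, a < b ->
  \int[mu]_x (G v x * ramp a b (T x)) =
    F v * (ramp a b 0 - (v b - v a) / (2 * beta * (b - a))).
Proof.
have beta0' := beta0; move=> E v0 av Fv max a b ab.
have ba : 0 < b - a by rewrite subr_gt0.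
set h := ramp a b.
have h01 t : 0 <= h t <= 1 by exact: ramp_itv.
have mh : measurable_fun setT (h \o T).
  apply: measurableT_comp => //; apply: continuous_measurable_fun.
  exact: continuous_ramp.
have mG : measurable_fun setT (G v) by exact/measurable_G/(energy_le_continuous E).
have iG : mu.-integrable setT (EFin \o (fun x => `|G v x|)) by exact: integrable_norm.
have iGh : mu.-integrable setT (EFin \o (fun x => G v x * h (T x))).
  apply: integrable_le_norm iG _ => //; first exact: measurable_funM.
  move=> x _; have /andP[? ?] := h01 (T x).
  by rewrite normrM ler_piMr// ger0_norm.
set H := \int[mu]_x _; pose I := \int[mu]_x `|G v x|.
have I0 : 0 <= I by apply: Rintegral_ge0.
(* Expanding [expR (x * h)] to first order leaves an error of at most [2 x^2 |G v|]. This both shows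
   that the perturbed function is admissible and bounds its [F] from below. *)
have Fx x : `|x| <= 2^-1 -> adm (fun t => v t + x * h t) /\
    F v + x * H - 2 * x ^+ 2 * I <= F (fun t => v t + x * h t).
  move=> x2.
  have bnd y : `|G (fun t => v t + x * h t) y - (G v y + x * (G v y * h (T y)))| <=
      2 * x ^+ 2 * `|G v y|.
    have /andP[h0 h1] := h01 (T y).
    have xh : `|x * h (T y)| <= `|x| by rewrite normrM ler_piMr// ger0_norm.
    have := expR_taylor1 (le_trans xh x2) => tay.
    rewrite (_ : _ - _ = G v y * (expR (x * h (T y)) - 1 - x * h (T y))); last first.
      by rewrite /G expRD; ring.
    rewrite normrM mulrC ler_wpM2r// (le_trans tay)// ler_wpM2l//.
    by rewrite -[leLHS]real_normK ?num_real// -[leRHS]real_normK ?num_real// lerXn2r ?nnegrE.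
  have mGx : measurable_fun setT (G (fun t => v t + x * h t)).
    apply: measurable_G => t; apply: cvgD; first exact: (energy_le_continuous E).
    by apply: cvgM; [exact: cvg_cst|exact: continuous_ramp].
  have iL : mu.-integrable setT (EFin \o (fun y => G v y + x * (G v y * h (T y)))).
    by apply: (integrableD measurableT av (integrableZl measurableT x iGh)).
  have iQ : mu.-integrable setT (EFin \o (fun y => 2 * x ^+ 2 * `|G v y|)).
    exact: (integrableZl measurableT (2 * x ^+ 2) iG).
  have ax : adm (fun t => v t + x * h t).
    have iD : mu.-integrable setT (EFin \o
        (fun y => G (fun t => v t + x * h t) y - (G v y + x * (G v y * h (T y))))).
      apply: integrable_le_norm iQ _ => //; apply: measurable_funB => //.
      exact: measurable_integrable iL.
    apply: eq_integrable (integrableD measurableT iD iL) => // y _ /=.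
    by rewrite -EFinD subrK.
  split => //.
  have -> : F v + x * H - 2 * x ^+ 2 * I =
      \int[mu]_y ((G v y + x * (G v y * h (T y))) - 2 * x ^+ 2 * `|G v y|).
    rewrite RintegralB// RintegralD//; last exact: (integrableZl measurableT x iGh).
    by rewrite RintegralZl// RintegralZl.
  apply: le_Rintegral => //; first exact: (integrableB measurableT iL iQ).
  by move=> y _; have := bnd y; rewrite ler_norml; lra.
(* [x * c1 + x ^+ 2 * c2] is the exponent by which maximality allows [F] to grow: [x * h 0]
   compensates the value at [0], the rest is the change of energy divided by [4 beta]. *)
pose c1 := h 0 - (v b - v a) / (2 * beta * (b - a)).
pose c2 := (4 * beta * (b - a))^-1.
have c20 : 0 <= c2 by rewrite invr_ge0 !mulr_ge0//; lra.
have key x : `|x| <= 2^-1 -> F (fun t => v t + x * h t) <= F v * expR (x * c1 + x ^+ 2 * c2).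
  move=> x2; have [ax _] := Fx _ x2.
  have [rho' E'] := energy_le_ramp x ab E.
  have := max _ _ _ E' ax; rewrite v0 add0r -/h.
  rewrite -mulrA -ler_pdivlMr ?mulr_gt0 ?expR_gt0// => /le_trans; apply.
  rewrite -[leLHS]mulrA ler_pM2l// -expRD -expRN -expRD ler_expR le_eqVlt.
  apply/orP; left; apply/eqP.
  by rewrite /c1 /c2; field; rewrite !gt_eqF.
apply/eqP; rewrite -subr_eq0; apply/eqP.
(* Keeps both [|x|] and [|x * c1 + x ^+ 2 * c2|] below [1 / 2], the range of [expR_taylor1]. *)
pose dd := Num.min 2^-1 (2 * (`|c1| + c2 + 1))^-1.
have c1p : 0 < `|c1| + c2 + 1 by have := normr_ge0 c1; lra.
have dd0 : 0 < dd by rewrite /dd lt_min !invr_gt0 mulr_gt0// andbT.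
apply: (@eq0_of_le_sqr _ _ (2 * I + F v * (c2 + 2 * (`|c1| + c2) ^+ 2)) dd dd0) => x xd.
have /andP[x2 xc] : (`|x| <= 2^-1) && (`|x| <= (2 * (`|c1| + c2 + 1))^-1).
  by rewrite -le_min.
have [ax Hx] := Fx _ x2; have Kx := key _ x2.
set y := x * c1 + x ^+ 2 * c2 in Kx.
have x0 := normr_ge0 x; have c10 := normr_ge0 c1.
have yx : `|y| <= `|x| * (`|c1| + c2).
  rewrite /y (le_trans (ler_normD _ _))//.
  have -> : `|x * c1| = `|x| * `|c1| by rewrite normrM.
  have -> : `|x ^+ 2 * c2| = `|x| ^+ 2 * c2 by rewrite normrM normrX (ger0_norm c20).
  rewrite mulrDr lerD2l ler_wpM2r// expr2 ler_piMr//; lra.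
have y2 : `|y| <= 2^-1.
  have xc' : `|x| * (2 * (`|c1| + c2 + 1)) <= 1.
    by rewrite -ler_pdivlMr ?mulr_gt0// div1r.
  by apply: le_trans yx _; lra.
have := expR_taylor1 y2; rewrite ler_norml => /andP[_ ey].
have ysq : y ^+ 2 <= x ^+ 2 * (`|c1| + c2) ^+ 2.
  rewrite -exprMn -(real_normK (num_real y)) -(real_normK (num_real (x * _))).
  by rewrite lerXn2r ?nnegrE// normrM [X in _ * X]ger0_norm//; lra.
have : F v * expR y <= F v * (1 + (x * c1 + x ^+ 2 * c2) + 2 * (x ^+ 2 * (`|c1| + c2) ^+ 2)).
  by rewrite ler_pM2l//; rewrite /y in ey ysq *; lra.
rewrite -/c1; move: Hx Kx.
set A := (`|c1| + c2) ^+ 2; lra.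
Qed.

End variational.

(** * Derivatives and monotonicity on the line *)

Section real_lemmas.
Context {R : realType}.
Implicit Types (f D : R -> R) (a b x df : R).

Lemma is_derive_eps f x df :
  (forall e, 0 < e -> exists2 d, 0 < d &
    forall y, `|y - x| < d -> `|f y - f x - df * (y - x)| <= e * `|y - x|) ->
  is_derive x 1 f df.
Proof.
move=> H.
have L : (fun h => h^-1 *: ((f \o shift x) (h *: (1 : R)) - f x)) @ 0^' --> df.
  apply/cvgrPdist_le => e e0; have [d d0 Hd] := H _ e0.
  near=> h.
  have h0 : h != 0 by near: h; exact: nbhs_dnbhs_neq.
  have hd : `|h| < d.
    near: h; apply: nbhs_dnbhs; have := nbhsx_ballx (0 : R) d d0.
    by apply: filterS => z; rewrite /ball /= sub0r normrN.
  have := Hd (h + x); rewrite addrK => /(_ hd).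
  rewrite /= scaler1 /GRing.scale /= => K.
  have -> : df - h^-1 * (f (h + x) - f x) = - ((f (h + x) - f x - df * h) / h) by field.
  by rewrite normrN normrM normfV ler_pdivrMr ?normr_gt0.
apply: DeriveDef; first by apply/cvg_ex; exists df.
by apply/cvg_lim => //; exact: L.
Unshelve. all: by end_near. Qed.

Lemma is_derive_epsP f x df e : is_derive x 1 f df -> 0 < e ->
  exists2 d, 0 < d &
    forall y, `|y - x| < d -> `|f y - f x - df * (y - x)| <= e * `|y - x|.
Proof.
move=> [Df fE] e0.
have L : (fun h => h^-1 *: ((f \o shift x) (h *: (1 : R)) - f x)) @ 0^' --> df.
  by rewrite -fE; exact: Df.
move/cvgrPdist_le : L => /(_ _ e0); rewrite near_withinE => /nbhs_ballP[d /= d0 Hd].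
exists d => // y yd; have [->|yx] := eqVneq y x; first by rewrite !subrr mulr0 subrr normr0 mulr0.
have yx0 : y - x != 0 by rewrite subr_eq0.
have /= := Hd (y - x); rewrite /ball /= sub0r normrN => /(_ yd yx0).
rewrite scaler1 subrK /GRing.scale /= => K.
have -> : f y - f x - df * (y - x) = - ((df - (y - x)^-1 * (f y - f x)) * (y - x)) by field.
by rewrite normrN normrM ler_wpM2r.
Qed.

(* The supremum of the [s] up to which the inequality holds cannot be before [b]. *)
Lemma pointwise_increasing_le D a b : a <= b ->
  (forall t, a <= t <= b -> exists2 d, 0 < d & forall s, `|s - t| < d ->
    (s <= t -> D s <= D t) /\ (t <= s -> D t <= D s)) -> D a <= D b.
Proof.
move=> ab H; pose S := [set s | a <= s <= b /\ forall r, a <= r <= s -> D a <= D r].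
have Sa : S a.
  split; first by rewrite lexx.
  by move=> r; rewrite -eq_le => /eqP ->.
have supS : has_sup S by split; [exists a|exists b => s [/andP[]]].
pose c := sup S.
have ac : a <= c by exact: ub_le_sup supS.2 _ Sa.
have cb : c <= b by apply: ge_sup; [exists a|move=> s [/andP[]]].
have [d d0 Hd] := H c (introT andP (conj ac cb)).
have Dr r : a <= r -> r < c -> D a <= D r.
  move=> ar rc; have e0 : 0 < c - r by rewrite subr_gt0.
  have [s [_ Ss] rs] := sup_adherent e0 supS.
  by apply: Ss; rewrite ar /=; move: rs; rewrite -/c; lra.
have Dac : D a <= D c.
  have [<-//|/eqP ac'] := eqVneq a c.
  have {ac'}acl : a < c by rewrite lt_neqAle ac andbT; apply/eqP.
  pose r := Num.max a (c - d / 2).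
  have rc : r < c by rewrite /r gt_max acl/=; lra.
  apply: le_trans (Dr r _ rc) _; first by rewrite /r le_max lexx.
  apply: (Hd r _).1; last exact: ltW.
  rewrite ltr0_norm ?subr_lt0// opprB.
  have : c - d / 2 <= r by rewrite /r le_max lexx orbT.
  lra.
have [<-//|/eqP cb'] := eqVneq c b.
have {cb'}cbl : c < b by rewrite lt_neqAle cb andbT; apply/eqP.
pose s := Num.min b (c + d / 2).
have cs : c < s by rewrite /s lt_min cbl/=; lra.
have sd : s <= c + d / 2 by rewrite /s ge_min lexx orbT.
suff : S s by move=> /(ub_le_sup supS.2); rewrite -/c leNgt cs.
split; first by rewrite (le_trans ac (ltW cs))/= /s ge_min lexx.
move=> r /andP[ar rs]; have [rc|cr] := ltP r c; first exact: Dr.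
apply: le_trans Dac _; apply: (Hd r _).2 => //.
by rewrite ger0_norm ?subr_ge0//; lra.
Qed.

End real_lemmas.

(** * The cumulative mass *)

Section cumulative.
Context {R : realType}.
Local Notation mu := (@lebesgue_measure R).
Variable g : R -> R.
Hypothesis ig : mu.-integrable setT (EFin \o g).

Let igS (A : set R) : measurable A -> mu.-integrable A (EFin \o g).
Proof. by move=> mA; exact: integrableS ig. Qed.

(** For the radial density [g r = 2 pi r V(r) e^(psi(r))], extended by [0] to [r <= 0], this is the
    mass of the disk of radius [r]. Starting at [-oo] makes it continuous on the whole line and zero
    for [r <= 0], which suits signed radii. *)
Definition cumulative (r : R) := \int[mu]_(x in `]-oo, r]) g x.

Lemma cumulativeB r s : r <= s ->
  cumulative s - cumulative r = \int[mu]_(x in `]r, s]) g x.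
Proof.
by move=> rs; rewrite /cumulative Rintegral_itvB ?bnd_simp//; exact: igS.
Qed.

Lemma cumulativeB_norm r s : r <= s ->
  `|cumulative s - cumulative r| <= \int[mu]_(x in `]r, s]) `|g x|.
Proof. by move=> rs; rewrite cumulativeB//; apply: le_normr_Rintegral => //; exact: igS. Qed.

Lemma absolute_continuity_itv e : 0 < e -> exists2 d, 0 < d &
  forall r s, r <= s -> s - r < d -> \int[mu]_(x in `]r, s]) `|g x| < e.
Proof.
move=> e0; have [d [d0 H]] := integral_normr_continuous ig e0; exists d => // r s rs sr.
have /H : (mu `]r, s] < d%:E)%E.
  rewrite lebesgue_measure_itv /= lte_fin.
  by case: ifP => // _; rewrite -EFinD lte_fin.
exact.
Qed.

Lemma continuous_cumulative : continuous cumulative.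
Proof.
move=> r; apply/cvgrPdist_lt => e e0.
have [d d0 H] := absolute_continuity_itv e0.
near=> s; have sd : `|r - s| < d by near: s; exact: (nbhsx_ballx r d d0).
have [rs|/ltW sr] := leP r s.
  rewrite distrC; apply: le_lt_trans (cumulativeB_norm rs) _; apply: H => //.
  by move: sd; rewrite distrC ger0_norm ?subr_ge0.
apply: le_lt_trans (cumulativeB_norm sr) _; apply: H => //.
by move: sd; rewrite ger0_norm ?subr_ge0.
Unshelve. all: by end_near. Qed.

End cumulative.

(** * From the Euler-Lagrange equation to the slope of the profile *)

Section profile.
Context {R : realType}.
Local Notation mu := (@lebesgue_measure R).
Variables (g v rho : R -> R) (beta e : R).
Hypothesis ig : mu.-integrable setT (EFin \o g).
Hypothesis g0 : forall r, r <= 0 -> g r = 0.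
Hypothesis beta0 : 0 < beta.
Hypothesis Ev : energy_le v rho e.
Hypothesis EL : forall a b, a < b ->
  \int[mu]_r (g r * ramp a b (ln r)) = ramp a b 0 - (v b - v a) / (2 * beta * (b - a)).

Let M := cumulative g.
Let psi t := v t - 2 * beta * Num.max 0 t.

(** For [r > 0], the ramp in [ln r] and the indicator of [r <= expR c] differ by at most [1], and
    only for [r] between [expR s] and [expR t]. For [r <= 0], where [ln] has no meaning, [g]
    vanishes. *)
Let ramp_cumulative s t c : s < t -> s <= c -> c <= t ->
  `|\int[mu]_r (g r * ramp s t (ln r)) - M (expR c)| <=
  \int[mu]_(x in `]expR s, expR t]) `|g x|.
Proof.
move=> st sc ct; rewrite /M /cumulative [X in _ - X]Rintegral_mkcond.
have mg := measurable_integrable ig.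
have i1 : mu.-integrable setT (EFin \o (fun r => g r * ramp s t (ln r))).
  apply: integrable_le_norm (integrable_norm ig) _ => //.
    apply: measurable_funM => //.
    apply: (measurableT_comp (f := ramp s t)); last exact: measurable_ln.
    by apply: continuous_measurable_fun; exact: continuous_ramp.
  move=> x _; have /andP[? ?] := ramp_itv (ln x) st.
  by rewrite normrM ler_piMr// ger0_norm.
have i2 : mu.-integrable setT (EFin \o (g \_ `]-oo, expR c])).
  rewrite -restrict_EFin; apply/integrable_restrict => //.
  by rewrite setTI; exact: integrableS ig.
rewrite -RintegralB// [X in _ <= X]Rintegral_mkcond.
have iB : mu.-integrable setT
    (EFin \o (fun r => g r * ramp s t (ln r) - (g \_ `]-oo, expR c]) r)).
  exact: (integrableB _ i1 i2).
apply: le_trans (le_normr_Rintegral _ iB) _ => //.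
apply: le_Rintegral => //; first exact: integrable_norm.
  rewrite -restrict_EFin; apply/integrable_restrict => //.
  by rewrite setTI; apply: integrable_norm; exact: integrableS ig.
move=> r _; rewrite !patchE.
have [r0|r0] := leP r 0.
  by rewrite g0// mul0r; case: ifP => _; rewrite ?subr0 normr0; case: ifP.
have lnr : expR (ln r) = r by rewrite lnK// posrE.
have -> : (r \in `]-oo, expR c]%classic) = (ln r <= c).
  by rewrite mem_setE in_itv /= -{1}lnr ler_expR.
have -> : (r \in `]expR s, expR t]%classic) = (s < ln r <= t).
  by rewrite mem_setE in_itv /= -{1 2}lnr ler_expR ltr_expR.
have [ls|sl] := leP (ln r) s.
  by rewrite ramp_le// (le_trans ls sc) mulr1 subrr normr0.
have [tl|lt] := leP t (ln r).
  rewrite ramp_ge// mulr0 sub0r normrN.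
  case: ifPn => [lc|_]; last by rewrite normr0; case: ifP.
  by rewrite (_ : ln r <= t)//; lra.
rewrite /= (ltW lt) -[leRHS]mulr1.
have /andP[h0 h1] := ramp_itv (ln r) st.
case: ifP => _; last by rewrite subr0 normrM ler_wpM2l// ger0_norm.
rewrite -[X in _ - X]mulr1 -mulrBr normrM ler_wpM2l//.
by rewrite ler_norml; lra.
Qed.

(** [ramp s t 0 * (t - s)] is the increment of [Num.max 0] from [s] to [t]; so [EL] equates the
    difference quotient of [psi] with [- 2 beta] times a mass weighted by the ramp. *)
Let psi_increment s t c : s < t -> s <= c -> c <= t ->
  `|psi t - psi s + 2 * beta * M (expR c) * (t - s)| <=
  2 * beta * \int[mu]_(x in `]expR s, expR t]) `|g x| * (t - s).
Proof.
move=> st sc ct; have := ramp_cumulative st sc ct; rewrite EL//.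
have ts : 0 < t - s by rewrite subr_gt0.
set I := \int[mu]_(x in _) _; move=> H.
have r0 : ramp s t 0 * (t - s) = Num.max 0 t - Num.max 0 s.
  rewrite /ramp divfK ?gt_eqF//.
  have [t0|/ltW t0] := leP t 0.
    by rewrite clamp_ge ?(ltW st)// !max_l ?subrr// (le_trans (ltW st)).
  have [s0|/ltW s0] := leP s 0; first by rewrite clamp_id// max_r// subr0.
  by rewrite clamp_le ?(ltW st)// max_r.
have -> : psi t - psi s + 2 * beta * M (expR c) * (t - s) =
  - (2 * beta * (t - s)) * (ramp s t 0 - (v t - v s) / (2 * beta * (t - s)) - M (expR c)).
  have -> : ramp s t 0 = (Num.max 0 t - Num.max 0 s) / (t - s).
    by rewrite -r0 mulfK// gt_eqF.
  by rewrite /psi; field; rewrite !gt_eqF.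
have bts : 0 <= 2 * beta * (t - s) by rewrite !mulr_ge0// ltW.
by rewrite normrM normrN (ger0_norm bts) [leRHS]mulrAC ler_wpM2l.
Qed.

(** With [c] placed at [t], the error in [psi_increment] is the integral of [|g|] over a shrinking
    interval, small by absolute continuity of the integral. At [t = 0] the corners of [v] and of
    [2 beta * Num.max 0 t] cancel. *)
Lemma profile_is_derive (t : R) : is_derive t (1 : R) psi (- (2 * beta * M (expR t))).
Proof.
apply: is_derive_eps => eps eps0.
have b2 : 0 < 2 * beta by rewrite mulr_gt0.
have [d1 d10 Hd1] := absolute_continuity_itv ig (divr_gt0 eps0 b2).
have : \forall y \near t, `|expR t - expR y| < d1.
  by have /cvgrPdist_lt := @continuous_expR R t; apply.
move=> /nbhs_ballP[d /= d0 Hd]; exists d => // y yt.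
have yd1 : `|expR t - expR y| < d1 by apply: Hd; rewrite /ball /= distrC.
have [->|/eqP ne] := eqVneq y t; first by rewrite !subrr mulr0 subrr normr0 mulr0.
have [ty|yt'] := ltP t y.
  have := @psi_increment t y t ty (lexx _) (ltW ty).
  have tye : expR t <= expR y by rewrite ler_expR ltW.
  have := Hd1 _ _ tye; rewrite distrC ger0_norm ?subr_ge0// in yd1.
  move=> /(_ yd1) HI; rewrite mulNr opprK => /le_trans; apply.
  rewrite ger0_norm ?subr_ge0 ?(ltW ty)// ler_wpM2r ?subr_ge0 ?(ltW ty)//.
  by rewrite mulrC -ler_pdivlMr// ltW.
have {}yt' : y < t by rewrite lt_neqAle yt' andbT; apply/eqP.
have := @psi_increment y t t yt' (ltW yt') (lexx _).
have tye : expR y <= expR t by rewrite ler_expR ltW.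
have := Hd1 _ _ tye; rewrite ger0_norm ?subr_ge0// in yd1.
move=> /(_ yd1) HI.
have -> : psi y - psi t - - (2 * beta * M (expR t)) * (y - t) =
  - (psi t - psi y + 2 * beta * M (expR t) * (t - y)) by ring.
rewrite normrN => /le_trans; apply.
rewrite distrC ger0_norm ?subr_ge0 ?(ltW yt')// ler_wpM2r ?subr_ge0 ?(ltW yt')//.
by rewrite mulrC -ler_pdivlMr// ltW.
Qed.

Let f r := (2 * beta * M r) ^+ 2 / r.

Let cf r : 0 < r -> {for r, continuous f}.
Proof.
move=> r0; apply: cvgM; last by apply: cvgV => //; rewrite gt_eqF.
rewrite /= (_ : (fun x => _) = (fun x => (2 * beta * M x) * (2 * beta * M x))) //.
have c : (fun x => 2 * beta * M x) @ r --> 2 * beta * M r.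
  by apply: cvgM; [exact: cvg_cst|exact: continuous_cumulative].
exact: cvgM.
Qed.

(* Pointwise, [v' = - p] and [(v s - v t)^2 <= (s - t) (rho s - rho t)] force [rho] to
   grow at least as fast as a primitive of [p^2]; this needs no regularity of [rho]. *)
Let int_f_le a : a <= - 1 ->
  \int[mu]_(r in `]expR a, expR (- 1)]) f r <= e.
Proof.
(* The primitive [Q] lives on [[q, 1]], with room on both sides of [[expR a, expR (- 1)]], so it is
   differentiable up to the ends. Times below [- 1] stay in the region where [psi] and [v]
   coincide. *)
move=> a1; pose q := expR a / 2; have ea := expR_gt0 a.
have q0 : 0 < q by rewrite divr_gt0.
have i_f : mu.-integrable `[q, 1] (EFin \o f).
  apply: continuous_compact_integrable; first exact: segment_compact.
  apply: continuous_in_subspaceT => r; rewrite inE /= in_itv /= => /andP[qr _].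
  by apply: cf; exact: lt_le_trans qr.
pose Q r := \int[mu]_(x in `[q, r]) f x.
have dQ r : q < r -> r < 1 -> is_derive r 1 Q (f r).
  move=> qr r1; have := @continuous_FTC1_closed R f q r 1 r1 i_f qr (cf (lt_trans q0 qr)).
  by rewrite derive1E => -[dQ Qf]; apply: DeriveDef.
have qa : q < expR a by rewrite /q; lra.
have e1 : expR (- 1) < 1 :> R by rewrite expR_lt1; lra.
have ee : expR a <= expR (- 1) by rewrite ler_expR.
have -> : \int[mu]_(r in `]expR a, expR (- 1)]) f r = Q (expR (- 1)) - Q (expR a).
  rewrite /Q Rintegral_itvB ?bnd_simp// ?(ltW qa)//.
  by apply: integrableS i_f => //; apply: subset_itvl; rewrite bnd_simp ltW.
clearbody Q; have [E1 E2] := Ev.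
apply/ler_addgt0Pr => eta eta0.
pose eps := eta / (2 * (- 1 - a + 1)).
have a10 : 0 < 2 * (- 1 - a + 1) by lra.
have eps0 : 0 < eps by rewrite divr_gt0.
have epsE : 2 * eps * (- 1 - a) <= eta.
  rewrite /eps mulrAC mulrA ler_pdivrMr// (_ : 2 * (- 1 - a) * eta = eta * (2 * (- 1 - a)));
    last by ring.
  by rewrite ler_wpM2l//; lra.
(* The slack [2 * eps * t] absorbs two first-order errors, one [eps] from [rho] and one from [Q];
   over [[a, - 1]] it costs at most [eta]. *)
pose D t := rho t - Q (expR t) + 2 * eps * t.
suff : D a <= D (- 1).
  rewrite /D; have /andP[_] := E2 _ _ a1; lra.
apply: pointwise_increasing_le a1 _ => t /andP[at_ t1].
have t0 : t < 0 by lra.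
set p := 2 * beta * M (expR t).
have dv : is_derive t (1 : R) psi (- p) by exact: profile_is_derive.
have dQt : is_derive t (1 : R) (Q \o expR) (p ^+ 2).
  have -> : p ^+ 2 = f (expR t) * expR t by rewrite /f -/p divfK// gt_eqF// expR_gt0.
  apply: is_derive1_comp; apply: dQ; first by rewrite (lt_le_trans qa)// ler_expR.
  by rewrite (le_lt_trans _ e1)// ler_expR.
(* If [|p| > dl], this size gives [(|p| - dl)^2 >= p^2 - eps]; if [|p| <= dl], then
   [p^2 <= dl^2 <= dl <= eps], which uses the cap at [1]. *)
have dl0 : 0 < Num.min 1 (eps / (2 * `|p| + 1)).
  by rewrite lt_min ltr01 divr_gt0//; have := normr_ge0 p; lra.
set dl := Num.min _ _ in dl0.
have [d1 d10 H1] := is_derive_epsP dv dl0.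
have [d2 d20 H2] := is_derive_epsP dQt eps0.
exists (Num.min (- t) (Num.min d1 d2)); first by rewrite !lt_min d10 d20 !andbT oppr_gt0.
move=> s; rewrite !lt_min => /and3P[st0 st1 st2].
have s0 : s < 0 by move: st0; rewrite ltr_norml => /andP[]; lra.
have pv x : x < 0 -> psi x = v x.
  by move=> x0; rewrite /psi max_l ?mulr0 ?subr0// ltW.
have {H1} := H1 _ st1; rewrite !pv// => H1.
have {H2} := H2 _ st2; rewrite /= => H2.
have dle : dl * (2 * `|p| + 1) <= eps.
  have pp : 0 < 2 * `|p| + 1 by have := normr_ge0 p; lra.
  by rewrite -ler_pdivlMr// /dl ge_min lexx orbT.
have [->|/eqP ne] := eqVneq s t; first by split.
have Hv : (p ^+ 2 - eps) * (s - t) ^+ 2 <= (v s - v t) ^+ 2.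
  have n0 : 0 <= `|s - t| by [].
  have p0 := normr_ge0 p.
  have H1' : `|p| * `|s - t| - dl * `|s - t| <= `|v s - v t|.
    have := ler_normD (v s - v t - - p * (s - t)) (- (v s - v t)).
    rewrite (_ : _ + _ = p * (s - t)); last by ring.
    by rewrite normrN normrM; lra.
  have [pd|dp] := leP `|p| dl.
    apply: (@le_trans _ _ 0); last exact: sqr_ge0.
    rewrite mulr_le0_ge0 ?sqr_ge0// subr_le0 -real_normK ?num_real//.
    by nra.
  have : (`|p| * `|s - t| - dl * `|s - t|) ^+ 2 <= `|v s - v t| ^+ 2.
    by rewrite lerXn2r ?nnegrE// -mulrBl mulr_ge0//; lra.
  rewrite real_normK ?num_real// -mulrBl exprMn real_normK ?num_real//.
  apply: le_trans; rewrite ler_wpM2r ?sqr_ge0//.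
  by rewrite -(real_normK (num_real p)); nra.
have Hr x y : x < y -> (p ^+ 2 - eps) * (y - x) ^+ 2 <= (v y - v x) ^+ 2 ->
    (p ^+ 2 - eps) * (y - x) <= rho y - rho x.
  move=> xy K; have := le_trans K (E1 _ _ (ltW xy)).
  by rewrite expr2 mulrA [X in _ <= X]mulrC ler_pM2r ?subr_gt0.
split=> [st|ts].
  have {}st : s < t by rewrite lt_neqAle st andbT; apply/eqP.
  have := Hr _ _ st; rewrite -(opprB (v s)) -(opprB s) !sqrrN => /(_ Hv).
  have nst : `|s - t| = t - s by rewrite ltr0_norm ?subr_lt0// opprB.
  move: H2; rewrite nst ler_norml => /andP[]; rewrite /D; lra.
have {}ts : t < s by rewrite lt_neqAle ts andbT eq_sym; apply/eqP.
have := Hr _ _ ts Hv.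
have nst : `|s - t| = s - t by rewrite gtr0_norm ?subr_gt0.
move: H2; rewrite nst ler_norml => /andP[]; rewrite /D; lra.
Qed.

(* In the variable [t = ln r] this is the integral of [v'^2] over [t <= - 1]. *)
Lemma cumulative_sqr_integrable :
  (\int[mu]_(r in `]0%R, expR (- 1)]) ((2 * beta * M r) ^+ 2 / r)%:E < +oo)%E.
Proof.
apply: le_lt_trans (ltry e); rewrite integral_mkcond.
pose J n : set R := `]expR (- n.+1%:R), expR (- 1)]%classic.
have f0 r : 0 < r -> 0 <= f r by move=> r0; rewrite divr_ge0 ?sqr_ge0 ?ltW.
have mJ n : @measurable _ (measurableTypeR R) (J n) by exact: measurable_itv.
have iJ n : mu.-integrable (J n) (EFin \o f).
  apply: (@integrableS _ _ _ mu `[expR (- n.+1%:R), expR (- 1)]%classic) => //.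
    by move=> x; rewrite /J /=; rewrite !in_itv /= => /andP[/ltW -> ->].
  apply: continuous_compact_integrable; first exact: segment_compact.
  apply: continuous_in_subspaceT => r; rewrite inE /= in_itv /= => /andP[qr _].
  by apply: cf; exact: lt_le_trans (expR_gt0 _) qr.
have J0 n r : J n r -> 0 < r.
  by rewrite /J /= in_itv /= => /andP[+ _]; exact: lt_trans (expR_gt0 _).
rewrite (_ : _ \_ _ = EFin \o (f \_ `]0, expR (- 1)])); last first.
  by apply/funext => r; rewrite /= !patchE; case: ifP.
apply: (@fatou_le _ _ _ mu (fun n => f \_ (J n)) _ (fun=> e)); last exact: cvg_cst.
- move=> n; apply: (proj1 (measurable_restrictT f (mJ n))).
  exact: measurable_integrable (iJ n).
- by move=> n r; rewrite patchE; case: ifPn => //; rewrite inE => /J0/f0.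
- move=> r; apply/cvgrPdist_lt => eps eps0; near=> n.
  rewrite (_ : (f \_ (J n)) r = (f \_ `]0, expR (- 1)]) r) ?subrr ?normr0//.
  rewrite !patchE /J !mem_setE !in_itv /=; congr (if _ then _ else _).
  congr (_ && _); have [r0|r0] := ltP 0 r.
    rewrite -[ltRHS]lnK ?posrE// ltr_expR ltrNl.
    apply: (@lt_trans _ _ n%:R); last by rewrite ltr_nat.
    by near: n; exact: nbhs_infty_gtr.
  by apply/negP => /(lt_trans (expR_gt0 _)); rewrite ltNge r0.
- move=> n; rewrite (_ : (fun r => _) = (EFin \o f) \_ (J n)); last first.
    by apply/funext => r; rewrite /= !patchE /=; case: ifP.
  rewrite -integral_mkcond -EFin_Rintegral// lee_fin; apply: int_f_le.
  by rewrite lerN2 ler1n.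
Unshelve. all: by end_near. Qed.

End profile.

(** * Polar coordinates *)

Section linear_substitution.
Context {R : realType}.
Local Notation mu := (@lebesgue_measure R).
Local Open Scope ereal_scope.

(** [c] times the image of Lebesgue measure under multiplication by [c] gives half-open intervals
    their length, so it is Lebesgue measure by uniqueness. *)
Let pushforward_scale (c : R) : (0 < c)%R ->
  exists nu : {measure set (measurableTypeR R) -> \bar R},
    (forall A, @measurable _ (measurableTypeR R) A -> nu A = mu A) /\
    forall f : measurableTypeR R -> \bar R, measurable_fun setT f -> (forall x, 0 <= f x) ->
      \int[nu]_x f x = c%:E * \int[mu]_x f (c * x)%R.
Proof.
move=> c0; pose phi : measurableTypeR R -> measurableTypeR R := ( *%R c).
have mphi : measurable_fun setT phi by exact: measurable_funM.
have [nu [nuA nuf]] : exists nu : {measure set (measurableTypeR R) -> \bar R},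
    (forall A, nu A = mu (phi @^-1` A)) /\
    (forall f : measurableTypeR R -> \bar R, measurable_fun setT f -> (forall x, 0 <= f x) ->
      \int[nu]_x f x = \int[mu]_x f (c * x)%R).
  unshelve eexists (pushforward mu phi); first exact: mphi.
  split=> // f mf f0.
  have := ge0_integral_pushforward mphi mu measurableT mf (fun x _ => f0 x).
  by rewrite preimage_setT => <-.
exists (mscale (NngNum (ltW c0)) nu); split; last first.
  by move=> f mf f0; rewrite ge0_integral_mscale// nuf.
move=> A mA; apply/esym; apply: lebesgue_measure_unique => // _ [[a b]] _ <-.
rewrite [RHS](_ : _ = c%:E * nu `]a, b]%classic)//= nuA.
rewrite (_ : _ @^-1` _ = `](a / c)%R, (b / c)%R]%classic); last first.
  apply/seteqP; split => x /=; rewrite !in_itv /= /phi ltr_pdivrMr// ler_pdivlMr//;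
  by rewrite ![(x * c)%R]mulrC.
rewrite !lebesgue_measure_itv /= !lte_fin ltr_pM2r ?invr_gt0//.
case: ifP => _; last by rewrite mule0.
by rewrite -!EFinB -EFinM -mulrBl mulrC divfK// gt_eqF.
Qed.

Lemma ge0_integral_opp (f : measurableTypeR R -> \bar R) :
  measurable_fun setT f -> (forall x, 0 <= f x) ->
  \int[mu]_x f x = \int[mu]_x f (- x)%R.
Proof.
move=> mf f0.
have mopp : measurable_fun setT (-%R : measurableTypeR R -> measurableTypeR R) by [].
have := ge0_integral_pushforward mopp mu measurableT mf (fun x _ => f0 x).
rewrite preimage_setT => <-.
by apply: eq_measure_integral => //= A mA AS; exact/esym/lebesgue_measureN.
Qed.

Lemma ge0_integral_scale (c : R) (f : measurableTypeR R -> \bar R) : (c != 0)%R ->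
  measurable_fun setT f -> (forall x, 0 <= f x) ->
  \int[mu]_x f x = `|c|%:E * \int[mu]_x f (c * x)%R.
Proof.
wlog c0 : c f / (0 < c)%R => [H|_ mf f0].
  rewrite neq_lt => /orP[c0|c0] mf f0; last by apply: H => //; rewrite gt_eqF.
  have mopp : measurable_fun setT (-%R : measurableTypeR R -> measurableTypeR R) by [].
  have mfo := measurableT_comp mf mopp.
  have cp : (0 < - c)%R by rewrite oppr_gt0.
  have cn : (- c != 0)%R by rewrite oppr_eq0 lt_eqF.
  rewrite ge0_integral_opp// (H (- c)%R _ cp cn mfo (fun x => f0 (- x)%R)).
  by rewrite normrN; congr (_ * _); apply: eq_integral => x _ /=; rewrite mulNr opprK.
have [nu [nuA nuf]] := pushforward_scale c0.
by rewrite gtr0_norm// -nuf//; apply: eq_measure_integral => A mA _; rewrite nuA.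
Qed.

End linear_substitution.

Section polar.
Context {R : realType}.
Local Notation mu := (@lebesgue_measure R).
Implicit Types s r : R.

(* [s] is the cotangent of the polar angle, and [r] ranges over the whole line:
   this parametrizes the plane minus the horizontal axis, with area element
   [|r| / (1 + s^2) dr ds]. *)
Definition polar (z : R * R) : R * R :=
  (z.2 * (z.1 / Num.sqrt (1 + z.1 ^+ 2)), z.2 * (Num.sqrt (1 + z.1 ^+ 2))^-1).

Definition polar_density (z : R * R) : R := `|z.2| / (1 + z.1 ^+ 2).

Lemma onep_sqr_gt0 s : 0 < 1 + s ^+ 2.
Proof. by rewrite ltr_wpDr// sqr_ge0. Qed.

Lemma polar_density_ge0 z : 0 <= polar_density z.
Proof. by rewrite divr_ge0// ltW// onep_sqr_gt0. Qed.

Lemma eucl_polar z : eucl (polar z) = `|z.2|.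
Proof.
have k0 := onep_sqr_gt0 z.1; rewrite /eucl /polar /=.
rewrite !exprMn exprVn sqr_sqrtr ?(ltW k0)//.
rewrite (_ : _ + _ = z.2 ^+ 2) ?sqrtr_sqr//.
by field; rewrite gt_eqF.
Qed.

Lemma measurable_sqrt_comp d (T : measurableType d) (f : T -> R) :
  measurable_fun setT f -> measurable_fun setT (fun x => Num.sqrt (f x)).
Proof.
move=> mf.
have ms : measurable_fun setT (Num.sqrt : R -> R).
  by apply: continuous_measurable_fun; exact: sqrt_continuous.
exact: (measurableT_comp ms mf).
Qed.

(** Uses [1 / y = y * expR (- ln (y ^+ 2))], with a test for [y = 0], where the inverse is [0] by
    convention. *)
Lemma measurable_inv_comp d (T : measurableType d) (f : T -> R) :
  measurable_fun setT f -> measurable_fun setT (fun x => (f x)^-1).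
Proof.
move=> mf; have m2 : measurable_fun setT (fun x => f x ^+ 2) by exact: measurable_funX.
rewrite (_ : (fun x => _) =
    fun x => f x * (if 0 < f x ^+ 2 then expR (- ln (f x ^+ 2)) else 0)).
  apply: measurable_funM => //; apply: measurable_fun_ifT => //.
    exact: measurable_fun_ltr.
  apply: measurableT_comp => //; apply: measurableT_comp => //.
  exact: (measurableT_comp (@measurable_ln R) m2).
apply/funext => x; have [->|fx] := eqVneq (f x) 0; first by rewrite invr0 mul0r.
rewrite exprn_even_gt0 ?fx// expRN lnK ?posrE ?exprn_even_gt0//.
by rewrite expr2 invfM mulrA mulfV// mul1r.
Qed.

Lemma measurable_eucl : measurable_fun setT (eucl : plane R -> R).
Proof.
apply: measurable_sqrt_comp; apply: measurable_funD; apply: measurable_funX.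
  exact: measurable_fst.
exact: measurable_snd.
Qed.

Let measurable_1sqr : measurable_fun setT (fun z : plane R => 1 + z.1 ^+ 2).
Proof.
by apply: measurable_funD => //; apply: measurable_funX; exact: measurable_fst.
Qed.

Lemma measurable_polar : measurable_fun setT (polar : plane R -> plane R).
Proof.
have m2 : measurable_fun setT (fun z : plane R => (Num.sqrt (1 + z.1 ^+ 2))^-1).
  apply: measurable_inv_comp.
  exact: measurable_sqrt_comp.
apply/measurable_fun_pairP; split.
  apply: measurable_funM; first exact: measurable_snd.
  by apply: measurable_funM => //; exact: measurable_fst.
by apply: measurable_funM => //; exact: measurable_snd.
Qed.

Lemma measurable_polar_density : measurable_fun setT (polar_density : plane R -> R).
Proof.
apply: measurable_funM.
  by apply: measurableT_comp => //; exact: measurable_snd.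
by apply: measurable_inv_comp.
Qed.

(** Two linear substitutions joined by Tonelli: for fixed [y != 0] set [x = y * s], with Jacobian
    [|y|]; then for fixed [s] set [y = r / sqrt (1 + s^2)]. The line [y = 0], where the first one
    degenerates, is null. *)
Lemma ge0_integral_polar (f : plane R -> \bar R) :
  measurable_fun setT f -> (forall x, (0 <= f x)%E) ->
  (\int[leb2 R]_x f x = \int[leb2 R]_z ((polar_density z)%:E * f (polar z)))%E.
Proof.
move=> mf f0.
have mfx y : measurable_fun setT (fun x : measurableTypeR R => f (x, y)).
  by apply: (measurableT_comp mf); exact: pair2_measurable.
have mfy : measurable_fun setT (fun z : plane R => f (z.2 * z.1, z.2)).
  apply: (measurableT_comp mf); apply/measurable_fun_pairP; split => /=.
    by apply: measurable_funM; [exact: measurable_snd|exact: measurable_fst].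
  exact: measurable_snd.
pose a (z : plane R) : R := `|z.2|.
pose h (z : plane R) := ((a z)%:E * f ((z.2 * z.1)%R, z.2))%E.
have mh : measurable_fun setT h.
  apply: emeasurable_funM => //; apply/measurable_EFinP.
  by apply: measurableT_comp => //; exact: measurable_snd.
have h0 z : (0 <= h z)%E by rewrite /h mule_ge0 // lee_fin /a.
rewrite fubini_tonelli2//.
transitivity (\int[mu]_y fubini_G mu h y)%E.
  apply: ge0_ae_eq_integral => //.
  - exact: measurable_fun_fubini_tonelli_G.
  - exact: measurable_fun_fubini_tonelli_G.
  - by move=> y _; apply: integral_ge0.
  - by move=> y _; apply: integral_ge0.
  - exists [set 0]; split => //; first exact: lebesgue_measure_set1.
    move=> y /=; apply: contra_notP => /eqP y0 _.
    rewrite /fubini_G (ge0_integral_scale y0)//.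
    rewrite -ge0_integralZl//.
    exact: (measurableT_comp mfy (pair2_measurable y)).
rewrite -fubini_tonelli2// fubini_tonelli1//.
pose q (z : plane R) := ((polar_density z)%:E * f (polar z))%E.
have mq : measurable_fun setT q.
  apply: emeasurable_funM; last exact: (measurableT_comp mf measurable_polar).
  by apply/measurable_EFinP; exact: measurable_polar_density.
have q0 z : (0 <= q z)%E by rewrite /q mule_ge0 // lee_fin polar_density_ge0.
transitivity (\int[mu]_s fubini_F mu q s)%E; last by rewrite -fubini_tonelli1.
apply: eq_integral => s _; rewrite /fubini_F /q.
set k := Num.sqrt (1 + s ^+ 2).
have k0 : 0 < k by rewrite sqrtr_gt0 onep_sqr_gt0.
have kV0 : k^-1 != 0 by rewrite gt_eqF// invr_gt0.
have mhs := measurableT_comp mh (pair1_measurable s).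
rewrite [LHS](ge0_integral_scale kV0 mhs (fun y => h0 (s, y))).
have mk : measurable_fun setT (( *%R k^-1) : measurableTypeR R -> measurableTypeR R).
  exact: measurable_funM.
rewrite -(@ge0_integralZl _ _ _ mu _ measurableT _ (measurableT_comp mhs mk))//.
apply: eq_integral => r _; rewrite /= /h /a /= muleA; congr (_ * _)%E.
  rewrite -EFinM; congr EFin; rewrite /polar_density /= normrM normfV (gtr0_norm k0).
  rewrite (_ : 1 + s ^+ 2 = k ^+ 2); first by field; rewrite gt_eqF.
  by rewrite sqr_sqrtr// ltW// onep_sqr_gt0.
congr f; rewrite /polar /= -/k; congr (_, _); first by ring.
by rewrite mulrC.
all: by move=> x _; exact: h0.
Qed.

End polar.

Section polar_integral.
Context {R : realType}.
Local Notation mu := (@lebesgue_measure R).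

Lemma integral_polar (f : plane R -> \bar R) : measurable_fun setT f ->
  (\int[leb2 R]_x f x = \int[leb2 R]_z ((polar_density z)%:E * f (polar z)))%E.
Proof.
move=> mf; rewrite integralE [RHS]integralE.
rewrite ge0_integral_polar//; last exact: measurable_funepos.
rewrite (ge0_integral_polar (f := f^\-%E))//; last exact: measurable_funeneg.
by congr (_ - _)%E; apply: eq_integral => z _;
  rewrite ?funeposE ?funenegE maxe_pMr ?lee_fin ?polar_density_ge0// mule0 ?muleN.
Qed.

Lemma measurable_polar_comp (f : plane R -> R) : measurable_fun setT f ->
  measurable_fun setT (fun z : plane R => polar_density z * f (polar z)).
Proof.
move=> mf; apply: measurable_funM; first exact: measurable_polar_density.
exact: (measurableT_comp mf measurable_polar).
Qed.

Lemma Rintegral_polar (f : plane R -> R) : measurable_fun setT f ->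
  \int[leb2 R]_x f x = \int[leb2 R]_z (polar_density z * f (polar z)).
Proof.
by move=> mf; rewrite /Rintegral integral_polar//; exact/measurable_EFinP.
Qed.

Lemma integrable_polar (f : plane R -> R) :
  (leb2 R).-integrable setT (EFin \o f) ->
  (leb2 R).-integrable setT (EFin \o (fun z => polar_density z * f (polar z))).
Proof.
move=> fi; have mf := measurable_integrable fi; apply/integrableP; split.
  by apply/measurable_EFinP; exact: measurable_polar_comp.
have /integrableP[_] := fi.
rewrite ge0_integral_polar//; last by apply: measurableT_comp => //; exact/measurable_EFinP.
congr (_ < _)%E; apply: eq_integral => z _ /=.
by rewrite normrM (ger0_norm (polar_density_ge0 z)) EFinM.
Qed.

Lemma integral_oneDsqrV : (\int[mu]_s ((1 + s ^+ 2)^-1)%:E = pi%:E)%E.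
Proof.
rewrite (ge0_symfun_integralT (f := fun s => (1 + s ^+ 2)^-1)).
- rewrite -set_itvcy integral0y_oneDsqr -EFinM; congr EFin.
  by rewrite mulrC divfK.
- by move=> s; rewrite invr_ge0 ltW// onep_sqr_gt0.
- exact: continuous_oneDsqrV.
- by move=> s; rewrite /= sqrrN.
Qed.

Lemma ge0_even_integral (f : measurableTypeR R -> \bar R) : measurable_fun setT f ->
  (forall r, (0 <= f r)%E) -> (forall r, f (- r) = f r) ->
  (\int[mu]_r f r = 2%:E * \int[mu]_(r in `]0%R, +oo[) f r)%E.
Proof.
move=> mf f0 even.
rewrite -set_itvNyy (@itv_bndbnd_setU _ _ _ (BRight 0))//.
rewrite ge0_integral_setU//; last 2 first.
- exact: measurable_funS mf.
- apply/disj_setPS => x []; rewrite /= !in_itv /= andbT => x0.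
  by rewrite ltNge x0.
rewrite mule_natl mule2n; congr (_ + _)%E.
rewrite integral_itv_obnd_cbnd; last exact: measurable_funS mf.
rewrite ge0_integration_by_substitution0//.
by apply: eq_integral => r _; rewrite even.
Qed.

(** The integral of [1 / (1 + s^2)] contributes [pi]; the factor [2] comes from folding the signed
    radius onto the half-line. *)
Lemma ge0_integral_radial (h : measurableTypeR R -> \bar R) :
  measurable_fun setT h -> (forall r, (0 <= h r)%E) ->
  (\int[leb2 R]_x h (eucl x) = (2 * pi)%:E * \int[mu]_(r in `]0%R, +oo[) (r%:E * h r))%E.
Proof.
move=> mh h0.
have mhe : measurable_fun setT (h \o (eucl : plane R -> R)).
  exact: (measurableT_comp mh measurable_eucl).
rewrite ge0_integral_polar//.
pose nrm (r : measurableTypeR R) : R := `|r|.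
have mnrm : measurable_fun setT nrm by exact: measurableT_comp.
pose g (r : measurableTypeR R) := ((nrm r)%:E * h (nrm r))%E.
have mg : measurable_fun setT g.
  by apply: emeasurable_funM; [exact/measurable_EFinP|exact: (measurableT_comp mh mnrm)].
have g0 r : (0 <= g r)%E by rewrite /g mule_ge0 // lee_fin /nrm.
pose q (z : plane R) := ((polar_density z)%:E * h (eucl (polar z)))%E.
have mq : measurable_fun setT q.
  apply: emeasurable_funM; last exact: (measurableT_comp mhe measurable_polar).
  by apply/measurable_EFinP; exact: measurable_polar_density.
have q0 z : (0 <= q z)%E by rewrite /q mule_ge0 // lee_fin polar_density_ge0.
rewrite (fubini_tonelli1 q)//.
have sV0 s : (0 <= ((1 + s ^+ 2)^-1 : R)%:E)%E by rewrite lee_fin invr_ge0 ltW// onep_sqr_gt0.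
transitivity (\int[mu]_s (((1 + s ^+ 2)^-1)%:E * \int[mu]_r g r))%E.
  apply: eq_integral => s _; rewrite /fubini_F -ge0_integralZl//.
  apply: eq_integral => r _; rewrite /q eucl_polar /polar_density /g /=.
  by rewrite EFinM muleA -EFinM [(_ / _)%R]mulrC.
rewrite ge0_integralZr//; last 2 first.
- apply/measurable_EFinP; apply: measurable_inv_comp.
  by apply: measurable_funD => //; exact: measurable_funX.
- exact: integral_ge0.
rewrite integral_oneDsqrV ge0_even_integral//; last first.
  by move=> r; rewrite /g /nrm normrN.
rewrite muleA -EFinM mulrC; congr (_ * _)%E.
apply: eq_integral => r; rewrite inE /= in_itv /= andbT => r0.
by rewrite /g /nrm gtr0_norm.
Qed.

End polar_integral.

(** * Test functions and weak derivatives in the plane *)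

Section plane_topology.
Context {R : realType}.

(** This links the product topology with the product sigma-algebra: an open set is the countable
    union of the boxes with rational centre and side [2 / (n + 1)] that it contains. *)
Lemma open_measurable_plane (U : set (R * R)) : open U -> measurable (U : set (plane R)).
Proof.
move=> oU.
pose Bx (i : rat * rat * nat) : set (plane R) :=
  `]ratr i.1.1 - i.2.+1%:R^-1, ratr i.1.1 + i.2.+1%:R^-1[%classic `*`
  `]ratr i.1.2 - i.2.+1%:R^-1, ratr i.1.2 + i.2.+1%:R^-1[%classic.
pose F i : set (plane R) := [set x | Bx i x /\ Bx i `<=` U].
suff -> : (U : set (plane R)) = \bigcup_i F i.
  apply: countable_bigcupT_measurable; first exact: countableP.
  move=> i; have [BU|BU] := pselect (Bx i `<=` U).
    rewrite (_ : F i = Bx i); first by apply: measurableX; exact: measurable_itv.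
    by apply/seteqP; split => [x []|x].
  by rewrite (_ : F i = set0)//; apply/seteqP; split => [x []|x].
apply/seteqP; split => [x Ux|x [i _ [Bx_ +]]]; last exact.
have /nbhs_ballP[e /= e0 eU] : nbhs x U by apply: open_nbhs_nbhs; split.
have [n ne] : exists n, n.+1%:R^-1 < e / 2.
  have e20 : 0 < e / 2 by rewrite divr_gt0.
  have [N _ HN] := near_infty_natSinv_lt (PosNum e20).
  by exists N; apply: HN => /=.
have near_rat (t : R) : exists q : rat, t - n.+1%:R^-1 < ratr q < t + n.+1%:R^-1.
  have [q] : exists q, ratr q \in `]t - n.+1%:R^-1, t + n.+1%:R^-1[.
    apply: rat_in_itvoo; have : 0 < n.+1%:R^-1 :> R by rewrite invr_gt0.
    by move: (n.+1%:R^-1) => z; lra.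
  by rewrite in_itv /=; exists q.
have [p pP] := near_rat x.1; have [q qP] := near_rat x.2.
exists (p, q, n) => //; split.
  by split => /=; rewrite in_itv /=; move: pP qP; move: (n.+1%:R^-1) => z; lra.
move=> y [/=]; rewrite !in_itv /= => y1 y2; apply: eU; split; rewrite /ball /= ltr_norml;
  move: pP qP y1 y2 ne; move: (n.+1%:R^-1) => z; lra.
Qed.

Lemma compact_measurable_plane (K : set (R * R)) : compact K -> measurable (K : set (plane R)).
Proof.
move=> /compact_closed cK; rewrite -[K]setCK; apply: measurableC.
by apply: open_measurable_plane; apply: closed_openC; apply: cK; exact: norm_hausdorff.
Qed.

Lemma continuous_measurable_plane (f : R * R -> R) : continuous f ->
  measurable_fun setT (f : plane R -> R).
Proof.
move=> /continuousP cf; apply: (measurability _ (RGenOpens.measurableE R)).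
move=> _ [_ [a [b ->] <-]]; rewrite setTI; apply: open_measurable_plane.
exact/cf/interval_open.
Qed.

Lemma eucl_ge0 (x : R * R) : 0 <= eucl x. Proof. exact: sqrtr_ge0. Qed.

Lemma ler_norm1_eucl (x : R * R) : `|x.1| <= eucl x.
Proof. by rewrite -sqrtr_sqr ler_wsqrtr// lerDl sqr_ge0. Qed.

Lemma ler_norm2_eucl (x : R * R) : `|x.2| <= eucl x.
Proof. by rewrite -sqrtr_sqr ler_wsqrtr// lerDr sqr_ge0. Qed.

Lemma eucl_eq0 (x : R * R) : eucl x = 0 -> x = 0.
Proof.
move=> x0; have := ler_norm1_eucl x; have := ler_norm2_eucl x.
rewrite x0 !normr_le0 => /eqP x2 /eqP x1.
by rewrite (surjective_pairing x) x1 x2.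
Qed.

Lemma eucl_gt0 (x : R * R) : x <> 0 -> 0 < eucl x.
Proof.
move=> x0; rewrite lt_neqAle eucl_ge0 andbT; apply/eqP => /esym/eucl_eq0; exact: x0.
Qed.

Lemma continuous_eucl : continuous (@eucl R).
Proof.
move=> x; apply: (@cvg_comp _ _ _ (fun y : R * R => y.1 ^+ 2 + y.2 ^+ 2) Num.sqrt);
  last exact: sqrt_continuous.
rewrite (_ : (fun y : R * R => _) = (fun y : R * R => y.1 * y.1 + y.2 * y.2))//.
apply: cvgD; apply: cvgM; try exact: cvg_fst; exact: cvg_snd.
Qed.

Lemma compact_eucl_bounded (K : set (R * R)) : compact K ->
  exists2 A, 0 < A & forall x, K x -> eucl x <= A.
Proof.
move=> /(continuous_compact (continuous_subspaceT continuous_eucl)) /compact_bounded[M [Mr H]].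
exists (`|M| + 1) => [|x Kx]; first by have := normr_ge0 M; lra.
have M1 : M < `|M| + 1 by have := ler_norm M; lra.
have := H _ M1 (eucl x) (ex_intro2 _ _ x Kx erefl).
by rewrite /= ger0_norm// eucl_ge0.
Qed.

Lemma continuous_compact_support_bounded (f : R * R -> R) : continuous f ->
  compact (closure [set x | f x != 0]) ->
  exists2 B, 0 <= B & forall x, `|f x| <= B.
Proof.
move=> cf ck.
have [M [Mr H]] := compact_bounded (continuous_compact (continuous_subspaceT cf) ck).
exists (`|M| + 1) => [|x]; first by have := normr_ge0 M; lra.
have M1 : M < `|M| + 1 by have := ler_norm M; lra.
have [->|fx] := eqVneq (f x) 0; first by rewrite normr0; have := normr_ge0 M; lra.
by apply: (H _ M1); exists x => //; exact: subset_closure.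
Qed.

Lemma compact_support_radius (f : R * R -> R) :
  compact (closure [set x | f x != 0]) ->
  exists2 A, 0 < A & forall x, A < eucl x -> f x = 0.
Proof.
move=> /compact_eucl_bounded[A A0 HA]; exists A => // x Ax.
apply/eqP/negPn/negP => fx.
have : eucl x <= A by apply: HA; apply: subset_closure.
by rewrite leNgt Ax.
Qed.

End plane_topology.

Section line_derivatives.
Context {R : realType}.
Implicit Types f : R * R -> R.

Let quotient1 f x : (fun h : R => h^-1 *: ((f \o shift x) (h *: (1, 0)) - f x)) =
  (fun h : R => h^-1 *: (((fun t => f (t, x.2)) \o shift x.1) (h *: (1 : R)) - f (x.1, x.2))).
Proof.
apply/funext => h; case: x => a b; congr (_ *: (f _ - _)).
by rewrite /shift /=; congr (_, _); rewrite /= scaler0 add0r.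
Qed.

Let quotient2 f x : (fun h : R => h^-1 *: ((f \o shift x) (h *: (0, 1)) - f x)) =
  (fun h : R => h^-1 *: (((fun t => f (x.1, t)) \o shift x.2) (h *: (1 : R)) - f (x.1, x.2))).
Proof.
apply/funext => h; case: x => a b; congr (_ *: (f _ - _)).
by rewrite /shift /=; congr (_, _); rewrite /= scaler0 add0r.
Qed.

Lemma derivable_line1 f x d : is_derive x.1 (1 : R) (fun t => f (t, x.2)) d ->
  derivable f x (1, 0) /\ pd1 f x = d.
Proof. by move=> [D E]; rewrite /pd1 /derivable /derive quotient1; split. Qed.

Lemma derivable_line2 f x d : is_derive x.2 (1 : R) (fun t => f (x.1, t)) d ->
  derivable f x (0, 1) /\ pd2 f x = d.
Proof. by move=> [D E]; rewrite /pd2 /derivable /derive quotient2; split. Qed.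

Lemma is_derive_line1 f a b : derivable f (a, b) (1, 0) ->
  is_derive (a : R) (1 : R) (fun t => f (t, b)) (pd1 f (a, b)).
Proof.
rewrite /pd1 /derivable /derive quotient1 /= => D.
by apply: DeriveDef.
Qed.

Lemma is_derive_line2 f a b : derivable f (a, b) (0, 1) ->
  is_derive (b : R) (1 : R) (fun t => f (a, t)) (pd2 f (a, b)).
Proof.
rewrite /pd2 /derivable /derive quotient2 /= => D.
by apply: DeriveDef.
Qed.

Lemma is_derive_continuous (f : R -> R) (x d : R) :
  is_derive x (1 : R) f d -> {for x, continuous f}.
Proof. by move=> [D _]; apply: differentiable_continuous; exact/derivable1_diffP. Qed.

Lemma MVT_between (f df : R -> R) : (forall x : R, is_derive x (1 : R) f (df x)) ->
  forall x y : R, exists2 c, `|c - x| <= `|y - x| & f y - f x = df c * (y - x).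
Proof.
move=> D x y.
have cf a b : {within `[a, b], continuous f}.
  by apply: continuous_subspaceT => z; exact: is_derive_continuous (D z).
have [xy|/ltW yx] := leP x y.
  have [c] := MVT_segment xy (fun x _ => D x) (cf x y).
  rewrite in_itv /= => /andP[xc cy] E; exists c => //.
  by rewrite !ger0_norm ?subr_ge0// lerB.
have [c] := MVT_segment yx (fun x _ => D x) (cf y x).
rewrite in_itv /= => /andP[xc cy] E; exists c; last by rewrite -opprB E; ring.
by rewrite !ler0_norm ?subr_le0// !opprB lerB.
Qed.

(** The classical argument from continuous partial derivatives: the increment is split along the two
    sides of a rectangle, and the mean value theorem is applied on each side. *)
Lemma is_derive_ray (f : R * R -> R) (a b r : R) :
  (forall x, derivable f x (1, 0) /\ derivable f x (0, 1)) ->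
  continuous (pd1 f) -> continuous (pd2 f) ->
  is_derive r (1 : R) (fun r => f (r * a, r * b))
    (a * pd1 f (r * a, r * b) + b * pd2 f (r * a, r * b)).
Proof.
move=> D c1 c2; apply: is_derive_eps => e e0.
have ab0 : 0 < `|a| + `|b| + 1 by have := normr_ge0 a; have := normr_ge0 b; lra.
pose eps := e / (`|a| + `|b| + 1).
have eps0 : 0 < eps by rewrite divr_gt0.
pose p : R * R := (r * a, r * b).
have /cvgrPdist_le/(_ _ eps0) /nbhs_ballP[d1 /= d10 H1] := c1 p.
have /cvgrPdist_le/(_ _ eps0) /nbhs_ballP[d2 /= d20 H2] := c2 p.
pose d := Num.min d1 d2 / (`|a| + `|b| + 1).
have d0 : 0 < d by rewrite divr_gt0// lt_min d10.
exists d => // y yr.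
have rad u v : `|u - r * a| <= `|y * a - r * a| -> `|v - r * b| <= `|y * b - r * b| ->
    `|pd1 f p - pd1 f (u, v)| <= eps /\ `|pd2 f p - pd2 f (u, v)| <= eps.
  rewrite -!mulrBl !normrM => ua vb.
  have yd : `|y - r| * (`|a| + `|b| + 1) < Num.min d1 d2 by rewrite -ltr_pdivlMr.
  have yrp := normr_ge0 (y - r).
  have ya : 0 <= `|y - r| * `|a| by rewrite mulr_ge0.
  have yb : 0 <= `|y - r| * `|b| by rewrite mulr_ge0.
  have [yd1 yd2] : `|y - r| * (`|a| + `|b| + 1) < d1 /\ `|y - r| * (`|a| + `|b| + 1) < d2.
    by split; apply: lt_le_trans yd _; rewrite ge_min lexx ?orbT.
  split; [apply: H1|apply: H2]; split; rewrite /ball /= distrC; lra.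
have [u ua E1] := MVT_between (fun x => is_derive_line1 (D (x, y * b)).1) (r * a) (y * a).
have [v vb E2] := MVT_between (fun x => is_derive_line2 (D (r * a, x)).2) (r * b) (y * b).
have [K1 _] := rad _ _ ua (lexx _).
have [_ K2] : `|pd1 f p - pd1 f (r * a, v)| <= eps /\ `|pd2 f p - pd2 f (r * a, v)| <= eps.
  by apply: rad => //; rewrite subrr normr0.
rewrite -/p.
have -> : f (y * a, y * b) - f (r * a, r * b) - (a * pd1 f p + b * pd2 f p) * (y - r) =
    - ((pd1 f p - pd1 f (u, y * b)) * a * (y - r) + (pd2 f p - pd2 f (r * a, v)) * b * (y - r)).
  have -> : f (y * a, y * b) - f (r * a, r * b) = (f (y * a, y * b) - f (r * a, y * b)) +
    (f (r * a, y * b) - f (r * a, r * b)) by ring.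
  by rewrite E1 E2; ring.
rewrite normrN (le_trans (ler_normD _ _))// !normrM -mulrDl ler_wpM2r//.
have e1 : e = eps * (`|a| + `|b| + 1) by rewrite divfK ?gt_eqF.
apply: (@le_trans _ _ (eps * `|a| + eps * `|b|)).
  by apply: lerD; rewrite ler_wpM2r.
by rewrite e1 !mulrDr mulr1; lra.
Qed.

End line_derivatives.

(** * Integration by parts on the line *)

Section compactly_supported.
Context {R : realType}.
Local Notation mu := (@lebesgue_measure R).
Variables (chi dchi : R -> R) (A : R).
Hypothesis dchiE : forall r : R, is_derive r (1 : R) chi (dchi r).
Hypothesis cdchi : continuous dchi.
Hypothesis chi0 : forall r, A < `|r| -> chi r = 0.

Lemma dchi0 r : A < `|r| -> dchi r = 0.
Proof.
move=> Ar; have [_ <-] := dchiE r.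
suff [_ ->] : is_derive r (1 : R) chi 0 by [].
apply: is_derive_eps => e e0; exists (`|r| - A); first by rewrite subr_gt0.
move=> y yr; rewrite !chi0//; first by rewrite subrr mul0r subrr normr0 mulr_ge0// ltW.
have := ler_normB r y.
have := ler_dist_dist y r; rewrite ler_norml; lra.
Qed.

Lemma integrable_dchi : mu.-integrable setT (EFin \o dchi).
Proof.
have H : mu.-integrable `[- A, A] (EFin \o dchi).
  apply: continuous_compact_integrable; first exact: segment_compact.
  exact: continuous_subspaceT.
have := (integrable_mkcond (mu := mu) (EFin \o dchi) (measurable_itv `[- A, A])).1 H.
congr (mu.-integrable setT _); apply/funext => r; rewrite patchE.
case: ifPn => //; rewrite mem_setE in_itv /= -ler_norml -ltNge => Ar.
by rewrite /= dchi0.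
Qed.

Lemma integral_dchi_itv a b : a < b -> \int[mu]_(r in `[a, b]) dchi r = chi b - chi a.
Proof.
move=> ab; rewrite /Rintegral (@continuous_FTC2 _ dchi chi)//.
- exact: continuous_subspaceT.
- split.
  + by move=> x _; have [] := dchiE x.
  + by apply: cvg_at_right_filter; exact: is_derive_continuous (dchiE a).
  + by apply: cvg_at_left_filter; exact: is_derive_continuous (dchiE b).
- by move=> x _; rewrite derive1E; have [] := dchiE x.
Qed.

Lemma integral_dchi_right r : \int[mu]_(x in `]r, +oo[) dchi x = - chi r.
Proof.
pose B := Num.max A r + 1.
have rB : r < B by rewrite /B (@le_lt_trans _ _ (Num.max A r)) ?ltrDl// le_max lexx orbT.
have AB : A < B by rewrite /B (@le_lt_trans _ _ (Num.max A r)) ?ltrDl// le_max lexx.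
have -> : \int[mu]_(x in `]r, +oo[) dchi x = \int[mu]_(x in `]r, B]) dchi x.
  rewrite Rintegral_mkcond [RHS]Rintegral_mkcond; congr Rintegral.
  apply/funext => x; rewrite !patchE !mem_setE !in_itv /= andbT.
  case: (ltP r x) => //= rx; case: leP => // Bx.
  by rewrite dchi0// (lt_trans AB)// (lt_le_trans Bx)// ler_norm.
rewrite Rintegral_itv_obnd_cbnd; last exact: integrableS integrable_dchi.
rewrite integral_dchi_itv// (@chi0 B) ?sub0r//.
by rewrite (lt_le_trans AB)// ler_norm.
Qed.

Lemma integral_dchi : \int[mu]_x dchi x = 0.
Proof.
pose B := `|A| + 1.
have AB : A < B by rewrite /B (le_lt_trans (ler_norm _))// ltrDl.
have B0 : 0 < B by rewrite /B ltr_wpDl.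
have -> : \int[mu]_x dchi x = \int[mu]_(x in `[- B, B]) dchi x.
  rewrite [RHS]Rintegral_mkcond; congr Rintegral.
  apply/funext => x; rewrite !patchE !mem_setE !in_itv /= -ler_norml.
  by case: leP => // Bx; rewrite dchi0// (lt_trans AB).
rewrite integral_dchi_itv; last by rewrite gtrN.
by rewrite !chi0 ?subrr// ?normrN gtr0_norm.
Qed.

End compactly_supported.

Section cumulative_by_parts.
Context {R : realType}.
Local Notation mu := (@lebesgue_measure R).

Lemma integrable_prod (f g : measurableTypeR R -> R) :
  mu.-integrable setT (EFin \o f) -> mu.-integrable setT (EFin \o g) ->
  (leb2 R).-integrable setT (EFin \o (fun z => f z.1 * g z.2)).
Proof.
move=> fi gi; have mf := measurable_integrable fi; have mg := measurable_integrable gi.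
pose F (z : plane R) := f z.1 * g z.2.
apply/integrable12ltyP.
  apply/measurable_EFinP; apply: measurable_funM.
    exact: (measurableT_comp mf measurable_fst).
  exact: (measurableT_comp mg measurable_snd).
have -> : (\int[mu]_x \int[mu]_y `|(EFin \o F) (x, y)| =
    \int[mu]_x (`|(f x)%:E| * \int[mu]_y `|(g y)%:E|))%E.
  apply: eq_integral => x _; rewrite -ge0_integralZl//.
    by apply: eq_integral => y _; rewrite /= /F normrM EFinM.
  by apply: measurableT_comp => //; exact/measurable_EFinP.
rewrite ge0_integralZr//; last 2 first.
- by apply: measurableT_comp => //; exact/measurable_EFinP.
- exact: integral_ge0.
by apply: lte_mul_pinfty; [exact: integral_ge0|
  rewrite ge0_fin_numE ?integral_ge0//; case/integrableP : fi|case/integrableP : gi].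
Qed.

(** Fubini on the half-plane [y <= x] for [dchi x * g y]. As [g] is only integrable, its cumulative
    integral need not be differentiable at every point. *)
Lemma cumulative_by_parts (g chi dchi : R -> R) (A : R) :
  mu.-integrable setT (EFin \o g) ->
  (forall r : R, is_derive r (1 : R) chi (dchi r)) -> continuous dchi ->
  (forall r, A < `|r| -> chi r = 0) ->
  \int[mu]_r (cumulative g r * dchi r) = \int[mu]_r (- (g r * chi r)).
Proof.
move=> gi D cd chi0; have di := integrable_dchi D cd chi0.
have mg := measurable_integrable gi.
pose S : set (plane R) := [set z | z.2 <= z.1].
have mS : measurable S.
  rewrite (_ : S = (fun z : plane R => z.2 - z.1) @^-1` `]-oo, 0]); last first.
    by apply/seteqP; split => z; rewrite /S /= in_itv /= subr_le0.
  rewrite -[X in measurable X]setTI.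
  have : measurable_fun setT (fun z : plane R => z.2 - z.1).
    by apply: measurable_funB; [exact: measurable_snd|exact: measurable_fst].
  by apply => //; exact: measurable_itv.
have SE x y : ((x, y) \in S) = (y <= x) by apply/idP/idP; rewrite inE.
pose h (z : plane R) := dchi z.1 * g z.2 * \1_S z.
have ih : (leb2 R).-integrable setT (EFin \o h).
  apply: (integrable_le_norm measurableT _ (integrable_norm (integrable_prod di gi))).
    apply: measurable_funM; last exact: measurable_indic.
    exact: measurable_integrable (integrable_prod di gi).
  move=> z _; rewrite /h normrM ler_piMr// indicE; by case: (_ \in _); rewrite ?normr1 ?normr0.
have := Fubini ih.
rewrite -[X in X = _ -> _]/(\int[mu]_x fubini_F mu (EFin \o h) x)%E.
rewrite -[X in _ = X -> _]/(\int[mu]_x fubini_G mu (EFin \o h) x)%E.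
have -> : fubini_F mu (EFin \o h) = EFin \o (fun r => cumulative g r * dchi r).
  apply/funext => r; rewrite /fubini_F /=.
  have -> : (fun y => (h (r, y))%:E) = (fun y => ((dchi r)%:E * ((g \_ `]-oo, r]) y)%:E)%E).
    apply/funext => y; rewrite /h /= patchE mem_setE in_itv /= indicE SE -EFinM.
    by case: leP => _; rewrite ?mulr1// -[point]/(0 : R) !mulr0.
  have ig' : mu.-integrable setT (EFin \o (g \_ `]-oo, r])).
    rewrite -restrict_EFin; apply/integrable_restrict => //.
    by rewrite setTI; exact: integrableS gi.
  rewrite integralZl// -EFin_Rintegral// -EFinM mulrC.
  by rewrite /cumulative [in RHS]Rintegral_mkcond.
have -> : fubini_G mu (EFin \o h) = EFin \o (fun r => - (g r * chi r)).
  apply/funext => y; rewrite /fubini_G /=.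
  have -> : (fun x => (h (x, y))%:E) = (fun x => ((g y)%:E * ((dchi \_ `[y, +oo[) x)%:E)%E).
    apply/funext => x; rewrite /h /= patchE mem_setE in_itv /= andbT indicE SE -EFinM.
    by case: leP => _; rewrite ?mulr1 1?mulrC// -[point]/(0 : R) mulr0 mul0r.
  have id' : mu.-integrable setT (EFin \o (dchi \_ `[y, +oo[)).
    rewrite -restrict_EFin; apply/integrable_restrict => //.
    by rewrite setTI; exact: integrableS di.
  rewrite integralZl// -EFin_Rintegral// -EFinM -mulrN; congr (_ * _)%:E.
  rewrite -[LHS]Rintegral_mkcond -Rintegral_itv_obnd_cbnd ?(integral_dchi_right D cd chi0)//.
  exact: integrableS di.
by move=> H; rewrite /Rintegral; congr fine.
Qed.

End cumulative_by_parts.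

Section test_functions.
Context {R : realType}.
Local Notation mu := (@lebesgue_measure R).
Implicit Types phi theta : R * R -> R.

Lemma test_continuous phi : test_function phi -> continuous phi.
Proof. by move=> [H _] x; have [h _] := H 0%N; exact: h. Qed.

Lemma test_derivable phi : test_function phi ->
  forall x, derivable phi x (1, 0) /\ derivable phi x (0, 1).
Proof. by move=> [H _] x; have [_ [h _ _]] := H 1%N; exact: h. Qed.

Let pd_support phi (v : R * R) :
  [set x | 'D_v phi x != 0] `<=` closure [set x | phi x != 0].
Proof.
move=> x /= dx; apply: contrapT => nx; move/eqP : dx; apply.
have near0 : \forall y \near x, phi y = 0.
  have oC : open (~` closure [set x | phi x != 0]).
    by apply: closed_openC; exact: closed_closure.
  have : nbhs x (~` closure [set x | phi x != 0]) by apply: open_nbhs_nbhs; split.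
  apply: filterS => y ny; apply/eqP/negPn/negP => fy; apply: ny.
  exact: subset_closure.
rewrite (@near_eq_derive _ _ _ phi (cst 0) x v near0). exact: derive_cst.
Qed.

Let pd_compact phi (v : R * R) : compact (closure [set x | phi x != 0]) ->
  compact (closure [set x | 'D_v phi x != 0]).
Proof.
move=> ck; apply: subclosed_compact ck _; first exact: closed_closure.
have -> : closure [set x | phi x != 0] = closure (closure [set x | phi x != 0]).
  by apply/closure_id; exact: closed_closure.
by apply: closureS; exact: pd_support.
Qed.

Lemma test_pd1 phi : test_function phi -> test_function (pd1 phi).
Proof.
by move=> [H ck]; split=> [k|]; [have [_ []] := H k.+1|exact: pd_compact].
Qed.

Lemma test_pd2 phi : test_function phi -> test_function (pd2 phi).
Proof.
by move=> [H ck]; split=> [k|]; [have [_ []] := H k.+1|exact: pd_compact].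
Qed.

(** On the support of [theta] one has [|f| <= 1 + |f|^2]; the indicator of the square [[- A, A]^2]
    stands for the constant [1]. *)
Lemma integrable_Lp_loc_mul (f theta : plane R -> R) : Lp_loc 2 f ->
  continuous (theta : R * R -> R) ->
  compact (closure [set x : R * R | theta x != 0]) ->
  (leb2 R).-integrable setT (EFin \o (fun z => f z * theta z)).
Proof.
move=> [mf fK] ct ck.
have [B B0 HB] := continuous_compact_support_bounded ct ck.
have [A A0 HA] := compact_support_radius ck.
pose K : set (plane R) := closure [set x : R * R | theta x != 0].
have mK : measurable K by exact: compact_measurable_plane.
pose I : R -> R := \1_(`[- A, A]%classic).
have iI : mu.-integrable setT (EFin \o I) by exact: integrable_indic_itv.
have i1 := integrable_prod iI iI.
have i2 : (leb2 R).-integrable setT (EFin \o ((fun z => `|f z| ^+ 2) \_ K)).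
  rewrite -restrict_EFin; apply: (integrable_mkcond _ mK).1; apply/integrableP; split.
    apply/measurable_EFinP; apply: measurable_funX; apply: measurableT_comp => //.
    exact: measurable_funTS.
  have := fK K ck; congr (_ < _)%E; apply: eq_integral => z _ /=.
  by rewrite normrX normr_id.
have i3 := integrableZl measurableT B (integrableD measurableT i1 i2).
apply: (integrable_le_norm measurableT _ i3) => [|z _].
  by apply: measurable_funM => //; exact: continuous_measurable_plane.
rewrite /= normrM.
have [t0|t0] := eqVneq (theta z) 0.
  rewrite t0 normr0 mulr0 mulr_ge0// addr_ge0//.
    by rewrite /I !indicE mulr_ge0.
  by rewrite patchE; case: ifP => // _; rewrite exprn_ge0.
have Kz : z \in K by rewrite inE; apply: subset_closure.
rewrite patchE Kz.
have zA : eucl z <= A by rewrite leNgt; apply/negP => /HA /eqP; exact/negP.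
have -> : I z.1 = 1.
  by rewrite /I indicE mem_setE in_itv /= -ler_norml (le_trans (ler_norm1_eucl _)).
have -> : I z.2 = 1.
  by rewrite /I indicE mem_setE in_itv /= -ler_norml (le_trans (ler_norm2_eucl _)).
rewrite mulr1 mulrC; apply: ler_pM => //.
by have := sqr_ge0 (`|f z| - 1); have := normr_ge0 (f z); nra.
Qed.

Lemma integral_line_by_parts (p dp chi dchi : R -> R) (A : R) :
  (forall r : R, is_derive r (1 : R) p (dp r)) -> continuous dp ->
  (forall r : R, is_derive r (1 : R) chi (dchi r)) -> continuous dchi ->
  (forall r, A < `|r| -> chi r = 0) ->
  (\int[mu]_r (p r * dchi r + dp r * chi r)%:E = 0)%E.
Proof.
move=> Dp cdp Dc cdc c0.
have D r : is_derive r (1 : R) (p * chi) (p r * dchi r + dp r * chi r).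
  have := is_deriveM (Dp r) (Dc r); rewrite /GRing.scale /= addrC.
  by rewrite [chi r * _]mulrC addrC.
have cD : continuous (fun r => p r * dchi r + dp r * chi r).
  move=> r; apply: cvgD; apply: cvgM; try exact: cdc; try exact: cdp.
    exact: is_derive_continuous (Dp r).
  exact: is_derive_continuous (Dc r).
have c0' r : A < `|r| -> (p * chi) r = 0.
  by move=> Ar; rewrite -[LHS]/(p r * chi r) c0// mulr0.
have := integral_dchi D cD c0'.
have i := integrable_dchi D cD c0'.
by move=> H; rewrite -EFin_Rintegral// H.
Qed.

Section weak_gradient.
Variables psi g1 g2 : plane R -> R.
Hypotheses (psi2 : Lp_loc 2 psi) (g12 : Lp_loc 2 g1) (g22 : Lp_loc 2 g2).
Hypothesis D1 : forall a b : R, b != 0 ->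
  is_derive a (1 : R) (fun t => psi (t, b)) (g1 (a, b)).
Hypothesis D2 : forall a b : R, a != 0 ->
  is_derive b (1 : R) (fun t => psi (a, t)) (g2 (a, b)).
Hypothesis c1 : forall b : R, b != 0 -> continuous (fun a : R => g1 (a, b)).
Hypothesis c2 : forall a : R, a != 0 -> continuous (fun b : R => g2 (a, b)).

Let cline1 phi (b : R) : continuous phi -> continuous (fun a : R => phi (a, b)).
Proof.
move=> cphi a; apply: (@cvg_comp _ _ _ (fun a : R => (a, b)) phi); last exact: cphi.
by apply: (@cvg_pair _ _ _ _ (nbhs a) (nbhs b)); [exact: cvg_id|exact: cvg_cst].
Qed.

Let cline2 phi (a : R) : continuous phi -> continuous (fun b : R => phi (a, b)).
Proof.
move=> cphi b; apply: (@cvg_comp _ _ _ (fun b : R => (a, b)) phi); last exact: cphi.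
by apply: (@cvg_pair _ _ _ _ (nbhs a) (nbhs b)); [exact: cvg_cst|exact: cvg_id].
Qed.

Let ae_neq0 (F : measurableTypeR R -> \bar R) : measurable_fun setT F ->
  (forall y, y != 0 -> F y = 0%E) -> (\int[mu]_y F y = 0)%E.
Proof.
move=> iF F0; rewrite -[RHS](integral0 mu setT); apply: ae_eq_integral => //.
exists [set 0]; split => //; first exact: lebesgue_measure_set1.
by move=> y /=; apply: contra_notP => /eqP y0 _; exact: F0.
Qed.

(** By Fubini it is enough to integrate by parts on the coordinate lines that miss the origin, where
    everything is classical; the one remaining line in each direction is null. Local square
    integrability justifies Fubini, so the origin leaves no singular term. *)
Lemma weak_gradient_punctured : weak_gradient psi g1 g2.
Proof.
move=> phi Tphi; have cphi := test_continuous Tphi; have [_ ck] := Tphi.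
have T1 := test_pd1 Tphi; have T2 := test_pd2 Tphi.
have [A A0 HA] := compact_support_radius ck.
have ip1 := integrable_Lp_loc_mul psi2 (test_continuous T1) T1.2.
have ip2 := integrable_Lp_loc_mul psi2 (test_continuous T2) T2.2.
have ig1 := integrable_Lp_loc_mul g12 cphi ck.
have ig2 := integrable_Lp_loc_mul g22 cphi ck.
split; apply/eqP; rewrite -subr_eq0 opprK -RintegralD//; apply/eqP.
  pose q z := psi z * pd1 phi z + g1 z * phi z.
  have iq : (leb2 R).-integrable setT (EFin \o q) by exact: (integrableD _ ip1 ig1).
  rewrite /Rintegral -(integral21_prod_meas1 iq) ae_neq0//; first exact: (measurable_fubini_G iq).
  move=> y y0; rewrite /fubini_G /= /q.
  apply: (@integral_line_by_parts (fun x => psi (x, y)) (fun x => g1 (x, y))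
    (fun x => phi (x, y)) (fun x => pd1 phi (x, y)) A).
  - by move=> r; exact: D1.
  - exact: c1.
  - by move=> r; apply: is_derive_line1; exact: (test_derivable Tphi (r, y)).1.
  - by apply: cline1; exact: test_continuous T1.
  - by move=> r Ar; apply: HA; apply: lt_le_trans Ar (ler_norm1_eucl (r, y)).
pose q z := psi z * pd2 phi z + g2 z * phi z.
have iq : (leb2 R).-integrable setT (EFin \o q) by exact: (integrableD _ ip2 ig2).
rewrite /Rintegral -(integral12_prod_meas1 iq) ae_neq0//; first exact: (measurable_fubini_F iq).
move=> x x0; rewrite /fubini_F /= /q.
apply: (@integral_line_by_parts (fun y => psi (x, y)) (fun y => g2 (x, y))
  (fun y => phi (x, y)) (fun y => pd2 phi (x, y)) A).
- by move=> r; exact: D2.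
- exact: c2.
- by move=> r; apply: is_derive_line2; exact: (test_derivable Tphi (x, r)).2.
- by apply: cline2; exact: test_continuous T2.
- by move=> r Ar; apply: HA; apply: lt_le_trans Ar (ler_norm2_eucl (x, r)).
Qed.

End weak_gradient.

End test_functions.

(** * The weak Poisson equation for radial functions *)

Section radial_integral.
Context {R : realType}.
Local Notation mu := (@lebesgue_measure R).
Variables (g H : measurableTypeR R -> R).
Hypothesis mH : measurable_fun setT H.
Hypothesis ig : mu.-integrable setT (EFin \o g).
Hypothesis g0 : forall r, r <= 0 -> g r = 0.
Hypothesis gH : forall r, 0 < r -> g r = 2 * pi * r * H r.

Let ge0_radial (k kk : measurableTypeR R -> \bar R) :
  measurable_fun setT k -> (forall r, (0 <= k r)%E) ->
  (forall r, r <= 0 -> kk r = 0%E) ->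
  (forall r, 0 < r -> kk r = ((2 * pi * r)%:E * k r)%E) ->
  (\int[leb2 R]_x k (eucl x) = \int[mu]_r kk r)%E.
Proof.
move=> mk k0 kk0 kkE; rewrite ge0_integral_radial// -ge0_integralZl//; last 3 first.
- apply: emeasurable_funM; last exact: measurable_funTS.
  by apply/measurable_EFinP; exact: measurable_funTS.
- by move=> r; rewrite /= in_itv /= andbT => r0; rewrite mule_ge0// lee_fin ltW.
- by rewrite lee_fin mulr_ge0// pi_ge0.
rewrite integral_mkcond; apply: eq_integral => r _; rewrite patchE mem_setE in_itv /= andbT.
by case: ltP => r0; [rewrite kkE// muleA -EFinM|rewrite kk0].
Qed.

Lemma integrable_radial : (leb2 R).-integrable setT (EFin \o (fun x => H (eucl x))).
Proof.
apply/integrableP; split.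
  by apply/measurable_EFinP; exact: (measurableT_comp mH measurable_eucl).
have /integrableP[_] := ig.
have E : (\int[leb2 R]_x `|(H (eucl x))%:E| = \int[mu]_r `|(g r)%:E|)%E.
  apply: (@ge0_radial (fun r => `|(H r)%:E|%E) (fun r => `|(g r)%:E|%E)) => //.
  - by apply: measurableT_comp => //; exact/measurable_EFinP.
  - by move=> r r0; rewrite g0// abse0.
  - move=> r r0; rewrite gH// EFinM abseM gee0_abs// lee_fin !mulr_ge0// ?pi_ge0//.
    exact: ltW.
by move: E => /= ->.
Qed.

Lemma Rintegral_radial : \int[leb2 R]_x H (eucl x) = \int[mu]_r g r.
Proof.
rewrite /Rintegral; congr fine; rewrite integralE [RHS]integralE.
have mHE : measurable_fun setT (EFin \o H) by exact/measurable_EFinP.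
have c0 r : 0 < r -> (0 <= (2 * pi * r)%:E :> \bar R)%E.
  by move=> r0; rewrite lee_fin !mulr_ge0// ?pi_ge0// ltW.
congr (_ - _)%E.
- rewrite -(@ge0_radial ((EFin \o H)^\+)%E ((EFin \o g)^\+)%E).
  + by apply: eq_integral => x _; rewrite !funeposE.
  + exact: measurable_funepos.
  + by move=> r.
  + by move=> r r0; rewrite funeposE /= g0// maxxx.
  + by move=> r r0; rewrite !funeposE /= gH// EFinM maxe_pMr ?c0// mule0.
- rewrite -(@ge0_radial ((EFin \o H)^\-)%E ((EFin \o g)^\-)%E).
  + by apply: eq_integral => x _; rewrite !funenegE.
  + exact: measurable_funeneg.
  + by move=> r.
  + by move=> r r0; rewrite funenegE /= g0// oppr0 maxxx.
  + by move=> r r0; rewrite !funenegE /= gH// -mulrN EFinM maxe_pMr ?c0// mule0.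
Qed.

End radial_integral.

Section radial_poisson.
Context {R : realType}.
Local Notation mu := (@lebesgue_measure R).
Variables (g H : measurableTypeR R -> R) (beta : R) (psi g1 g2 : plane R -> R).
Hypothesis mH : measurable_fun setT H.
Hypothesis ig : mu.-integrable setT (EFin \o g).
Hypothesis g0 : forall r, r <= 0 -> g r = 0.
Hypothesis gH : forall r, 0 < r -> g r = 2 * pi * r * H r.
Hypotheses (psi2 : Lp_loc 2 psi) (g12 : Lp_loc 2 g1) (g22 : Lp_loc 2 g2).
Hypothesis g1E : forall x, g1 x = - (2 * beta * cumulative g (eucl x)) * (x.1 / eucl x ^+ 2).
Hypothesis g2E : forall x, g2 x = - (2 * beta * cumulative g (eucl x)) * (x.2 / eucl x ^+ 2).
Hypothesis wg : weak_gradient psi g1 g2.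

Let M := cumulative g.

Let Rintegral_opp (f : measurableTypeR R -> R) : measurable_fun setT f ->
  \int[mu]_r f r = \int[mu]_r f (- r).
Proof.
move=> mf; have mfE : measurable_fun setT (EFin \o f) by exact/measurable_EFinP.
rewrite /Rintegral; congr fine; rewrite integralE [RHS]integralE.
rewrite (ge0_integral_opp (f := (EFin \o f)^\+%E))//; last exact: measurable_funepos.
rewrite (ge0_integral_opp (f := (EFin \o f)^\-%E))//; last exact: measurable_funeneg.
by congr (_ - _)%E; apply: eq_integral => r _; rewrite ?funeposE ?funenegE.
Qed.

Let M0 r : r <= 0 -> M r = 0.
Proof.
move=> r0; rewrite /M /cumulative (@eq_Rintegral _ _ _ mu _ (cst 0)) ?Rintegral_cst ?mul0r//.
by move=> x; rewrite inE /= in_itv /= => xr; rewrite g0// (le_trans xr).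
Qed.

Let M_bounded r : `|M r| <= \int[mu]_x `|g x|.
Proof.
have i1 : mu.-integrable `]-oo, r] (EFin \o g) by exact: integrableS ig.
apply: le_trans (le_normr_Rintegral _ i1) _ => //.
rewrite Rintegral_mkcond; apply: le_Rintegral => //; last 2 first.
- exact: integrable_norm.
- by move=> x _; rewrite patchE; case: ifP => // _; rewrite -[point]/(0 : R).
rewrite -restrict_EFin; apply/integrable_restrict => //; rewrite setTI.
exact: integrable_norm.
Qed.

(** On a full line through the origin the radius is signed. Since [M] and [g] vanish for [r <= 0],
    [M r - M (- r)] is [sgn(r) M(|r|)] and, off [r = 0], [g r + g (- r)] is [g |r|]. The identity
    combines integration by parts against [chi] and against its reflection. *)
Let ray_by_parts (chi dchi : R -> R) (A c : R) :
  (forall r : R, is_derive r (1 : R) chi (dchi r)) -> continuous dchi ->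
  (forall r, A < `|r| -> chi r = 0) ->
  (\int[mu]_r (- c * ((M r - M (- r)) * dchi r))%:E =
   \int[mu]_r (c * ((g r + g (- r)) * chi r))%:E)%E.
Proof.
move=> D cd chi0.
have cchi : continuous chi by move=> r; exact: is_derive_continuous (D r).
have cM : continuous M by exact: continuous_cumulative.
have mg := measurable_integrable ig.
have mopp : measurable_fun setT (-%R : measurableTypeR R -> measurableTypeR R) by [].
have di := integrable_dchi D cd chi0.
pose chi' r := chi (- r); pose dchi' r := - dchi (- r).
have D' r : is_derive r (1 : R) chi' (dchi' r).
  have Dn : is_derive r (1 : R) (-%R : R -> R) (- 1) by exact: is_deriveN (is_derive_id r (1 : R)).
  have := @is_derive1_comp _ chi -%R r _ _ (D (- r)) Dn.
  by rewrite mulrN1 /chi' /dchi'; apply.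
have cd' : continuous dchi'.
  by move=> r; apply: cvgN; apply: (@cvg_comp _ _ _ -%R dchi); [exact: oppr_continuous|exact: cd].
have chi0' r : A < `|r| -> chi' r = 0 by move=> Ar; rewrite /chi' chi0// normrN.
have di' := integrable_dchi D' cd' chi0'.
have e1 := cumulative_by_parts ig D cd chi0.
have e2 := cumulative_by_parts ig D' cd' chi0'.
have cMo : continuous (fun r => M (- r)).
  by move=> r; apply: (@cvg_comp _ _ _ -%R M); [exact: oppr_continuous|exact: cM].
have iMd (m : R -> R) : continuous m -> (forall r, `|m r| <= \int[mu]_x `|g x|) ->
    mu.-integrable setT (EFin \o (fun r => m r * dchi r)).
  move=> cm mb; have mq := measurable_integrable di.
  apply: (integrable_le_norm measurableT _
    (integrableZl measurableT (\int[mu]_x `|g x|) (integrable_norm di))).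
    by apply: measurable_funM => //; exact: continuous_measurable_fun.
  by move=> r _; rewrite /= normrM ler_wpM2r.
have i1 := iMd _ cM M_bounded.
have i2 := iMd _ cMo (fun r => M_bounded (- r)).
have chib r : `|chi r| <= \int[mu]_x `|dchi x|.
  rewrite -normrN -(integral_dchi_right D cd chi0).
  have i3 : mu.-integrable `]r, +oo[ (EFin \o dchi) by exact: integrableS di.
  apply: le_trans (le_normr_Rintegral _ i3) _ => //.
  rewrite Rintegral_mkcond; apply: le_Rintegral => //; last 2 first.
  - exact: integrable_norm.
  - by move=> x _; rewrite patchE; case: ifP => // _; rewrite -[point]/(0 : R).
  rewrite -restrict_EFin; apply/integrable_restrict => //; rewrite setTI.
  exact: integrable_norm.
have mchi : measurable_fun setT chi by exact: continuous_measurable_fun.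
have i3 : mu.-integrable setT (EFin \o (fun r => g r * chi r)).
  apply: (integrable_le_norm measurableT _
    (integrableZl measurableT (\int[mu]_x `|dchi x|) (integrable_norm ig))).
    exact: measurable_funM.
  by move=> r _; rewrite /= normrM mulrC ler_wpM2r.
have igo : mu.-integrable setT (EFin \o (fun r => g (- r))).
  apply/integrableP; split; first by apply/measurable_EFinP; exact: (measurableT_comp mg mopp).
  have /integrableP[mgE] := ig.
  by rewrite (ge0_integral_opp (f := fun r => `|(g r)%:E|%E))//; exact: measurableT_comp.
have i4 : mu.-integrable setT (EFin \o (fun r => g (- r) * chi r)).
  apply: (integrable_le_norm measurableT _
    (integrableZl measurableT (\int[mu]_x `|dchi x|) (integrable_norm igo))).
    by apply: measurable_funM => //; exact: (measurableT_comp mg mopp).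
  by move=> r _; rewrite /= normrM mulrC ler_wpM2r.
have iX : mu.-integrable setT (EFin \o (fun r => (M r - M (- r)) * dchi r)).
  by apply: eq_integrable (integrableB measurableT i1 i2) => // r _; rewrite /= -EFinB mulrBl.
have iY : mu.-integrable setT (EFin \o (fun r => (g r + g (- r)) * chi r)).
  by apply: eq_integrable (integrableD measurableT i3 i4) => // r _; rewrite /= -EFinD mulrDl.
have e2' : \int[mu]_r (M (- r) * dchi r) = \int[mu]_r (g (- r) * chi r).
  have := e2; rewrite Rintegral_opp; last first.
    apply: measurable_funM; first exact: continuous_measurable_fun.
    exact: continuous_measurable_fun.
  rewrite [X in _ = X]Rintegral_opp; last first.
    apply: measurableT_comp => //; apply: measurable_funM => //.
    exact: (measurableT_comp mchi mopp).
  rewrite (@eq_Rintegral _ _ _ mu _ (fun r => -1 * (M (- r) * dchi r))); last first.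
    by move=> r _; rewrite /dchi' /= opprK mulrN mulN1r.
  rewrite [X in _ = X -> _](@eq_Rintegral _ _ _ mu _ (fun r => -1 * (g (- r) * chi r))); last first.
    by move=> r _; rewrite /chi' /= opprK mulN1r.
  by rewrite !RintegralZl// => /(mulrI _); apply; rewrite unitrN1.
have e1' : \int[mu]_r (M r * dchi r) = - \int[mu]_r (g r * chi r).
  rewrite e1 (@eq_Rintegral _ _ _ mu _ (fun r => -1 * (g r * chi r))) ?RintegralZl ?mulN1r//.
  by move=> r _; rewrite mulN1r.
have E : \int[mu]_r ((M r - M (- r)) * dchi r) = - \int[mu]_r ((g r + g (- r)) * chi r).
  rewrite (@eq_Rintegral _ _ _ mu _ (fun r => M r * dchi r - M (- r) * dchi r)); last first.
    by move=> r _; rewrite mulrBl.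
  rewrite [in RHS](@eq_Rintegral _ _ _ mu _ (fun r => g r * chi r + g (- r) * chi r)); last first.
    by move=> r _; rewrite mulrDl.
  by rewrite RintegralB// RintegralD// e1' e2' opprD.
rewrite -!EFin_Rintegral//.
- by rewrite !RintegralZl// E mulNr mulrN opprK.
- exact: (integrableZl measurableT c iY).
- exact: (integrableZl measurableT (- c) iX).
Qed.

(** In polar coordinates the factor [|r|] of the area element cancels the [1 / |r|] of the gradient.
    On the line of parameter [s] this leaves [- 2 beta / (1 + s^2)] times the signed mass times the
    derivative of [phi] along the line, while [4 pi beta H] becomes [2 beta g / (1 + s^2)]. *)
Lemma weak_poisson_radial :
  weak_poisson psi (fun x => 4 * pi * beta * H (eucl x)).
Proof.
move=> phi Tphi; have cphi := test_continuous Tphi; have [_ ck] := Tphi.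
have T1 := test_pd1 Tphi; have T2 := test_pd2 Tphi.
have c1 := test_continuous T1; have c2 := test_continuous T2.
have [A A0 HA] := compact_support_radius ck.
have [B B0 HB] := continuous_compact_support_bounded cphi ck.
have ip1 := integrable_Lp_loc_mul psi2 (test_continuous (test_pd1 T1)) (test_pd1 T1).2.
have ip2 := integrable_Lp_loc_mul psi2 (test_continuous (test_pd2 T2)) (test_pd2 T2).2.
have ig1 := integrable_Lp_loc_mul g12 c1 T1.2.
have ig2 := integrable_Lp_loc_mul g22 c2 T2.2.
pose Q1 x := g1 x * pd1 phi x + g2 x * pd2 phi x.
pose Q2 x := 4 * pi * beta * H (eucl x) * phi x.
have iQ1 : (leb2 R).-integrable setT (EFin \o Q1) by exact: (integrableD _ ig1 ig2).
have iQ2 : (leb2 R).-integrable setT (EFin \o Q2).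
  have iH := integrable_radial mH ig g0 gH.
  apply: (integrable_le_norm measurableT _
    (integrableZl measurableT (`|4 * pi * beta| * B) (integrable_norm iH))).
    apply: measurable_funM; last exact: continuous_measurable_plane.
    by apply: measurable_funM => //; exact: measurable_integrable iH.
  move=> x _; rewrite /= /Q2 normrM [`|_ * H _|]normrM mulrAC ler_wpM2r//.
  by rewrite ler_wpM2l.
(* [Q1] is the scalar product of the gradients; the weak gradient is tested against [pd1 phi] and
   [pd2 phi]. *)
transitivity (\int[leb2 R]_x Q1 x).
  rewrite (@eq_Rintegral _ _ _ (leb2 R) _
    (fun x => -1 * (psi x * pd1 (pd1 phi) x + psi x * pd2 (pd2 phi) x))); last first.
    by move=> x _; rewrite /laplacian; ring.
  rewrite RintegralZl//; last exact: (integrableD _ ip1 ip2).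
  have E1 : \int[leb2 R]_x (psi x * pd1 (pd1 phi) x + psi x * pd2 (pd2 phi) x) =
    \int[leb2 R]_x (psi x * pd1 (pd1 phi) x) + \int[leb2 R]_x (psi x * pd2 (pd2 phi) x).
    exact: (RintegralD measurableT ip1 ip2).
  have E2 : \int[leb2 R]_x Q1 x =
    \int[leb2 R]_x (g1 x * pd1 phi x) + \int[leb2 R]_x (g2 x * pd2 phi x).
    exact: (RintegralD measurableT ig1 ig2).
  have sgn (i j i' j' : R) : i = - i' -> j = - j' -> -1 * (i + j) = i' + j'.
    by move=> -> ->; rewrite mulN1r opprD !opprK.
  have [w1 _] := wg T1; have [_ w2] := wg T2.
  exact: (etrans (congr1 ( *%R (- 1)) E1) (etrans (sgn _ _ _ _ w1 w2) (esym E2))).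
rewrite (Rintegral_polar (f := Q1) (measurable_integrable iQ1)).
rewrite [RHS](Rintegral_polar (f := Q2) (measurable_integrable iQ2)).
have pQ1 := integrable_polar iQ1; have pQ2 := integrable_polar iQ2.
rewrite /Rintegral -(integral12_prod_meas1 pQ1) -(integral12_prod_meas1 pQ2).
congr fine; apply: eq_integral => s _; rewrite /fubini_F /=.
pose k := Num.sqrt (1 + s ^+ 2); pose a := s / k; pose b := k^-1.
have k20 := onep_sqr_gt0 s.
have D r : is_derive r (1 : R) (fun r : R => phi (r * a, r * b))
    (a * pd1 phi (r * a, r * b) + b * pd2 phi (r * a, r * b)).
  by apply: is_derive_ray c1 c2; exact: test_derivable.
have cray (f : R * R -> R) : continuous f -> continuous (fun r : R => f (r * a, r * b)).
  move=> cf r; apply: (@cvg_comp _ _ _ (fun r : R => (r * a, r * b)) f); last exact: cf.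
  by apply: (@cvg_pair _ _ _ _ (nbhs (r * a)) (nbhs (r * b)));
    apply: cvgM; [exact: cvg_id|exact: cvg_cst|exact: cvg_id|exact: cvg_cst].
have cdchi : continuous (fun r : R => a * pd1 phi (r * a, r * b) + b * pd2 phi (r * a, r * b)).
  by move=> r; apply: cvgD; apply: cvgM; [exact: cvg_cst|exact: cray|exact: cvg_cst|exact: cray].
have chi0 r : A < `|r| -> phi (r * a, r * b) = 0.
  by move=> Ar; apply: HA; rewrite (eucl_polar (s, r)).
have := ray_by_parts (2 * beta / (1 + s ^+ 2)) D cdchi chi0.
congr (_ = _); apply: eq_integral => r _; congr EFin.
  rewrite /Q1 g1E g2E eucl_polar /polar_density /polar /= -/k -/a -/b -/M.
  have [r0|r0|->] := ltrgt0P r.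
  - rewrite (M0 (_ : - r <= 0)) ?oppr_le0 ?ltW// subr0.
    by field; rewrite !gt_eqF.
  - rewrite (M0 (ltW r0)) sub0r.
    by field; rewrite ?oppr_eq0 ?(gt_eqF k20) ?(lt_eqF r0).
  - by rewrite oppr0 subrr !mul0r mulr0.
rewrite /Q2 eucl_polar /polar_density /polar /= -/k -/a -/b.
have [r0|r0|->] := ltrgt0P r.
- rewrite (g0 (_ : - r <= 0)) ?oppr_le0 ?ltW// addr0 gH//.
  by field; rewrite gt_eqF.
- rewrite (g0 (ltW r0)) add0r gH ?oppr_gt0//.
  by field; rewrite gt_eqF.
- by rewrite oppr0 g0// addr0 !mul0r mulr0.
Qed.

End radial_poisson.

(** * Construction of the radial profile *)

Section half_line.
Context {R : realType}.
Local Notation mu := (@lebesgue_measure R).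

Lemma integrable_bounded_primitive (f P : R -> R) (B : R) :
  (forall r : R, 0 < r -> is_derive r (1 : R) P (f r)) ->
  (forall r : R, 0 < r -> {for r, continuous f}) -> (forall r, 0 < r -> 0 <= f r) ->
  (forall r, 0 < r -> `|P r| <= B) ->
  mu.-integrable setT (EFin \o (f \_ `]0%R, +oo[)).
Proof.
move=> DP cf f0 PB.
pose J n : set R := `[n.+1%:R^-1, n.+1%:R]%classic.
have nV n : 0 < n.+1%:R^-1 :> R by rewrite invr_gt0.
have mJ n : @measurable _ (measurableTypeR R) (J n) by exact: measurable_itv.
have wcf n : {within J n, continuous f}.
  apply: continuous_in_subspaceT => r; rewrite inE /J /= in_itv /= => /andP[qr _].
  by apply: cf; exact: lt_le_trans (nV n) qr.
have iJ n : mu.-integrable (J n) (EFin \o f).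
  by apply: continuous_compact_integrable; [exact: segment_compact|exact: wcf].
have J0 n r : J n r -> 0 < r.
  by rewrite /J /= in_itv /= => /andP[+ _]; exact: lt_le_trans (nV n).
have mfJ n : measurable_fun setT (f \_ (J n)).
  exact: (proj1 (measurable_restrictT f (mJ n)) (measurable_integrable (iJ n))).
have cvgJ r : (fun n => (f \_ (J n)) r) @ \oo --> (f \_ `]0%R, +oo[) r.
  apply/cvgrPdist_lt => eps eps0; near=> n.
  rewrite (_ : (f \_ (J n)) r = (f \_ `]0, +oo[) r) ?subrr ?normr0//.
  rewrite !patchE /J !mem_setE !in_itv /= andbT; congr (if _ then _ else _).
  have [r0|r0] := ltP 0 r; last first.
    by apply/negP => /andP[/(lt_le_trans (nV n))]; rewrite ltNge r0.
  apply/andP; split.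
    rewrite -[leRHS]invrK lef_pV2 ?posrE ?invr_gt0// ltW//.
    apply: (@lt_trans _ _ n%:R); last by rewrite ltr_nat.
    by near: n; exact: nbhs_infty_gtr.
  rewrite ltW//; apply: (@lt_trans _ _ n%:R); last by rewrite ltr_nat.
  by near: n; exact: nbhs_infty_gtr.
have mf : measurable_fun setT (f \_ `]0%R, +oo[).
  have m0 : @measurable _ (measurableTypeR R) `]0%R, +oo[%classic by exact: measurable_itv.
  apply: (proj1 (measurable_restrictT f m0)).
  apply: open_continuous_measurable_fun; first exact: interval_open.
  by move=> r; rewrite inE /= in_itv /= andbT => /cf.
apply/integrableP; split; first exact/measurable_EFinP.
apply: (@le_lt_trans _ _ (2 * B)%:E); last exact: ltry.
apply: (@fatou_le _ _ _ mu (fun n => f \_ (J n)) _ (fun=> 2 * B)) => //; last exact: cvg_cst.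
- by move=> n r; rewrite patchE; case: ifPn => //; rewrite inE => /J0/f0.
- move=> r; rewrite ger0_norm; first exact: cvgJ.
  rewrite patchE; case: ifPn => //; rewrite mem_setE in_itv /= andbT.
  exact: f0.
- move=> n; rewrite (_ : (fun r => _) = (EFin \o f) \_ (J n)); last first.
    by apply/funext => r; rewrite /= !patchE /=; case: ifP.
  rewrite -integral_mkcond.
  (* For [n = 0] the interval is the point [1], to which the fundamental theorem does not apply. *)
  have [->|n0] := eqVneq n 0%N.
    rewrite /J invr1 set_itv1 integral_set1 lee_fin mulr_ge0//.
    exact: le_trans (PB 1 ltr01).
  have n1 : n.+1%:R^-1 < n.+1%:R :> R.
    apply: (@lt_trans _ _ 1); first by rewrite invf_lt1// ltr1n ltnS lt0n.
    by rewrite ltr1n ltnS lt0n.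
  rewrite /J (@continuous_FTC2 _ f P _ _ n1 (wcf n)).
  + rewrite -EFinB lee_fin.
    have := PB n.+1%:R (ltr0Sn _ n); have := PB _ (nV n).
    by rewrite !ler_norml; lra.
  + split.
    * move=> r; rewrite in_itv /= => /andP[r0 _].
      by have [] := DP r (lt_trans (nV n) r0).
    * apply: cvg_at_right_filter; exact: is_derive_continuous (DP _ (nV n)).
    * apply: cvg_at_left_filter; exact: is_derive_continuous (DP _ (ltr0Sn _ n)).
  + move=> r; rewrite in_itv /= => /andP[r0 _].
    by rewrite derive1E; have [] := DP r (lt_trans (nV n) r0).
Unshelve. all: by end_near. Qed.

(* a smooth majorant of [r^-1 exp (- eps |ln r|)] with primitive
   [2 / eps * atan (r ^ eps)] *)
Definition bump (eps r : R) : R :=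
  if 0 < r then r^-1 * (2 * expR (eps * ln r) / (1 + expR (eps * ln r) ^+ 2)) else 0.

Lemma bump_ge0 eps r : 0 <= bump eps r.
Proof.
by rewrite /bump; case: ltP => // r0; rewrite mulr_ge0 ?invr_ge0 ?(ltW r0).
Qed.

Lemma bump_ge eps r : 0 < eps -> 0 < r -> r^-1 * expR (- (eps * `|ln r|)) <= bump eps r.
Proof.
move=> eps0 r0; rewrite /bump r0 ler_wpM2l ?invr_ge0 ?(ltW r0)//.
rewrite ler_pdivlMr ?onep_sqr_gt0//.
have [t0|t0] := leP 0 (ln r).
  rewrite (ger0_norm t0) expRN mulrC ler_pdivrMr ?expR_gt0//.
  have : 1 <= expR (eps * ln r) by rewrite -(expR0 R) ler_expR mulr_ge0// ltW.
  by move: (expR _) => E E1; nra.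
rewrite (ltr0_norm t0) mulrN opprK.
have : expR (eps * ln r) <= 1 by rewrite expR_le1 pmulr_rle0// ltW.
have := expR_gt0 (eps * ln r).
by move: (expR _) => E E0 E1; nra.
Qed.

Lemma integrable_bump eps : 0 < eps -> mu.-integrable setT (EFin \o bump eps).
Proof.
move=> eps0.
pose f r := r^-1 * (2 * expR (eps * ln r) / (1 + expR (eps * ln r) ^+ 2)).
pose P r := 2 / eps * atan (expR (eps * ln r)).
have DE (r : R) : 0 < r -> is_derive r (1 : R) (fun r => expR (eps * ln r))
    (expR (eps * ln r) * (eps * r^-1)).
  move=> r0; have dl : is_derive r (1 : R) (fun r => eps * ln r) (eps * r^-1).
    have d1 := is_derive1_ln r0.
    exact (@is_deriveZ R R R (@ln R) eps r (1 : R) r^-1 d1).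
  exact: (is_derive1_comp (is_derive_expR _) dl).
have DP (r : R) : 0 < r -> is_derive r (1 : R) P (f r).
  move=> r0; have d1 := DE r r0.
  have d2 := @is_derive1_comp R (@atan R) (fun r => expR (eps * ln r)) r _ _ (is_derive1_atan _) d1.
  have d3 := @is_deriveZ R R R (@atan R \o (fun r => expR (eps * ln r))) (2 / eps) r (1 : R) _ d2.
  have -> : f r = (2 / eps) *:
      ((1 + expR (eps * ln r) ^+ 2)^-1 * (expR (eps * ln r) * (eps * r^-1))).
    by rewrite /f /GRing.scale /=; field; rewrite !gt_eqF// onep_sqr_gt0.
  exact d3.
have cE (r : R) : 0 < r -> {for r, continuous (fun r => expR (eps * ln r))}.
  by move=> r0; exact: is_derive_continuous (DE r r0).
have := @integrable_bounded_primitive f P (2 / eps * (pi / 2)) DP.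
have -> : bump eps = f \_ `]0, +oo[.
  by apply/funext => r; rewrite /bump patchE mem_setE in_itv /= andbT.
apply.
- move=> r r0; apply: cvgM; first by apply: cvgV => //; rewrite gt_eqF.
  apply: cvgM; first by apply: cvgM; [exact: cvg_cst|exact: cE].
  apply: cvgV; first by rewrite gt_eqF// onep_sqr_gt0.
  by apply: cvgD; [exact: cvg_cst|apply: cvgM; exact: cE].
- by move=> r r0; rewrite /f mulr_ge0 ?invr_ge0 ?(ltW r0).
- move=> r r0; rewrite /P normrM ger0_norm ?divr_ge0 ?(ltW eps0)//.
  rewrite ler_wpM2l ?divr_ge0 ?(ltW eps0)// ler_norml.
  by rewrite !ltW ?atan_ltpi2 ?atan_gtNpi2.
Qed.

End half_line.

Section hat_function.
Context {R : realType}.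

(** A tent built from two clamps, of slope [1] up to the midpoint and [- 1] after it. It will
    concentrate a competitor on the annulus where [V] is positive. *)
Lemma energy_le_hat (a b : R) : a < b -> exists h rho : R -> R, exists e,
  [/\ energy_le h rho e, continuous h, forall t, 0 <= h t <= b - a &
      forall t, (0 < h t) = (a < t < b)].
Proof.
move=> ab; pose c := (a + b) / 2.
have cE : 2 * c = a + b by rewrite /c; field.
have ac : a < c by rewrite /c; lra.
have cb : c < b by rewrite /c; lra.
have E0 : energy_le (cst 0 : R -> R) (cst 0) 0.
  by split=> s t st /=; rewrite !subr0 ?expr0n ?mulr0// lexx.
have := energy_le_clamp (- 1) cb (energy_le_clamp 1 ac E0).
set u := (X in energy_le X); set rho := (X in energy_le _ X); set e := (X in energy_le _ _ X).
move=> E; have := energy_le_shift (c - a) E => E'.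
have uE t : u t + (c - a) = if t <= a then 0 else if t <= c then t - a else
    if t <= b then b - t else 0.
  rewrite /u /=; have [ta|at_] := leP t a.
    by rewrite !clamp_le ?(ltW ac) ?(ltW cb)//; [ring|lra].
  have [tc|ct] := leP t c.
    by rewrite (clamp_id (ltW at_) tc) (clamp_le (ltW cb) tc); ring.
  rewrite (clamp_ge (ltW ac) (ltW ct)).
  have [tb|bt] := leP t b; first by rewrite (clamp_id (ltW ct) tb) /c; field.
  by rewrite (clamp_ge (ltW cb) (ltW bt)) /c; field.
exists (fun t => u t + (c - a)), rho, e; split => //.
- exact: energy_le_continuous E'.
- by move=> t; rewrite uE; case: (leP t a) => ?; [|case: (leP t c) => ?; [|case: (leP t b) => ?]];
    move: cE; lra.
- move=> t; rewrite uE; move: cE.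
  by case: (leP t a) => ?; [|case: (leP t c) => ?; [|case: (leP t b) => ?]] => ?;
    apply/idP/idP; rewrite ?ltxx ?subr_gt0; lra.
Qed.

End hat_function.

Section radial_functions.
Context {R : realType}.
Local Notation mu := (@lebesgue_measure R).

Lemma Lp_loc2_radial (f : plane R -> R) (h : measurableTypeR R -> R) :
  measurable_fun setT f -> measurable_fun setT h ->
  (forall x, f x ^+ 2 <= h (eucl x)) -> (forall r, 0 <= h r) ->
  (forall A : R, 0 < A -> (\int[mu]_(r in `]0%R, A]) (r * h r)%:E < +oo)%E) ->
  Lp_loc 2 f.
Proof.
move=> mf mh fh h0 hA; split => // K cK.
have [A A0 HA] := compact_eucl_bounded cK.
have mA : @measurable _ (measurableTypeR R) `]-oo, A]%classic by exact: measurable_itv.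
pose hh (r : measurableTypeR R) : \bar R := (h r * \1_(`]-oo, A]%classic) r)%:E.
have hh0 r : (0 <= hh r)%E by rewrite lee_fin mulr_ge0// indicE.
have mhh : measurable_fun setT hh.
  by apply/measurable_EFinP; apply: measurable_funM.
have mK := compact_measurable_plane cK.
rewrite integral_mkcond.
apply: (@le_lt_trans _ _ (\int[leb2 R]_x hh (eucl x))%E).
  apply: ge0_le_integral => //.
  - by move=> x _; rewrite patchE; case: ifP => // _; rewrite lee_fin exprn_ge0.
  - apply: (proj1 (measurable_restrictT _ mK)); apply/measurable_EFinP.
    apply: measurable_funX; apply: measurableT_comp => //; exact: measurable_funTS.
  - exact: (measurableT_comp mhh measurable_eucl).
  - move=> x _; rewrite patchE; case: ifPn => [|_]; last exact: hh0.
    rewrite inE => Kx; rewrite /hh lee_fin real_normK ?num_real//.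
    by rewrite indicE mem_setE in_itv /= HA// mulr1.
rewrite (ge0_integral_radial mhh hh0); apply: lte_mul_pinfty => //.
  by rewrite lee_fin mulr_ge0// pi_ge0.
apply: le_lt_trans (hA A A0).
rewrite integral_mkcond [leRHS]integral_mkcond; apply: ge0_le_integral => //.
- move=> r _; rewrite patchE mem_setE in_itv /= andbT; case: ltP => // r0.
  by rewrite mule_ge0// lee_fin ltW.
- apply: (proj1 (measurable_restrictT _ _)) => //; apply: emeasurable_funM.
    by apply/measurable_EFinP; exact: measurable_funTS.
  exact: measurable_funTS.
- apply: (proj1 (measurable_restrictT _ _)) => //; apply/measurable_EFinP.
  by apply: measurable_funM; apply: measurable_funTS.
- move=> r _; rewrite !patchE !mem_setE !in_itv /= andbT; case: ltP => //= r0.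
  rewrite /hh indicE mem_setE in_itv /=; case: (leP r A) => _.
    by rewrite mulr1 -EFinM.
  by rewrite mulr0 mule0.
Qed.

(** This lets [ln (eucl x)] be differentiated without a square root. At [y = 0] both sides are [0]
    by the convention for [ln 0]. *)
Lemma ln_sqrt (y : R) : 0 <= y -> ln (Num.sqrt y) = ln y / 2.
Proof.
rewrite le_eqVlt => /orP[/eqP <-|y0]; first by rewrite sqrtr0 ln0// mul0r.
rewrite -{2}(sqr_sqrtr (ltW y0)) lnXn ?sqrtr_gt0//.
by rewrite mulr2n; field.
Qed.

Lemma is_derive_ln_sqr (a b : R) : 0 < a ^+ 2 + b ^+ 2 ->
  is_derive a (1 : R) (fun t => ln (t ^+ 2 + b ^+ 2) / 2) (a / (a ^+ 2 + b ^+ 2)).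
Proof.
move=> ab.
have d0 : is_derive a (1 : R) (fun t : R => t ^+ 2 + b ^+ 2) (2 * a).
  apply: is_derive_eps => e e0; exists e => // y ya.
  have -> : y ^+ 2 + b ^+ 2 - (a ^+ 2 + b ^+ 2) - 2 * a * (y - a) = (y - a) * (y - a) by ring.
  by rewrite normrM ler_wpM2r// ltW.
have d1 := @is_derive1_comp R (@ln R) (fun t : R => t ^+ 2 + b ^+ 2) a _ _ (is_derive1_ln ab) d0.
have d2 := @is_deriveZ R R R (@ln R \o (fun t => t ^+ 2 + b ^+ 2)) 2^-1 a (1 : R) _ d1.
have -> : (fun t => ln (t ^+ 2 + b ^+ 2) / 2) = 2^-1 \*: (@ln R \o (fun t => t ^+ 2 + b ^+ 2)).
  by apply/funext => t; rewrite mulrC.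
have -> : a / (a ^+ 2 + b ^+ 2) = 2^-1 *: ((a ^+ 2 + b ^+ 2)^-1 * (2 * a)).
  by rewrite /GRing.scale /=; field; rewrite gt_eqF.
exact d2.
Qed.

Variables (Psi M : R -> R) (c : R).
Hypothesis DPsi : forall t : R, is_derive t (1 : R) Psi (- (c * M (expR t))).
Hypothesis cM : continuous M.

Definition radial_profile (x : R * R) := Psi (ln (eucl x)).
Definition radial_gradient1 (x : R * R) := - (c * M (eucl x)) * (x.1 / eucl x ^+ 2).
Definition radial_gradient2 (x : R * R) := - (c * M (eucl x)) * (x.2 / eucl x ^+ 2).

Lemma eucl_sqr (x : R * R) : eucl x ^+ 2 = x.1 ^+ 2 + x.2 ^+ 2.
Proof. by rewrite /eucl sqr_sqrtr// addr_ge0 ?sqr_ge0. Qed.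

Lemma radial_line1 (a b : R) : (a, b) <> 0 ->
  is_derive a (1 : R) (fun t => radial_profile (t, b)) (radial_gradient1 (a, b)).
Proof.
move=> /eucl_gt0 e0; have := exprn_gt0 2 e0; rewrite eucl_sqr /= => ab.
have -> : (fun t => radial_profile (t, b)) = Psi \o (fun t => ln (t ^+ 2 + b ^+ 2) / 2).
  by apply/funext => t; rewrite /= -ln_sqrt// addr_ge0 ?sqr_ge0.
rewrite /radial_gradient1 eucl_sqr /=.
have := DPsi (ln (eucl (a, b))); rewrite lnK ?posrE// => d1.
have := is_derive_ln_sqr ab => d2.
have e : ln (eucl (a, b)) = ln (a ^+ 2 + b ^+ 2) / 2 by rewrite -ln_sqrt// addr_ge0 ?sqr_ge0.
rewrite e in d1.
exact: (@is_derive1_comp R Psi _ a _ _ d1 d2).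
Qed.

Lemma radial_line2 (a b : R) : (a, b) <> 0 ->
  is_derive b (1 : R) (fun t => radial_profile (a, t)) (radial_gradient2 (a, b)).
Proof.
move=> ab0; have ba0 : (b, a) <> 0 by move=> [b0 a0]; apply: ab0; rewrite b0 a0.
have swap (u v : R) : eucl (u, v) = eucl (v, u) by rewrite /eucl /= addrC.
have := radial_line1 ba0; rewrite /radial_gradient1 /radial_gradient2 swap.
congr (is_derive _ _ _ _); apply/funext => t.
by rewrite /radial_profile swap.
Qed.

Lemma continuous_radial_profile (x : R * R) : x <> 0 -> {for x, continuous radial_profile}.
Proof.
move=> /eucl_gt0 e0.
have cl := continuous_comp (@continuous_eucl R x) (continuous_ln e0).
exact: (continuous_comp cl (is_derive_continuous (DPsi (ln (eucl x))))).
Qed.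

Let cvg_coef (x : R * R) : x <> 0 -> (fun y => - (c * M (eucl y))) @ x --> - (c * M (eucl x)).
Proof.
move=> _; apply: cvgN; apply: cvgM; first exact: cvg_cst.
exact: (continuous_comp (@continuous_eucl R x) (@cM (eucl x))).
Qed.

Let cvg_sqr (x : R * R) : x <> 0 -> (fun y => (eucl y ^+ 2)^-1) @ x --> (eucl x ^+ 2)^-1.
Proof.
move=> /eucl_gt0 e0; apply: cvgV; first by rewrite gt_eqF// exprn_gt0.
by apply: cvgM; exact: continuous_eucl.
Qed.

Lemma continuous_radial_gradient1 (x : R * R) : x <> 0 -> {for x, continuous radial_gradient1}.
Proof.
move=> x0; apply: cvgM; first exact: cvg_coef.
by apply: cvgM; [exact: cvg_fst|exact: cvg_sqr].
Qed.

Lemma continuous_radial_gradient2 (x : R * R) : x <> 0 -> {for x, continuous radial_gradient2}.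
Proof.
move=> x0; apply: cvgM; first exact: cvg_coef.
by apply: cvgM; [exact: cvg_snd|exact: cvg_sqr].
Qed.

Lemma Ck1_radial_profile : Ck_on (~` [set 0]) 1 radial_profile.
Proof.
have pd1E x : x <> 0 -> derivable radial_profile x (1, 0) /\
    pd1 radial_profile x = radial_gradient1 x.
  by case: x => a b ab; apply: derivable_line1; exact: radial_line1.
have pd2E x : x <> 0 -> derivable radial_profile x (0, 1) /\
    pd2 radial_profile x = radial_gradient2 x.
  by case: x => a b ab; apply: derivable_line2; exact: radial_line2.
have near_neq0 (x : R * R) : x <> 0 -> \forall y \near x, y <> 0.
  move=> x0; have : open (~` [set (0 : R * R)]).
    by apply: closed_openC; apply: compact_closed; [exact: norm_hausdorff|exact: compact_set1].
  by move=> o0; apply: (open_nbhs_nbhs (conj o0 _)).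
have cont (f g : R * R -> R) x : x <> 0 -> (forall y, y <> 0 -> f y = g y) ->
    {for x, continuous g} -> {for x, continuous f}.
  move=> x0 fg cg; suff : f @ x --> f x by []; rewrite (fg _ x0).
  apply: cvg_trans cg; apply: near_eq_cvg.
  by apply: filterS (near_neq0 _ x0) => y y0; rewrite fg.
split; first by move=> x x0; exact: continuous_radial_profile.
split.
- by move=> x x0; split; [exact: (pd1E x x0).1|exact: (pd2E x x0).1].
- split => // x x0; apply: cont x0 _ (continuous_radial_gradient1 x0).
  by move=> y y0; rewrite (pd1E y y0).2.
- split => // x x0; apply: cont x0 _ (continuous_radial_gradient2 x0).
  by move=> y y0; rewrite (pd2E y y0).2.
Qed.

End radial_functions.

Section ae_lemmas.
Context d (X : measurableType d) (R : realType) (mu : {measure set X -> \bar R}).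

Lemma integrable_ae_eq (f g : X -> R) (N : set X) : measurable N -> mu N = 0%E ->
  measurable_fun setT g -> mu.-integrable setT (EFin \o f) ->
  (forall x, ~ N x -> f x = g x) ->
  mu.-integrable setT (EFin \o g) /\ \int[mu]_x f x = \int[mu]_x g x.
Proof.
move=> mN N0 mg fi fg; have mf := measurable_integrable fi.
split; last first.
  rewrite /Rintegral; congr fine; apply: ae_eq_integral => //; try exact/measurable_EFinP.
  exists N; split => // x /=; apply: contra_notP => Nx _.
  by rewrite /= fg.
apply/integrableP; split; first exact/measurable_EFinP.
have /integrableP[_] := fi.
rewrite (ge0_ae_eq_integral (f := fun x => `|(EFin \o f) x|%E)
  (g := fun x => `|(EFin \o g) x|%E))//.
- by apply: measurableT_comp => //; exact/measurable_EFinP.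
- by apply: measurableT_comp => //; exact/measurable_EFinP.
- exists N; split => // x /=; apply: contra_notP => Nx _.
  by rewrite /= fg.
Qed.

End ae_lemmas.

(** * The weight and the existence of a normalised profile *)

Section profile_exists.
Context {R : realType}.
Local Notation mu := (@lebesgue_measure R).
Variables (V : measurableTypeR R -> R) (N : set (measurableTypeR R)).
Variables (beta C R1 R2 C0 C1 C2 l0 l1 l2 : R).
Hypotheses (beta0 : 0 < beta) (C0_gt0 : 0 < C0) (C1_gt0 : 0 < C1) (C2_gt0 : 0 < C2).
Hypotheses (C_gt0 : 0 < C) (R1_gt0 : 0 < R1) (R12 : R1 < R2).
Hypotheses (mV : measurable_fun setT V) (mN : measurable N) (N0 : mu N = 0%E).
Hypothesis V_ge : forall r, ~ N r -> R1 < r -> r < R2 -> C <= V r.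
Hypothesis V_pos0 : forall r, ~ N r -> 0 < r -> r <= 1 -> V r <= C1 * expR (l1 * ln r).
Hypothesis V_pos1 : forall r, ~ N r -> 1 <= r -> V r <= C2 * expR (l2 * ln r).
Hypothesis V_neg1 : forall r, ~ N r -> 1 <= r -> - (C0 * expR (l0 * ln r)) <= V r.
Hypothesis V_loc : (\int[mu]_(r in `]0%R, 1%R]) (r * `|V r|)%:E < +oo)%E.
Hypotheses (hl0 : l0 < 2 * beta - 2) (hl1 : beta - 2 < l1) (hl2 : l2 < beta - 2).

(** Half of the smaller margin in the conditions on [l1] and [l2]: one half raises [beta] to [b'],
    the other half remains as decay that makes [w] integrable. *)
Let eps := Num.min (l1 + 2 - beta) (beta - 2 - l2) / 2.
Let b' := beta + eps.

Let eps_gt0 : 0 < eps.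
Proof. by rewrite /eps divr_gt0// lt_min; move: hl1 hl2; lra. Qed.

Let eps_l1 : b' + eps <= l1 + 2.
Proof.
have : Num.min (l1 + 2 - beta) (beta - 2 - l2) <= l1 + 2 - beta by rewrite ge_min lexx.
by rewrite /b' /eps; lra.
Qed.

Let eps_l2 : b' + eps <= 2 * beta - 2 - l2.
Proof.
have : Num.min (l1 + 2 - beta) (beta - 2 - l2) <= beta - 2 - l2 by rewrite ge_min lexx orbT.
by rewrite /b' /eps; lra.
Qed.

(* Setting [k] to [0] on the exceptional set makes its bounds hold everywhere, as the
   variational problem requires. *)
Let D : set (measurableTypeR R) := `]0, +oo[%classic `\` N.
Let k0 (r : measurableTypeR R) : R := 2 * pi * r * V r * expR (- (2 * beta * Num.max 0 (ln r))).
Let k := k0 \_ D.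
Let w (r : measurableTypeR R) : R := 2 * pi * (C1 + C2) * bump eps r.

Let mD : measurable D.
Proof. by apply: measurableD => //; exact: measurable_itv. Qed.

Let measurable_weight : measurable_fun setT
  (fun r : measurableTypeR R => expR (- (2 * beta * Num.max 0 (ln r)))).
Proof.
apply: measurableT_comp => //; apply: measurableT_comp => //; apply: measurable_funM => //.
by apply: measurable_maxr => //; exact: measurable_ln.
Qed.

Let mk0 : measurable_fun setT k0.
Proof.
apply: measurable_funM; last exact: measurable_weight.
by apply: measurable_funM => //; apply: measurable_funM.
Qed.

Let mk : measurable_fun setT k.
Proof. by apply: (proj1 (measurable_restrictT _ mD)); exact: measurable_funTS. Qed.

Let iw : mu.-integrable setT (EFin \o w).
Proof. exact: (integrableZl measurableT (2 * pi * (C1 + C2)) (integrable_bump eps_gt0)). Qed.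

Let c_ge0 : 0 <= 2 * pi * (C1 + C2).
Proof. by rewrite !mulr_ge0 ?pi_ge0// addr_ge0// ltW. Qed.

Let w0 r : 0 <= w r.
Proof. by rewrite mulr_ge0// bump_ge0. Qed.

Let weight r := expR (- (2 * beta * Num.max 0 (ln r))).

(** Stated for [r * r * a], so that the factor [r^-1] set aside in [k0E] turns [dr] into [d (ln r)]
    and all remaining powers become exponentials of [ln r]. *)
Let sqr_weight_le (c a l x r : R) : 0 < r -> 0 <= c -> a <= c * expR (l * ln r) ->
  2 * ln r + l * ln r - 2 * beta * Num.max 0 (ln r) <= x ->
  r * r * a * weight r <= c * expR x.
Proof.
move=> r0 c0 al lx.
apply: (@le_trans _ _ (r * r * (c * expR (l * ln r)) * weight r)).
  by rewrite ler_wpM2r ?expR_ge0// ler_wpM2l// mulr_ge0// ltW.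
have rE : r = expR (ln r) by rewrite lnK.
have -> : r * r * (c * expR (l * ln r)) * weight r =
    c * expR (2 * ln r + l * ln r - 2 * beta * Num.max 0 (ln r)).
  rewrite {1 2}rE /weight (_ : 2 * ln r + _ - _ = ln r + ln r + l * ln r +
    (- (2 * beta * Num.max 0 (ln r)))); last by ring.
  by rewrite !expRD; ring.
by rewrite ler_wpM2l// ler_expR.
Qed.

Let D_gt0 r : D r -> 0 < r.
Proof. by move=> []; rewrite /= in_itv /= andbT. Qed.

Let V_upper r : D r -> r * r * V r * weight r <= (C1 + C2) * expR (- ((b' + eps) * `|ln r|)).
Proof.
move=> Dr; have r0 := D_gt0 Dr; have [_ Nr] := Dr.
have [r1|r1] := leP r 1.
  have t0 : ln r <= 0 by rewrite ln_le0.
  have -> : - ((b' + eps) * `|ln r|) = (b' + eps) * ln r by rewrite ler0_norm//; ring.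
  apply: (@le_trans _ _ (C1 * expR ((b' + eps) * ln r))); last first.
    by rewrite ler_wpM2r ?expR_ge0// lerDl ltW.
  apply: sqr_weight_le (V_pos0 Nr r0 r1) _ => //; first exact: ltW.
  by rewrite max_l// mulr0 subr0 -mulrDl; move: eps_l1 t0; nra.
have t0 : 0 <= ln r by rewrite ln_ge0// ltW.
have -> : - ((b' + eps) * `|ln r|) = - ((b' + eps) * ln r) by rewrite ger0_norm.
apply: (@le_trans _ _ (C2 * expR (- ((b' + eps) * ln r)))); last first.
  by rewrite ler_wpM2r ?expR_ge0// lerDr ltW.
apply: sqr_weight_le (V_pos1 Nr (ltW r1)) _ => //; first exact: ltW.
by rewrite max_r//; move: eps_l2 t0; nra.
Qed.

Let k0E r : 0 < r -> k0 r = 2 * pi * (r^-1 * (r * r * V r * weight r)).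
Proof. by move=> r0; rewrite /k0 -/(weight r); field; rewrite gt_eqF. Qed.

Let kw r : k r <= w r * expR (- (b' * `|ln r|)).
Proof.
rewrite /k patchE; case: ifPn => [|_]; last by rewrite mulr_ge0 ?expR_ge0.
rewrite inE => Dr; have r0 := D_gt0 Dr.
rewrite k0E// /w.
apply: (@le_trans _ _ (2 * pi * (C1 + C2) * (r^-1 * expR (- (eps * `|ln r|))) *
    expR (- (b' * `|ln r|)))); last first.
  by rewrite ler_wpM2r ?expR_ge0// ler_wpM2l// bump_ge.
have -> : 2 * pi * (C1 + C2) * (r^-1 * expR (- (eps * `|ln r|))) * expR (- (b' * `|ln r|)) =
    2 * pi * (r^-1 * ((C1 + C2) * expR (- ((b' + eps) * `|ln r|)))).
  have -> : - ((b' + eps) * `|ln r|) = - (b' * `|ln r|) + - (eps * `|ln r|) by ring.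
  by rewrite expRD; ring.
by rewrite ler_wpM2l ?mulr_ge0 ?pi_ge0// ler_wpM2l ?invr_ge0 ?(ltW r0)// V_upper.
Qed.

Let k_le_w r : k r <= w r.
Proof.
apply: le_trans (kw r) _; rewrite -[leRHS]mulr1 ler_wpM2l// expR_le1 oppr_le0 mulr_ge0//.
by rewrite /b'; move: beta0 eps_gt0; lra.
Qed.

(** The decay exponent of [r^2 V^-(r)] times the weight at infinity. It is compared with [0] rather
    than [beta]: lower bounds on [V] serve the integrability of [k], not the a priori bound on the
    energy. *)
Let del := 2 * beta - 2 - l0.

Let del_gt0 : 0 < del. Proof. by rewrite /del; move: hl0; lra. Qed.

Let inner (r : measurableTypeR R) : R := 2 * pi * ((fun r => r * `|V r|) \_ `]0, 1]) r.

Let i_inner : mu.-integrable setT (EFin \o inner).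
Proof.
have m01 : @measurable _ (measurableTypeR R) `]0%R, 1%R]%classic by exact: measurable_itv.
have mrV : measurable_fun (`]0%R, 1%R]%classic : set (measurableTypeR R))
    (fun r : measurableTypeR R => r * `|V r|).
  apply: measurable_funM => //.
  by apply: measurableT_comp => //; exact: measurable_funTS.
have H : mu.-integrable setT (EFin \o ((fun r => r * `|V r|) \_ `]0, 1])).
  rewrite -restrict_EFin; apply: (integrable_mkcond _ m01).1.
  apply/integrableP; split; first exact/measurable_EFinP.
  apply: le_lt_trans V_loc; apply: ge0_le_integral => //.
  - by apply: measurableT_comp => //; exact/measurable_EFinP.
  - exact/measurable_EFinP.
  - move=> r; rewrite /= in_itv /= => /andP[r0 _].
    by rewrite lee_fin ger0_norm// mulr_ge0// ltW.
exact: (integrableZl measurableT (2 * pi) H).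
Qed.

(** From below, local integrability of [V] handles [r <= 1] and the bound with exponent [l0] handles
    [r > 1]; from above, [w] suffices. *)
Let k_bound r : `|k r| <= inner r + w r + 2 * pi * C0 * bump del r.
Proof.
have inner0 : 0 <= inner r.
  rewrite /inner mulr_ge0 ?mulr_ge0 ?pi_ge0// patchE; case: ifPn => //.
  by rewrite inE /= in_itv /= => /andP[r0 _]; rewrite mulr_ge0// ltW.
have b0 : 0 <= 2 * pi * C0 * bump del r by rewrite !mulr_ge0 ?pi_ge0 ?bump_ge0// ltW.
rewrite ler_norml; apply/andP; split; last by have := k_le_w r; have := w0 r; lra.
rewrite lerNl /k patchE; case: ifPn => [|_]; last first.
  by rewrite -[point]/(0 : R) oppr0; have := w0 r; lra.
rewrite inE => Dr; have r0 := D_gt0 Dr; have [_ Nr] := Dr.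
have [r1|r1] := leP r 1.
  suff : - k0 r <= inner r by have := w0 r; lra.
  have t0 : ln r <= 0 by rewrite ln_le0.
  rewrite /inner patchE mem_setE in_itv /= r0 r1 /k0 max_l// mulr0 oppr0 expR0 mulr1.
  have -> : - (2 * pi * r * V r) = 2 * pi * (r * - V r) by ring.
  rewrite ler_wpM2l ?mulr_ge0 ?pi_ge0//. by rewrite ler_wpM2l ?(ltW r0)// -normrN ler_norm.
suff : - k0 r <= 2 * pi * C0 * bump del r by have := w0 r; lra.
have t0 : 0 <= ln r by rewrite ln_ge0// ltW.
have := bump_ge del_gt0 r0; rewrite (ger0_norm t0) => hb.
apply: (@le_trans _ _ (2 * pi * C0 * (r^-1 * expR (- (del * ln r))))); last first.
  by rewrite ler_wpM2l// !mulr_ge0 ?pi_ge0// ltW.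
rewrite k0E// -mulrN -mulrN -mulNr -mulrN.
have -> : 2 * pi * C0 * (r^-1 * expR (- (del * ln r))) =
  2 * pi * (r^-1 * (C0 * expR (- (del * ln r)))) by ring.
rewrite ler_wpM2l ?mulr_ge0 ?pi_ge0// ler_wpM2l ?invr_ge0 ?(ltW r0)//.
apply: (@sqr_weight_le C0 (- V r) l0) => //; first exact: ltW.
  by have := V_neg1 Nr (ltW r1); rewrite lerNl.
by rewrite max_r// /del; lra.
Qed.

Let ik : mu.-integrable setT (EFin \o k).
Proof.
have i3 := integrableZl measurableT (2 * pi * C0) (integrable_bump del_gt0).
have i2 := integrableD measurableT (integrableD measurableT i_inner iw) i3.
by apply: (integrable_le_norm measurableT mk i2) => r _; exact: k_bound.
Qed.

Let lnR12 : ln R1 < ln R2.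
Proof. by rewrite ltr_ln ?posrE//; exact: lt_trans R12. Qed.

Let k_pos r : D r -> ln R1 < ln r -> ln r < ln R2 -> 0 < k r.
Proof.
move=> Dr; have r0 := D_gt0 Dr; have [_ Nr] := Dr.
have R20 := lt_trans R1_gt0 R12; rewrite !ltr_ln ?posrE// => r1 r2.
rewrite /k patchE mem_set// /k0 mulr_gt0 ?expR_gt0// mulr_gt0//.
  by rewrite !mulr_gt0 ?pi_gt0.
exact: lt_le_trans (V_ge Nr r1 r2).
Qed.

(** [k] may have negative integral. A large multiple of a tent over the annulus, where [k > 0]
    almost everywhere, outweighs the rest, because the exponential grows at least linearly. *)
Lemma candidate_exists : exists u rho e, [/\ energy_le u rho e, u 0 = 0,
  mu.-integrable setT (EFin \o (fun r => k r * expR (u (ln r)))) &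
  0 < \int[mu]_r (k r * expR (u (ln r)))].
Proof.
have [h [rho [e [Eh ch h01 hpos]]]] := energy_le_hat lnR12.
have mh : measurable_fun setT (fun r : measurableTypeR R => h (ln r)).
  apply: (measurableT_comp (f := h)); last exact: measurable_ln.
  exact: continuous_measurable_fun.
have kh0 r : 0 <= k r * h (ln r).
  have [hp|hn] := ltP 0 (h (ln r)); last first.
    have -> : h (ln r) = 0 by apply/eqP; rewrite eq_le hn; have /andP[] := h01 (ln r).
    by rewrite mulr0.
  have := hp; rewrite hpos => /andP[r1 r2].
  have [Dr|nD] := pselect (D r); first by rewrite mulr_ge0 ?ltW// k_pos.
  by rewrite /k patchE memNset// -[point]/(0 : R) mul0r.
have ikh : mu.-integrable setT (EFin \o (fun r => k r * h (ln r))).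
  apply: (integrable_le_norm measurableT _
    (integrableZl measurableT (ln R2 - ln R1) (integrable_norm ik))).
    exact: measurable_funM.
  move=> r _; have /andP[h0 hb] := h01 (ln r).
  by rewrite /= normrM mulrC ler_wpM2r// ger0_norm.
have I_gt0 : 0 < \int[mu]_r (k r * h (ln r)).
  rewrite lt_neqAle Rintegral_ge0 ?andbT//; apply/eqP => I0.
  have iz : (\int[mu]_r `|(k r * h (ln r))%:E| = 0)%E.
    rewrite (eq_integral (fun r => (k r * h (ln r))%:E)); last first.
      by move=> r _; rewrite gee0_abs// lee_fin.
    by rewrite -EFin_Rintegral// -I0.
  have mkh : measurable_fun setT (fun r : measurableTypeR R => (k r * h (ln r))%:E).
    by apply/measurable_EFinP; exact: measurable_integrable ikh.
  have [Z [mZ Z0 HZ]] := (ae_eq_integral_abs mu measurableT mkh).1 iz.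
  have sub : `]R1, R2[%classic `<=` Z `|` N.
    move=> r; rewrite /= in_itv /= => /andP[r1 r2].
    have [Nr|Nr] := pselect (N r); [by right|left; apply: HZ => /= /(_ I)].
    have r0 := lt_trans R1_gt0 r1.
    have Dr : D r by split => //; rewrite /= in_itv /= r0.
    have lr : ln R1 < ln r < ln R2 by rewrite !ltr_ln ?posrE ?r1 ?r2// (lt_trans r0).
    have /andP[l1r l2r] := lr.
    by move=> [] /eqP; rewrite mulf_eq0 gt_eqF ?k_pos//= gt_eqF// hpos.
  have : (mu `]R1, R2[ <= 0)%E.
    rewrite -(_ : mu (Z `|` N) = 0%E).
      by apply: le_measure; rewrite ?inE//; exact: measurableU.
    by rewrite null_set_setU.
  rewrite lebesgue_measure_itv /= lte_fin R12 -EFinB lee_fin subr_le0 leNgt.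
  by rewrite R12.
set I := \int[mu]_r _ in I_gt0; pose J := \int[mu]_r k r.
(* Chosen so that [J + n * I = J + |J| + 1], which is at least [1]. *)
pose n := (`|J| + 1) / I.
have n0 : 0 <= n by rewrite divr_ge0 ?addr_ge0// ltW.
(* The annulus may contain the unit circle, so the value of the tent at [0] is subtracted to meet
   [u 0 = 0]. *)
exists (fun t => n * h t - n * h 0), (fun t => n ^+ 2 * rho t), (n ^+ 2 * e).
have E1 := energy_le_shift (- (n * h 0)) (energy_le_scale n Eh).
pose G r := k r * expR (n * h (ln r) - n * h 0).
have iG : mu.-integrable setT (EFin \o G).
  apply: (integrable_le_norm measurableT _
    (integrableZl measurableT (expR (n * (ln R2 - ln R1))) (integrable_norm ik))).
    apply: measurable_funM => //; apply: measurableT_comp => //.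
    by apply: measurable_funB => //; exact: measurable_funM.
  move=> r _; rewrite /= normrM mulrC ler_wpM2r// ger0_norm ?expR_ge0// ler_expR.
  have /andP[_ hb] := h01 (ln r); have /andP[h0 _] := h01 0.
  rewrite -mulrBr ler_wpM2l//; lra.
split => //; first by rewrite subrr.
have ikL : mu.-integrable setT (EFin \o (fun r => k r + n * (k r * h (ln r)))).
  exact: (integrableD measurableT ik (integrableZl measurableT n ikh)).
pose L r := expR (- (n * h 0)) * (k r + n * (k r * h (ln r))).
have iL : mu.-integrable setT (EFin \o L).
  exact: (integrableZl measurableT (expR (- (n * h 0))) ikL).
(* [1 + x <= expR x] may be multiplied by [k r] where [k r >= 0]; where [k r < 0] the tent vanishes
   and equality holds. *)
have LG : \int[mu]_r L r <= \int[mu]_r G r.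
  apply: le_Rintegral => // r _; rewrite /L /G expRD mulrA mulrC ler_wpM2r ?expR_ge0//.
  have [k00|kn] := leP 0 (k r).
    by have := ler_wpM2l k00 (expR_ge1Dx (n * h (ln r))); lra.
  have -> : h (ln r) = 0.
    have /andP[h0 _] := h01 (ln r); apply/eqP; rewrite eq_le h0 andbT.
    by have := kh0 r; rewrite nmulr_rge0.
  by rewrite !mulr0 addr0 expR0 mulr1.
apply: lt_le_trans LG.
rewrite RintegralZl//.
rewrite RintegralD//; last exact: (integrableZl measurableT n ikh).
rewrite RintegralZl// -/I -/J mulr_gt0 ?expR_gt0// /n divfK ?gt_eqF//.
by have := ler_norm (- J); rewrite normrN; lra.
Qed.

Lemma profile_exists : exists v rho e s,
  let g (r : measurableTypeR R) := if 0 < r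
    then 2 * pi * r * (V r * expR (v (ln r) - 2 * beta * Num.max 0 (ln r) - s)) else 0 in
  [/\ energy_le v rho e, v 0 = 0, mu.-integrable setT (EFin \o g), \int[mu]_r g r = 1 &
    forall a b, a < b -> \int[mu]_r (g r * ramp a b (ln r)) =
      ramp a b 0 - (v b - v a) / (2 * beta * (b - a))].
Proof.
have mln : measurable_fun setT (@ln R : measurableTypeR R -> R) by exact: measurable_ln.
have bb' : beta < b' by rewrite /b' ltrDl.
have [v [rho [e [Ev v0 av F0 maxv]]]] :=
  maximizer_exists mk mln beta0 bb' iw w0 kw candidate_exists.
have EL := euler_lagrange mk mln beta0 Ev v0 av F0 maxv.
set F := Rintegral _ _ _ in F0.
(* Subtracting [ln F] divides the density by [F], so its mass becomes one. [f] is this density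
   written with [k] and [g] with [V]; they agree off the null set [N]. *)
exists v, rho, e, (ln F) => g; pose f r := F^-1 * (k r * expR (v (ln r))).
have if_ : mu.-integrable setT (EFin \o f) by exact: (integrableZl measurableT F^-1 av).
have fg r : ~ N r -> f r = g r.
  move=> Nr; rewrite /f /g /k patchE; case: ltP => r0; last first.
    rewrite memNset -?[point]/(0 : R) ?mul0r ?mulr0// => -[].
    by rewrite /= in_itv /= andbT ltNge r0.
  rewrite mem_set; last by split => //; rewrite /= in_itv /= r0.
  rewrite /k0.
  have -> : v (ln r) - 2 * beta * Num.max 0 (ln r) - ln F =
    v (ln r) + - (2 * beta * Num.max 0 (ln r)) + - ln F by [].
  by rewrite !expRD (expRN (ln F)) lnK ?posrE//; ring.
have mv : measurable_fun setT (fun r : measurableTypeR R => v (ln r)).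
  apply: (measurableT_comp (f := v)); last exact: mln.
  by apply: continuous_measurable_fun; exact: energy_le_continuous Ev.
have mg : measurable_fun setT g.
  apply: measurable_fun_ifT => //.
    exact: measurable_fun_ltr.
  apply: measurable_funM; first exact: measurable_funM.
  apply: measurable_funM => //; apply: measurableT_comp => //.
  apply: measurable_funB => //; apply: measurable_funB => //.
  apply: measurable_funM => //.
  by apply: measurable_maxr.
have [ig Ig] := integrable_ae_eq mN N0 mg if_ fg.
split=> //; first by rewrite -Ig RintegralZl// mulVf// gt_eqF.
move=> a b ab; have mr : measurable_fun setT (fun r : measurableTypeR R => ramp a b (ln r)).
  apply: (measurableT_comp (f := ramp a b)); last exact: mln.
  by apply: continuous_measurable_fun; exact: continuous_ramp.
have ir : mu.-integrable setT (EFin \o (fun r => f r * ramp a b (ln r))).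
  apply: (integrable_le_norm measurableT _ (integrable_norm if_)).
    by apply: measurable_funM => //; exact: measurable_integrable if_.
  move=> r _; have /andP[h0 h1] := ramp_itv (ln r) ab.
  by rewrite /= normrM (ger0_norm h0) ler_piMr.
have [_ <-] := integrable_ae_eq mN N0 (measurable_funM mg mr) ir
  (fun r Nr => congr1 (fun z => z * ramp a b (ln r)) (fg r Nr)).
have ik' : mu.-integrable setT (EFin \o (fun r => k r * expR (v (ln r)) * ramp a b (ln r))).
  apply: (integrable_le_norm measurableT _ (integrable_norm av)).
    by apply: measurable_funM => //; exact: measurable_integrable av.
  move=> r _; have /andP[h0 h1] := ramp_itv (ln r) ab.
  by rewrite /= normrM (ger0_norm h0) ler_piMr.
rewrite (eq_Rintegral _ (g := fun r => F^-1 * (k r * expR (v (ln r)) * ramp a b (ln r))));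
  last first.
  by move=> r _; rewrite /f !mulrA.
by rewrite RintegralZl// EL// mulKf// gt_eqF.
Qed.

End profile_exists.

(** * Regularity of the solution *)

Section radial_regularity.
Context {R : realType}.
Local Notation mu := (@lebesgue_measure R).

Lemma integral_itv_bounded (f : measurableTypeR R -> R) (A B : R) :
  measurable_fun setT f -> (forall r, 0 < r -> r <= A -> 0 <= f r <= B) ->
  (\int[mu]_(r in `]0%R, A]) (f r)%:E < +oo)%E.
Proof.
move=> mf fB.
have mA : @measurable _ (measurableTypeR R) `]0%R, A]%classic by exact: measurable_itv.
apply: (@le_lt_trans _ _ (\int[mu]_(r in `]0%R, A]) (cst B%:E) r)%E).
  apply: ge0_le_integral => //.
  - by move=> r; rewrite /= in_itv /= => /andP[r0 rA]; have /andP[] := fB r r0 rA.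
  - by apply/measurable_EFinP; exact: measurable_funTS.
  - by move=> r; rewrite /= in_itv /= => /andP[r0 rA]; have /andP[] := fB r r0 rA.
rewrite integral_cst//; suff : (B%:E * mu `]0%R, A] < +oo)%E by [].
rewrite lebesgue_measure_itv /= lte_fin.
by case: ifP => _; rewrite ?mule0 ?ltry// -EFinB -EFinM ltry.
Qed.

(** For [r <= 1], squaring [x <= expR x] at [x = - ln r / 2] gives [(ln r)^2 / 4 <= 1 / r]; for
    [r > 1], [ln r <= r]. *)
Lemma ln_sqr_bound (A r : R) : 0 < r -> r <= A -> r * (1 + ln r ^+ 2) <= 4 + A + A ^+ 3.
Proof.
move=> r0 rA; have A0 : 0 < A := lt_le_trans r0 rA.
have A3 : 0 <= A ^+ 3 by rewrite exprn_ge0// ltW.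
suff : r * ln r ^+ 2 <= 4 + A ^+ 3 by lra.
have [r1|r1] := leP r 1.
  have t0 : ln r <= 0 by rewrite ln_le0.
  have h : - (ln r / 2) <= expR (- (ln r / 2)) by have := expR_ge1Dx (- (ln r / 2)); lra.
  have s : (ln r / 2) ^+ 2 <= r^-1.
    rewrite -{2}[r]lnK ?posrE// -expRN (_ : - ln r = - (ln r / 2) + - (ln r / 2)); last by field.
    by rewrite expRD -sqrrN expr2 ler_pM//; lra.
  have := ler_wpM2l (ltW r0) s; rewrite mulfV ?gt_eqF// => hs.
  have -> : r * ln r ^+ 2 = 4 * (r * (ln r / 2) ^+ 2) by field.
  lra.
have t0 : 0 <= ln r by rewrite ln_ge0// ltW.
have tr : ln r <= r by have := expR_ge1Dx (ln r); rewrite lnK ?posrE//; lra.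
have : r * ln r ^+ 2 <= A ^+ 3.
  rewrite (exprS A) ler_pM ?sqr_ge0 ?(ltW r0)// ler_pXn2r ?nnegrE ?(ltW A0)//.
  exact: le_trans tr rA.
lra.
Qed.

Variables (g v rho : R -> R) (beta e s : R).
Hypothesis ig : mu.-integrable setT (EFin \o g).
Hypothesis g0 : forall r, r <= 0 -> g r = 0.
Hypotheses (beta0 : 0 < beta) (Ev : energy_le v rho e).
Hypothesis EL : forall a b : R, a < b -> \int[mu]_r (g r * ramp a b (ln r)) =
  ramp a b 0 - (v b - v a) / (2 * beta * (b - a)).

Let M := cumulative g.
Let cM : continuous M. Proof. exact: continuous_cumulative. Qed.
Let Psi t := v t - 2 * beta * Num.max 0 t - s.

Let DPsi (t : R) : is_derive t (1 : R) Psi (- (2 * beta * M (expR t))).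
Proof.
have := is_deriveB (profile_is_derive ig g0 beta0 EL t) (is_derive_cst s t 1).
by rewrite subr0; exact.
Qed.

Let psi := radial_profile Psi : plane R -> R.
Let g1 := radial_gradient1 M (2 * beta) : plane R -> R.
Let g2 := radial_gradient2 M (2 * beta) : plane R -> R.

Let mPsi : measurable_fun setT (fun r : measurableTypeR R => Psi (ln r)).
Proof.
apply: (measurableT_comp (f := Psi)); last exact: measurable_ln.
by apply: continuous_measurable_fun => t; exact: is_derive_continuous (DPsi t).
Qed.

Lemma Lp_loc2_radial_profile : v 0 = 0 -> Lp_loc 2 psi.
Proof.
move=> v0; have e0 := energy_le_ge0 Ev.
(* From [(a - b - c)^2 <= 3 (a^2 + b^2 + c^2)], using [v t ^+ 2 <= e * |t|] and [|t| <= 1 + t^2]. *)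
pose K := 3 * (e + (2 * beta) ^+ 2 + s ^+ 2).
have K0 : 0 <= K by rewrite mulr_ge0// !addr_ge0 ?sqr_ge0.
have sq1 (t : R) : 0 <= 1 + t ^+ 2 by rewrite addr_ge0 ?sqr_ge0.
have mh : measurable_fun setT (fun r : measurableTypeR R => K * (1 + ln r ^+ 2)).
  apply: measurable_funM => //; apply: measurable_funD => //.
  by apply: measurable_funX; exact: measurable_ln.
apply: (Lp_loc2_radial (h := fun r => K * (1 + ln r ^+ 2))) => //.
- exact: (measurableT_comp mPsi measurable_eucl).
- move=> x; rewrite /psi /radial_profile; set t := ln _.
  have := energy_le_holder 0 t Ev; rewrite v0 !subr0 => hv.
  have tn : `|t| <= 1 + t ^+ 2 by rewrite -(real_normK (num_real t)); nra.
  have m2 : (2 * beta * Num.max 0 t) ^+ 2 <= (2 * beta) ^+ 2 * (1 + t ^+ 2).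
    rewrite exprMn ler_wpM2l ?sqr_ge0//.
    by case: (leP 0 t) => _; rewrite ?expr0n /= ?lerDr.
  have ev : e * `|t| <= e * (1 + t ^+ 2) by rewrite ler_wpM2l.
  have s2 : s ^+ 2 <= s ^+ 2 * (1 + t ^+ 2) by rewrite ler_peMr ?sqr_ge0// lerDl sqr_ge0.
  have three (a b c : R) : (a - b - c) ^+ 2 <= 3 * (a ^+ 2 + b ^+ 2 + c ^+ 2).
    have := sqr_ge0 (a + b); have := sqr_ge0 (a + c); have := sqr_ge0 (b - c).
    rewrite !expr2; lra.
  apply: le_trans (three _ _ _) _.
  have -> : K * (1 + t ^+ 2) =
    3 * (e * (1 + t ^+ 2) + (2 * beta) ^+ 2 * (1 + t ^+ 2) + s ^+ 2 * (1 + t ^+ 2)).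
    by rewrite /K; ring.
  rewrite ler_wpM2l//; apply: lerD => //; apply: lerD => //.
  exact: le_trans hv ev.
- by move=> r; rewrite mulr_ge0.
- move=> A A0; apply: (@integral_itv_bounded _ _ (K * (4 + A + A ^+ 3))).
    exact: measurable_funM.
  move=> r r0 rA; apply/andP; split; first by rewrite mulr_ge0 ?(ltW r0)// mulr_ge0.
  by rewrite mulrCA ler_wpM2l// ln_sqr_bound.
Qed.

(** Near [0] the mass [M] comes with no rate of decay, [V^-] being only integrable there, so
    finiteness below [expR (- 1)] rests on the energy of [v]. Above it, continuity on a compact
    interval is enough; [B] enlarges [A] so that the split always makes sense. *)
Let gradient_integral (A : R) : 0 < A ->
  (\int[mu]_(r in `]0%R, A]) (r * ((2 * beta * M r) ^+ 2 / r ^+ 2))%:E < +oo)%E.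
Proof.
move=> A0; pose f (r : measurableTypeR R) := (2 * beta * M r) ^+ 2 / r.
have fE r : r * ((2 * beta * M r) ^+ 2 / r ^+ 2) = f r.
  rewrite /f; have [->|r0] := eqVneq r 0; first by rewrite invr0 mul0r mulr0.
  by field.
rewrite (eq_integral (EFin \o f)); last by move=> r _; rewrite /= fE.
pose B := Num.max A (expR (- 1)); have q0 : 0 < expR (- 1 : R) := expR_gt0 _.
have qB : expR (- 1) <= B by rewrite le_max lexx orbT.
have f0 r : 0 < r -> 0 <= f r by move=> r0; rewrite divr_ge0 ?sqr_ge0// ltW.
have mf : measurable_fun setT f.
  apply: measurable_funM; last exact: (measurable_inv_comp (@measurable_id _ _ setT)).
  apply: measurable_funX; apply: measurable_funM => //.
  exact: continuous_measurable_fun.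
have mi a b : @measurable _ (measurableTypeR R) `]a, b]%classic by exact: measurable_itv.
apply: (@le_lt_trans _ _ (\int[mu]_(r in `]0%R, B]) (f r)%:E)%E).
  apply: ge0_subset_integral => //.
  - by apply/measurable_EFinP; exact: measurable_funTS.
  - by move=> r; rewrite /= in_itv /= => /andP[r0 _]; rewrite lee_fin f0.
  - move=> r; rewrite /= !in_itv /= => /andP[-> rA] /=.
    by rewrite (le_trans rA)// le_max lexx.
have -> : `]0%R, B]%classic =
    `]0%R, expR (- 1)]%classic `|` `]expR (- 1)%R, B]%classic :> set (measurableTypeR R).
  by apply: itv_bndbnd_setU; rewrite bnd_simp// ltW.
rewrite ge0_integral_setU//; last 3 first.
- by apply/measurable_EFinP; exact: measurable_funTS.
- move=> r [] /=; rewrite in_itv /= => /andP[r0 _]; rewrite lee_fin f0//.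
  exact: lt_trans q0 r0.
- apply/disj_set2P/seteqP; split => // r /= [].
  by rewrite !in_itv /= => /andP[_ /le_lt_trans h] /andP[/h]; rewrite ltxx.
apply: lte_add_pinfty; first exact: (cumulative_sqr_integrable ig g0 beta0 Ev EL).
have iB : mu.-integrable `[expR (- 1), B]%classic (EFin \o f).
  apply: continuous_compact_integrable; first exact: segment_compact.
  apply: continuous_in_subspaceT => r; rewrite inE /= in_itv /= => /andP[qr _].
  have r0 : r != 0 by rewrite gt_eqF// (lt_le_trans q0).
  apply: cvgM; last by apply: cvgV.
  apply: (@cvgM _ _ _ _ (fun r => 2 * beta * M r) (fun r => 2 * beta * M r));
    by apply: cvgM; [exact: cvg_cst|exact: cM].
have iBo : mu.-integrable `]expR (- 1), B]%classic (EFin \o f).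
  apply: integrableS iB => //.
  by move=> r; rewrite /= !in_itv /= => /andP[/ltW -> ->].
have /integrableP[_] := iBo.
apply: le_lt_trans; apply: ge0_le_integral => //.
- move=> r; rewrite /= in_itv /= => /andP[r0 _]; rewrite lee_fin f0//.
  exact: lt_trans q0 r0.
- by apply/measurable_EFinP; exact: measurable_funTS.
- by apply: measurableT_comp => //; apply/measurable_EFinP; exact: measurable_funTS.
- by move=> r _; exact: lee_abs.
Qed.

Let mh : measurable_fun setT (fun r : measurableTypeR R => (2 * beta * M r) ^+ 2 / r ^+ 2).
Proof.
apply: measurable_funM; last by apply: measurable_inv_comp; exact: measurable_funX.
apply: measurable_funX; apply: measurable_funM => //.
exact: continuous_measurable_fun.
Qed.

Let mcoef : measurable_fun setT (fun x : plane R => - (2 * beta * M (eucl x))).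
Proof.
apply: (measurableT_comp (f := fun r : measurableTypeR R => - (2 * beta * M r)));
  last exact: measurable_eucl.
apply: measurableT_comp => //; apply: measurable_funM => //.
exact: continuous_measurable_fun.
Qed.

Let coef_le (x : R * R) (y : R) : `|y| <= eucl x ->
  (- (2 * beta * M (eucl x)) * (y / eucl x ^+ 2)) ^+ 2 <=
  (2 * beta * M (eucl x)) ^+ 2 / eucl x ^+ 2.
Proof.
move=> yx; rewrite exprMn sqrrN ler_wpM2l ?sqr_ge0//.
have [e0|e0] := eqVneq (eucl x) 0.
  by rewrite e0 expr0n /= invr0 mulr0 expr0n.
have q0 : 0 < eucl x ^+ 2 by rewrite exprn_even_gt0.
rewrite -[leRHS]mul1r ler_pdivlMr//.
have -> : (y / eucl x ^+ 2) ^+ 2 * eucl x ^+ 2 = y ^+ 2 / eucl x ^+ 2 by field.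
rewrite ler_pdivrMr// mul1r -(real_normK (num_real y)).
by rewrite ler_pXn2r// nnegrE// eucl_ge0.
Qed.

Lemma Lp_loc2_radial_gradient1 : Lp_loc 2 g1.
Proof.
apply: (Lp_loc2_radial _ mh) gradient_integral.
- apply: measurable_funM; first exact: mcoef.
  apply: measurable_funM; first exact: measurable_fst.
  by apply: measurable_inv_comp; apply: measurable_funX; exact: measurable_eucl.
- by move=> x; apply: coef_le; exact: ler_norm1_eucl.
- by move=> r; rewrite divr_ge0 ?sqr_ge0.
Qed.

Lemma Lp_loc2_radial_gradient2 : Lp_loc 2 g2.
Proof.
apply: (Lp_loc2_radial _ mh) gradient_integral.
- apply: measurable_funM; first exact: mcoef.
  apply: measurable_funM; first exact: measurable_snd.
  by apply: measurable_inv_comp; apply: measurable_funX; exact: measurable_eucl.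
- by move=> x; apply: coef_le; exact: ler_norm2_eucl.
- by move=> r; rewrite divr_ge0 ?sqr_ge0.
Qed.

Lemma weak_gradient_radial_profile : v 0 = 0 -> weak_gradient psi g1 g2.
Proof.
move=> v0; apply: weak_gradient_punctured.
- exact: Lp_loc2_radial_profile.
- exact: Lp_loc2_radial_gradient1.
- exact: Lp_loc2_radial_gradient2.
- by move=> a b /eqP b0; apply: (radial_line1 DPsi) => -[].
- by move=> a b /eqP a0; apply: (radial_line2 DPsi) => -[].
- move=> b /eqP b0 a; have ab : (a, b) <> 0 by move=> [].
  have cp : {for a, continuous (fun t : R => (t, b))}.
    by apply: (@cvg_pair _ _ _ _ (nbhs a) (nbhs b)); [exact: cvg_id|exact: cvg_cst].
  exact: (continuous_comp cp (continuous_radial_gradient1 (c := 2 * beta) cM ab)).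
- move=> a /eqP a0 b; have ab : (a, b) <> 0 by move=> [].
  have cp : {for b, continuous (fun t : R => (a, t))}.
    by apply: (@cvg_pair _ _ _ _ (nbhs a) (nbhs b)); [exact: cvg_cst|exact: cvg_id].
  exact: (continuous_comp cp (continuous_radial_gradient2 (c := 2 * beta) cM ab)).
Qed.

Lemma H1_loc_radial_profile : v 0 = 0 -> H1_loc psi.
Proof.
move=> v0; split; first exact: Lp_loc2_radial_profile.
exists g1, g2; split; [exact: Lp_loc2_radial_gradient1|exact: Lp_loc2_radial_gradient2|].
exact: weak_gradient_radial_profile.
Qed.

Lemma C1_radial_profile : Ck_on (~` [set 0]) 1 psi.
Proof. exact: (Ck1_radial_profile DPsi cM). Qed.

End radial_regularity.

(** * From almost every point of the plane to almost every radius *)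

Section radial_traces.
Context {R : realType}.
Local Notation mu := (@lebesgue_measure R).

(** In polar coordinates the planar measure has density [2 pi r], positive on the open half-line, so
    it vanishes only on null sets of radii. *)
Lemma null_radial (B : set (measurableTypeR R)) : measurable B ->
  leb2 R (eucl @^-1` B) = 0%E -> mu (B `&` `]0%R, +oo[) = 0%E.
Proof.
move=> mB B0.
have mp : @measurable _ (measurableTypeR R) `]0%R, +oo[%classic by exact: measurable_itv.
have h0 r : (0 <= (\1_B r)%:E :> \bar R)%E by rewrite lee_fin.
have mh : measurable_fun setT (fun r : measurableTypeR R => (\1_B r)%:E : \bar R).
  by apply/measurable_EFinP; exact: measurable_indic.
have := ge0_integral_radial mh h0.
have -> : (\int[leb2 R]_x (\1_B (eucl x))%:E = 0)%E.
  have mB' : measurable (eucl @^-1` B : set (plane R)).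
    by rewrite -[X in measurable X]setTI; exact: measurable_eucl.
  rewrite -B0 -[RHS](congr1 (leb2 R) (setIT _)).
  exact: (integral_indic (leb2 R) measurableT mB').
move=> /esym/eqP; rewrite mule_eq0 eqe mulf_eq0 pnatr_eq0/= gt_eqF ?pi_gt0//= => /eqP I0.
have mr : measurable_fun (`]0%R, +oo[%classic : set (measurableTypeR R))
    (fun r : measurableTypeR R => (r%:E * (\1_B r)%:E)%E).
  apply: emeasurable_funM; last exact: measurable_funTS.
  by apply/measurable_EFinP; exact: measurable_funTS.
have Ia : (\int[mu]_(r in `]0%R, +oo[) `|r%:E * (\1_B r)%:E| = 0)%E.
  rewrite -I0; apply: eq_integral => r rp.
  have r0 : 0 < r by move: rp; rewrite inE /= in_itv /= andbT.
  by rewrite gee0_abs// mule_ge0// lee_fin ltW.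
have [Z [mZ Z0 HZ]] := (ae_eq_integral_abs mu mp mr).1 Ia.
apply/eqP; rewrite eq_le measure_ge0 andbT -Z0.
apply: le_measure; rewrite ?inE//; first exact: measurableI.
move=> r [Br r0]; apply: HZ => /= /(_ r0).
move: r0; rewrite /= in_itv /= andbT => r0.
rewrite indicE mem_set// mule1 => -[] /eqP; by rewrite gt_eqF.
Qed.

Lemma eucl_axis (r : R) : 0 <= r -> eucl (r, 0) = r.
Proof. by move=> r0; rewrite /eucl /= expr0n addr0 sqrtr_sqr ger0_norm. Qed.

Lemma radial_valueE (V : R * R -> R) x : radially_symmetric V ->
  V x = radial_value V (eucl x).
Proof. by move=> rV; apply: rV; rewrite eucl_axis// eucl_ge0. Qed.

Lemma measurable_radial_value (V : plane R -> R) : measurable_fun setT V ->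
  measurable_fun setT (radial_value V : measurableTypeR R -> R).
Proof. by move=> mV; exact: (measurableT_comp mV (pair2_measurable (0 : measurableTypeR R))). Qed.

Lemma radial_value_loc (V : plane R -> R) : radially_symmetric V -> Lp_loc 1 V ->
  (\int[mu]_(r in `]0%R, 1%R]) (r * `|radial_value V r|)%:E < +oo)%E.
Proof.
move=> rV [mV locV]; have mVr := measurable_radial_value mV.
pose I1 : set (measurableTypeR R) := `]-oo, 1%R]%classic.
have mI1 : measurable I1 by exact: measurable_itv.
pose h (r : measurableTypeR R) : \bar R := (`|radial_value V r| * \1_I1 r)%:E.
have h0 r : (0 <= h r)%E by rewrite lee_fin mulr_ge0.
have mh : measurable_fun setT h.
  by apply/measurable_EFinP; apply: measurable_funM => //; exact: measurableT_comp.
pose K : set (R * R) := `[(-1)%R, 1%R]%classic `*` `[(-1)%R, 1%R]%classic.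
have cK : compact K by apply: compact_setX; exact: segment_compact.
have mK := compact_measurable_plane cK.
have hK : (\int[leb2 R]_x h (eucl x) < +oo)%E.
  apply: le_lt_trans (locV K cK); rewrite [leRHS]integral_mkcond.
  apply: ge0_le_integral => //.
  - exact: (measurableT_comp mh measurable_eucl).
  - apply: (proj1 (measurable_restrictT _ mK)); apply/measurable_EFinP.
    by apply: measurable_funX; apply: measurableT_comp => //; exact: measurable_funTS.
  - move=> x _; rewrite /h -radial_valueE// indicE /I1 mem_setE in_itv /= patchE.
    case: (leP (eucl x) 1) => x1; last first.
      by rewrite mulr0; case: ifP => // _; rewrite lee_fin exprn_ge0.
    rewrite mem_set ?mulr1 ?expr1// /K; split; rewrite /= in_itv /= -ler_norml.
      exact: le_trans (ler_norm1_eucl x) x1.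
    exact: le_trans (ler_norm2_eucl x) x1.
move: hK; rewrite (ge0_integral_radial mh h0).
have -> : (\int[mu]_(r in `]0%R, +oo[) (r%:E * h r) =
    \int[mu]_(r in `]0%R, 1%R]) (r * `|radial_value V r|)%:E)%E.
  rewrite integral_mkcond [RHS]integral_mkcond; apply: eq_integral => r _.
  rewrite !patchE !mem_setE !in_itv /= andbT; case: ltP => //= r0.
  rewrite /h indicE /I1 mem_setE in_itv /=; case: (leP r 1) => _.
    by rewrite mulr1 -EFinM.
  by rewrite mulr0 mule0.
apply: le_lt_trans; apply: lee_pemull.
  apply: integral_ge0 => r; rewrite /= in_itv /= => /andP[r0 _].
  by rewrite lee_fin mulr_ge0// ltW.
by rewrite lee_fin; have := pi_ge2 R; lra.
Qed.

Lemma radial_lower_bound (V : plane R -> R) (C R1 R2 : R) : 0 < R1 ->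
  radially_symmetric V -> measurable_fun setT V ->
  {ae leb2 R, forall x : plane R, (disk 0 R2 `\` disk 0 R1) x -> C <= V x} ->
  exists N : set (measurableTypeR R), [/\ measurable N, mu N = 0%E &
    forall r, ~ N r -> R1 < r -> r < R2 -> C <= radial_value V r].
Proof.
move=> R10 rV mV Vge; have mVr := measurable_radial_value mV.
pose B : set (measurableTypeR R) :=
  `[R1, R2[%classic `&` (radial_value V @^-1` `]-oo, C[%classic).
have mB : measurable B.
  apply: measurableI; first exact: measurable_itv.
  by rewrite -[X in measurable X]setTI; apply: mVr => //; exact: measurable_itv.
have mp : @measurable _ (measurableTypeR R) `]0%R, +oo[%classic by exact: measurable_itv.
exists (B `&` `]0%R, +oo[%classic); split; first exact: measurableI.
- apply: null_radial => //; apply: measure_negligible.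
    by rewrite -[X in measurable X]setTI; exact: measurable_eucl.
  apply: negligibleS Vge => x [] /=; rewrite !in_itv /= => /andP[x1 x2] xC /= H.
  move: xC; rewrite -radial_valueE// ltNge => /negP; apply; apply: H.
  by split; rewrite /disk /= subr0// => /lt_le_trans /(_ x1); rewrite ltxx.
move=> r nB r1 r2; rewrite leNgt; apply/negP => rC; apply: nB; split.
  by split; rewrite /= in_itv /= ?rC// (ltW r1) r2.
by rewrite /= in_itv /= andbT (lt_trans R10).
Qed.

End radial_traces.

Theorem corollary1p1 (R : realType) (beta : R) (V : plane R -> R)
    (C R1 R2 C0 C1 C2 l0 l1 l2 : R)
    (beta_gt0 : 0 < beta)
    (V_loc : Lp_loc 1 V)
    (V_rad : radially_symmetric V)
    (C_gt0 : 0 < C) (R1_gt0 : 0 < R1) (R12 : R1 < R2)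
    (V_ge : {ae leb2 R, forall x : plane R,
               (disk 0 R2 `\` disk 0 R1) x -> C <= V x})
    (C0_gt0 : 0 < C0) (C1_gt0 : 0 < C1) (C2_gt0 : 0 < C2)
    (Vneg_infty : {ae leb1 R, forall r : R,
               1 <= r -> (radial_value V)^\- r <= C0 * r `^ l0})
    (Vpos_zero : {ae leb1 R, forall r : R,
               0 < r <= 1 -> (radial_value V)^\+ r <= C1 * r `^ l1})
    (Vpos_infty : {ae leb1 R, forall r : R,
               1 <= r -> (radial_value V)^\+ r <= C2 * r `^ l2})
    (hl0 : l0 < 2 * beta - 2) (hl1 : beta - 2 < l1) (hl2 : l2 < beta - 2) :
  exists psi : plane R -> R,
    [/\ radially_symmetric psi,
        H1_loc psi /\ Ck_on (~` [set 0]) 1 psi,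
        (leb2 R).-integrable setT (fun x => (V x * expR (psi x))%:E),
        weak_poisson psi (fun x => 4 * pi * beta * (V x * expR (psi x))) &
        \int[leb2 R]_x (V x * expR (psi x)) = 1].
Proof.
have [mV _] := V_loc; have mVr := measurable_radial_value mV.
have [Z4 [m4 z4 H4]] := radial_lower_bound R1_gt0 V_rad mV V_ge.
case: Vneg_infty => Z1 [m1 z1 H1]; case: Vpos_zero => Z2 [m2 z2 H2].
case: Vpos_infty => Z3 [m3 z3 H3].
(* One exceptional set of radii for all four almost-everywhere hypotheses, since [k] is set to zero
   on a single null set. *)
pose N : set (measurableTypeR R) := Z1 `|` Z2 `|` (Z3 `|` Z4).
have mN : measurable N by apply: measurableU; exact: measurableU.
have N0 : leb1 R N = 0%E.
  by rewrite null_set_setU ?null_set_setU//; exact: measurableU.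
have NE r : ~ N r -> [/\ ~ Z1 r, ~ Z2 r, ~ Z3 r & ~ Z4 r].
  by move=> Nr; split => Zr; apply: Nr; [left; left|left; right|right; left|right; right].
have powE (r l : R) : 0 < r -> r `^ l = expR (l * ln r) by move=> r0; rewrite /powR gt_eqF.
have pos0 r : ~ N r -> 0 < r -> r <= 1 -> radial_value V r <= C1 * expR (l1 * ln r).
  move=> /NE[_ Zr _ _] r0 r1; rewrite -powE//; have [Q|Q] := pselect (0 < r <= 1 ->
    (radial_value V)^\+ r <= C1 * r `^ l1); last by exfalso; apply: Zr; exact: H2.
  by apply: le_trans (Q _); rewrite ?r0 ?r1// /funrpos le_max lexx.
have pos1 r : ~ N r -> 1 <= r -> radial_value V r <= C2 * expR (l2 * ln r).
  move=> /NE[_ _ Zr _] r1; rewrite -powE//; last exact: lt_le_trans r1.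
  have [Q|Q] := pselect (1 <= r -> (radial_value V)^\+ r <= C2 * r `^ l2); last first.
    by exfalso; apply: Zr; exact: H3.
  by apply: le_trans (Q r1); rewrite /funrpos le_max lexx.
have neg1 r : ~ N r -> 1 <= r -> - (C0 * expR (l0 * ln r)) <= radial_value V r.
  move=> /NE[Zr _ _ _] r1; rewrite -powE//; last exact: lt_le_trans r1.
  have [Q|Q] := pselect (1 <= r -> (radial_value V)^\- r <= C0 * r `^ l0); last first.
    by exfalso; apply: Zr; exact: H1.
  by rewrite lerNl; apply: le_trans (Q r1); rewrite /funrneg le_max lexx.
have geC r : ~ N r -> R1 < r -> r < R2 -> C <= radial_value V r.
  by move=> /NE[_ _ _ /H4]; exact.
have [v [rho [e [s [Ev v0 ig Ig EL]]]]] := profile_exists beta_gt0 C0_gt0 C1_gt0 C2_gt0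
  C_gt0 R1_gt0 R12 mVr mN N0 geC pos0 pos1 neg1 (radial_value_loc V_rad V_loc) hl0 hl1 hl2.
set g := (fun r : measurableTypeR R => if 0 < r then _ else 0) in ig Ig EL.
pose Psi t := v t - 2 * beta * Num.max 0 t - s.
pose H (r : measurableTypeR R) := radial_value V r * expR (Psi (ln r)).
pose psi : plane R -> R := radial_profile Psi.
have g0 r : r <= 0 -> g r = 0 by move=> r0; rewrite /g ltNge r0.
have gH r : 0 < r -> g r = 2 * pi * r * H r by move=> r0; rewrite /g r0.
have mH : measurable_fun setT H.
  apply: measurable_funM => //; apply: measurableT_comp => //.
  apply: measurable_funB => //; apply: measurable_funB.
    apply: (measurableT_comp (f := v)); last exact: measurable_ln.
    by apply: continuous_measurable_fun; exact: energy_le_continuous Ev.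
  by apply: measurable_funM => //; apply: measurable_maxr => //; exact: measurable_ln.
have HE : (fun x : plane R => V x * expR (psi x)) = (fun x => H (eucl x)).
  by apply/funext => x; rewrite /H -radial_valueE.
exists psi; split.
- by move=> x y xy; rewrite /psi /radial_profile xy.
- split; first exact: (H1_loc_radial_profile s ig g0 beta_gt0 Ev EL v0).
  exact: (C1_radial_profile s ig g0 beta_gt0 EL).
- by have := integrable_radial mH ig g0 gH; rewrite -HE.
- have := weak_poisson_radial mH ig g0 gH
    (Lp_loc2_radial_profile s ig g0 beta_gt0 Ev EL v0)
    (Lp_loc2_radial_gradient1 ig g0 beta_gt0 Ev EL)
    (Lp_loc2_radial_gradient2 ig g0 beta_gt0 Ev EL)
    (fun=> erefl) (fun=> erefl) (weak_gradient_radial_profile s ig g0 beta_gt0 Ev EL v0).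
  by rewrite (_ : (fun x => _) = fun x => 4 * pi * beta * (V x * expR (psi x)))//;
    apply/funext => x; rewrite -(congr1 (@^~ x) HE).
- by rewrite HE (Rintegral_radial mH g0 gH).
Qed.
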